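(* There exist universal constants $0<c<C<\infty$ such that for all integers $k\ge 2$ and all integers $n\ge 2$ the following hold. (1) If $A=\{A_1,A_2,\dots,A_k\}$ is a partition of $S^{n-1}$ into $k$ measurable sets, each of $\sigma_n$-measure $1/k$, then $\sigma_{n-1}(\partial A)\ge c\sqrt{\log k}$. (2) If $k\le n$, then there is a partition $A=\{A_1,A_2,\dots,A_{2k}\}$ of $S^{n-1}$ into $2k$ measurable sets, each of $\sigma_n$-measure $1/(2k)$, such that $\sigma_{n-1}(\partial A)\le C\sqrt{\log k}$.
   Context: $S^{n-1}$ is the Euclidean unit sphere in $\mathbb{R}^n$ and $\sigma_n$ is its normalized Haar measure (the rotation-invariant Borel probability measure on $S^{n-1}$). A partition of $S^{n-1}$ into $m$ measurable sets is a collection $A=\{A_1,\dots,A_m\}$ of pairwise disjoint measurable sets whose union is $S^{n-1}$. For $B\subseteq S^{n-1}$ and $\varepsilon>0$, $B_\varepsilon=\{x\in S^{n-1} : \inf_{b\in B}d(x,b)<\varepsilon\}$ is the $\varepsilon$-neighborhood of $B$ in the geodesic distance $d$ on $S^{n-1}$. The $\varepsilon$-boundary of a partition $A=\{A_1,\dots,A_m\}$ is $$\partial_\varepsilon A=\bigcup_{i=1}^m\Big(\Big(\bigcup_{j\ne i}A_j\Big)_\varepsilon\setminus\bigcup_{j\ne i}A_j\Big),$$ and the measure of the boundary of $A$ (called in the paper the $(n-1)$-dimensional Haar measure of the boundary) is defined as $$\sigma_{n-1}(\partial A)=\liminf_{\varepsilon\to0^+}\frac{\sigma_n(\partial_\varepsilon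 A)}{\sqrt{2n/\pi}\,\varepsilon}\in[0,\infty].$$ The notation $\sigma_{n-1}(\partial A)$ stands only for this quantity; no set $\partial A$ is defined. *)

(* Defs.v *)
From HB Require Import structures.
From mathcomp Require Export all_boot all_order all_algebra.
From mathcomp Require Export all_classical all_reals all_analysis.
Set Implicit Arguments.
Unset Strict Implicit.
Unset Printing Implicit Defensive.
Import Order.TTheory GRing.Theory Num.Theory.
Import numFieldNormedType.Exports.
Local Open Scope classical_set_scope.
Local Open Scope ring_scope.

Section Sphere.
Variables (R : realType) (n : nat).

(* R^n with its Borel sigma-algebra. The topology of 'rV[R]_n is the one of the
   sup norm, which is also the Euclidean topology. *)
Definition borel_rV := g_sigma_algebraType (@open 'rV[R]_n).

Definition dotprod (x y : 'rV[R]_n) : R := \sum_(i < n) x 0 i * y 0 i.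

(* The norm `|x| of the library is the sup norm on 'rV[R]_n. *)
Definition euclid_norm (x : 'rV[R]_n) : R := Num.sqrt (dotprod x x).

(* S^(n-1). It is closed in R^n, so its Borel subsets are exactly the Borel
   subsets of R^n that it contains, and its Borel probability measures are the
   Borel probability measures of R^n that give it mass 1. *)
Definition sphere : set borel_rV := [set x : 'rV[R]_n | euclid_norm x = 1].

Definition rotation (U : 'M[R]_n) : Prop := U *m U^T = 1%:M /\ \det U = 1.

(* For n >= 2 exactly one measure satisfies this predicate. *)
Definition is_sphere_haar (sigma : probability borel_rV R) : Prop :=
  sigma sphere = 1%E /\
  forall (U : 'M[R]_n) (B : set borel_rV), rotation U -> measurable B ->
    sigma ((fun x : 'rV[R]_n => x *m U) @^-1` B) = sigma B.

(* Only meaningful for x and y in the sphere. *)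
Definition geodesic_dist (x y : 'rV[R]_n) : R := acos (dotprod x y).

(* The infimum is taken in \bar R, so that inf set0 = +oo and the neighborhood
   of the empty set is empty. *)
Definition sphere_nbhd (B : set borel_rV) (e : R) : set borel_rV :=
  [set x | sphere x /\
    (ereal_inf [set (geodesic_dist x b)%:E | b in B] < e%:E)%E].

Definition sphere_partition (m : nat) (A : 'I_m -> set borel_rV) : Prop :=
  [/\ forall i, measurable (A i), trivIset setT A & \bigcup_i A i = sphere].

Definition equal_measure (sigma : probability borel_rV R) (m : nat)
    (A : 'I_m -> set borel_rV) : Prop :=
  forall i, sigma (A i) = (m%:R^-1 : R)%:E.

Definition other_cells (m : nat) (A : 'I_m -> set borel_rV) (i : 'I_m) :
    set borel_rV :=
  \bigcup_(j in [set j | j != i]) A j.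

Definition eps_boundary (m : nat) (A : 'I_m -> set borel_rV) (e : R) :
    set borel_rV :=
  \bigcup_i (sphere_nbhd (other_cells A i) e `\` other_cells A i).

Definition boundary_measure (sigma : probability borel_rV R) (m : nat)
    (A : 'I_m -> set borel_rV) : \bar R :=
  limf_einf
    (fun e : R => sigma (eps_boundary A e) *
                  ((Num.sqrt (2 * n%:R / pi) * e)^-1)%:E)%E
    0^'+.

End Sphere.

(* Main.v *)
(* Under the standard Gaussian measure on R^n the direction x / |x| has law sigma:
   caps of a given radius have the same mass for both laws, and Christensen's
   argument concludes.

   Lower bound. Let f be the indicator of the cone over a cell of measure 1/k, and
   let X, Y be independent Gaussians. The chance that X and cos t X + sin t Y both lie
   in the cone decreases to at most 9/10 of 1/k for some t <= 4 / sqrt (ln k):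
   Loomis-Whitney gives the power bound k^(-5/4) at correlation 1/2, and each
   application of Cauchy-Schwarz passes from correlation c^2 to c. On the other hand
   f is, up to the mass of the e-boundary inside the cell, a function F of the
   direction that is (1/e)-Lipschitz and constant outside the e-boundary; splitting the
   rotation of angle t in infinitesimal steps, F moves on average by at most
   C t / (e sqrt n) times that mass. Hence the mass is at least
   c e sqrt n sqrt (ln k) / k.

   Upper bound. The cells are the regions of the sphere where a given one among the
   first k coordinates has the largest absolute value and a given sign. A point of the
   e-boundary has its two largest such absolute values within 2e of each other. By
   Fubini in the dominating coordinate and the hazard rate estimate
   P(M <= |g| <= M + d) <= C d (1 + M) P(|g| >= M), this has probability at most
   C e sqrt n E(1 + |g|; the coordinate g dominates), and on an event of probability
   1/k the mean of |g| is O(sqrt (ln k) / k). *)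
From HB Require Import structures.
Require Import Defs.
From mathcomp Require Import measurable_realfun ring lra.
Import Order.TTheory GRing.Theory Num.Theory.
Import numFieldNormedType.Exports.
Set Implicit Arguments.
Unset Strict Implicit.
Unset Printing Implicit Defensive.
Local Open Scope classical_set_scope.
Local Open Scope ring_scope.

(** * Standard Gaussian measures *)

(** The statement concerns any measure satisfying [is_sphere_haar], so a concrete model is needed
    for computations. Gaussian vectors provide it because two independent copies can be rotated into
    each other exactly: this makes the noise operators a semigroup and the mean motion along an
    angle subadditive. Loomis-Whitney stands where hypercontractivity would be usual. A fixed power
    gain at correlation 1/2 is enough: j square roots turn k^(-1/4) into a constant factor when 2^j
    is of order ln k, and the correlation 2^(-1/2^j) reached there has an angle of order 1 / sqrt
    (ln k). The distance to an arbitrary measurable set is replaced by the distance to a finite net,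
    squared and capped. Its increase along a move is controlled by keeping the nearest net point of
    the starting position; this bound is one-sided, and reversing the rotation supplies the other
    side. The remaining obstacle is the plane, where the mean of 1/|x|^2 diverges, so that
    second-order terms have to be truncated before they are integrated. *)

Section Density.
Local Open Scope ereal_scope.
Context d (T : measurableType d) (R : realType).
Variables (mu nu : {measure set T -> \bar R}) (p : T -> R).
Hypotheses (mp : measurable_fun setT p) (p0 : forall x, (0 <= p x)%R).
Hypothesis nuE : forall A, measurable A -> nu A = \int[mu]_(x in A) (p x)%:E.

Import HBNNSimple.

(** True for indicators by [nuE], hence for simple functions, and monotone convergence along
    [nnsfun_approx] does the rest. *)
Lemma ge0_integral_density (f : T -> \bar R) :
  measurable_fun setT f -> (forall x, 0 <= f x) ->
  \int[nu]_x f x = \int[mu]_x (f x * (p x)%:E).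
Proof.
move=> mf f0; pose g := nnsfun_approx measurableT mf.
have glim x : f x = limn (fun n => (g n x)%:E).
  by apply/esym/cvg_lim => //; exact: cvg_nnsfun_approx.
have gnd x : {homo (fun n => (g n x)%:E) : m n / (m <= n)%N >-> m <= n}.
  by move=> m n mn; rewrite lee_fin; exact/lefP/nd_nnsfun_approx.
have mpE : measurable_fun setT (EFin \o p) by exact/measurable_EFinP.
transitivity (limn (fun n => \int[nu]_x (g n x)%:E)).
  rewrite -monotone_convergence//.
  - exact: eq_integral.
  - by move=> n; exact/measurable_EFinP.
  - by move=> n x _; rewrite lee_fin.
transitivity (limn (fun n => \int[mu]_x ((g n x)%:E * (p x)%:E))); last first.
  rewrite -monotone_convergence//.
  - apply: eq_integral => x _; rewrite glim.
    apply/cvg_lim => //; apply: cvgeZr => //.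
    by rewrite -glim; exact: cvg_nnsfun_approx.
  - move=> n; apply: emeasurable_funM => //; exact/measurable_EFinP.
  - by move=> n x _; rewrite mule_ge0// lee_fin.
  - by move=> x _ m n mn; rewrite lee_wpmul2r ?lee_fin ?p0//; exact/lefP/nd_nnsfun_approx.
congr (limn _); apply/funext => n.
under eq_integral do rewrite fimfunE -fsumEFin//.
rewrite ge0_integral_fsum//; last 2 first.
- by move=> y; exact/measurable_EFinP/measurable_funM.
- by move=> y x _; rewrite nnfun_muleindic_ge0.
under [RHS]eq_integral => x _.
  rewrite fimfunE -fsumEFin// ge0_mule_fsuml; last first.
    by move=> y; rewrite nnfun_muleindic_ge0.
  over.
rewrite ge0_integral_fsum//; last 2 first.
- move=> y; apply: emeasurable_funM => //.
  by apply/measurable_EFinP/measurable_funM.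
- by move=> y x _; rewrite mule_ge0 ?lee_fin ?p0// -lee_fin nnfun_muleindic_ge0.
apply: eq_fsbigr => r rg.
have r0 : (0 <= r)%R by move: rg; rewrite inE => -[x _ <-].
rewrite integralZl_indic_nnsfun// integral_indic// setIT nuE//.
under [RHS]eq_integral do rewrite EFinM -muleA.
rewrite ge0_integralZl_EFin//=; last 2 first.
- by move=> x _; rewrite mule_ge0 ?lee_fin ?p0.
- by apply: emeasurable_funM => //; exact/measurable_EFinP.
congr (_ * _); rewrite integral_mkcond; apply: eq_integral => x _.
rewrite patchE indicE.
by case: ifPn => _; rewrite ?mul1e ?mul0e.
Qed.
End Density.

(** * Shears and rotations of the plane preserve Lebesgue measure *)

Section Translation.
Local Open Scope ereal_scope.
Context (R : realType).
Notation mu := (@lebesgue_measure R).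
Notation RT := (measurableTypeR R).

Lemma lebesgue_measure_shift (a : R) (A : set R) : measurable A ->
  pushforward mu (fun x => x + a : measurableTypeR R)%R A = mu A.
Proof.
have ms : measurable_fun setT (fun x : R => (x + a)%R : measurableTypeR R).
  exact: measurable_funD.
move=> mA.
pose m := isMeasurableFun.Build _ _ _ _ _ ms.
pose sh : {mfun _ >-> _} := HB.pack (fun x : R => (x + a)%R : measurableTypeR R) m.
apply/esym/(@lebesgue_measure_unique _ (pushforward mu sh)) => //= _ [[b c]] _ <-.
rewrite /pushforward.
have -> : (fun x : R => (x + a)%R) @^-1` `]b, c] = `](b - a)%R, (c - a)%R]%classic.
  by apply/seteqP; split => x /=; rewrite !in_itv/= ltrBlDr lerBrDr.
rewrite !lebesgue_measure_itv/= !lte_fin ltrD2r.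
by case: ifP => // _; rewrite -!EFinD; congr EFin; ring.
Qed.

Lemma ge0_integral_shift (a : R) (f : R -> \bar R) :
  measurable_fun setT f -> (forall x, 0 <= f x) ->
  \int[mu]_x f (x + a)%R = \int[mu]_x f x.
Proof.
move=> mf f0.
have ms : measurable_fun setT (fun x : measurableTypeR R => (x + a)%R : measurableTypeR R).
  exact: measurable_funD.
rewrite -[LHS](@ge0_integral_pushforward _ _ _ _ _ _ ms mu setT f)//.
by apply: eq_measure_integral => //= A mA _; exact: lebesgue_measure_shift.
Qed.

Lemma shear_lebesgue (a : R) (F : RT * RT -> \bar R) :
  measurable_fun setT F -> (forall x, 0 <= F x) ->
  \int[mu]_x \int[mu]_y F (x + a * y, y)%R = \int[mu]_x \int[mu]_y F (x, y).
Proof.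
move=> mF F0.
have mG : measurable_fun setT (fun p : RT * RT => F (p.1 + a * p.2, p.2)%R).
  apply: measurableT_comp => //; apply/measurable_fun_pair => //=.
  by apply: measurable_funD => //; exact: measurable_funM.
apply: (etrans (fubini_tonelli (m1 := mu) (m2 := mu) _ mG (fun=> F0 _))).
apply: (etrans _ (esym (fubini_tonelli (m1 := mu) (m2 := mu) F mF F0))).
apply: eq_integral => y _.
apply: (ge0_integral_shift (a * y)%R (f := fun x => F (x, y))) => //.
exact: measurableT_comp.
Qed.

Lemma shear_lebesgue2 (a : R) (F : RT * RT -> \bar R) :
  measurable_fun setT F -> (forall x, 0 <= F x) ->
  \int[mu]_x \int[mu]_y F (x, y + a * x)%R = \int[mu]_x \int[mu]_y F (x, y).
Proof.
move=> mF F0.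
apply: eq_integral => x _.
apply: (ge0_integral_shift (a * x)%R (f := fun y => F (x, y))) => //.
exact: measurableT_comp.
Qed.

(** A rotation is a product of three shears, by [a], [- s] and [a], each of which preserves the
    measure by Fubini and translation. Here [a = s / (1 + c)] is the tangent of half the angle,
    which is infinite for the half turn [c = -1]. *)
Lemma rotation_lebesgue_neq (c s : R) (F : RT * RT -> \bar R) :
  measurable_fun setT F -> (forall x, 0 <= F x) ->
  (c ^+ 2 + s ^+ 2 = 1)%R -> c != (-1)%R ->
  \int[mu]_x \int[mu]_y F (c * x + s * y, - s * x + c * y)%R =
  \int[mu]_x \int[mu]_y F (x, y).
Proof.
move=> mF F0 cs c1.
have c0 : (1 + c != 0)%R by rewrite addrC -subr_eq0 opprK in c1 *.
pose a := (s / (1 + c))%R.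
have s2 : (s * s = 1 - c * c)%R by rewrite -!expr2 -cs addrAC subrr add0r.
have ab : (1 - a * s = c)%R.
  by rewrite /a mulrAC s2; field.
have aa : (a + (a + a * (- s) * a) = s)%R.
  have -> : (a + (a + a * (- s) * a) = a * (1 + (1 - a * s)))%R by ring.
  by rewrite ab /a divfK.
have mS (e : R) : measurable_fun setT
    (fun p : RT * RT => (p.1 + e * p.2, p.2)%R : RT * RT).
  by apply/measurable_fun_pair => //=; apply: measurable_funD => //; exact: measurable_funM.
have mS2 (e : R) : measurable_fun setT
    (fun p : RT * RT => (p.1, p.2 + e * p.1)%R : RT * RT).
  by apply/measurable_fun_pair => //=; apply: measurable_funD => //; exact: measurable_funM.
apply: (etrans _ (shear_lebesgue a mF F0)).
have mF1 := measurableT_comp mF (mS a).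
apply: (etrans _ (shear_lebesgue2 (- s)%R mF1 (fun=> F0 _))).
have mF2 := measurableT_comp mF1 (mS2 (- s)%R).
apply: (etrans _ (shear_lebesgue a mF2 (fun=> F0 _))).
apply: eq_integral => x _; apply: eq_integral => y _ /=.
congr (F (_, _)).
  rewrite -{1}aa -{1}ab; ring.
by rewrite -{1}ab; ring.
Qed.

(** The half turn left out by the shears is two quarter turns. *)
Lemma rotation_lebesgue (c s : R) (F : RT * RT -> \bar R) :
  measurable_fun setT F -> (forall x, 0 <= F x) ->
  (c ^+ 2 + s ^+ 2 = 1)%R ->
  \int[mu]_x \int[mu]_y F (c * x + s * y, - s * x + c * y)%R =
  \int[mu]_x \int[mu]_y F (x, y).
Proof.
move=> mF F0 cs; have [c1|c1] := eqVneq c (-1)%R; last exact: rotation_lebesgue_neq.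
have s0 : s = 0%R.
  by apply/eqP; rewrite -sqrf_eq0; move: cs; rewrite c1 sqrrN expr1n -[X in _ = X]addr0 => /addrI ->.
have n1 : (0 != -1 :> R)%R by rewrite eq_sym oppr_eq0 oner_eq0.
have e1 : (0 ^+ 2 + 1 ^+ 2 = 1 :> R)%R by rewrite expr0n/= add0r expr1n.
apply: (etrans _ (rotation_lebesgue_neq mF F0 e1 n1)).
have mG : measurable_fun setT
    (fun p : RT * RT => F (0 * p.1 + 1 * p.2, - 1 * p.1 + 0 * p.2)%R).
  apply: (measurableT_comp mF) => //=; apply/measurable_fun_pair => /=;
    by apply: measurable_funD; exact: measurable_funM.
apply: (etrans _ (rotation_lebesgue_neq mG (fun=> F0 _) e1 n1)).
apply: eq_integral => x _; apply: eq_integral => y _ /=.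
by rewrite s0 c1; congr (F (_, _)); ring.
Qed.
End Translation.

(** * The normal law on the line *)

Section Normal.
Local Open Scope ereal_scope.
Context (R : realType).
Notation mu := (@lebesgue_measure R).
Notation RT := (measurableTypeR R).
Definition std_normal : probability RT R := normal_prob 0%R 1%R.

Lemma std_normalE (f : RT -> \bar R) :
  measurable_fun setT f -> (forall x, 0 <= f x) ->
  \int[std_normal]_x f x = \int[mu]_x (f x * (normal_pdf 0%R 1%R x)%:E).
Proof.
move=> mf f0; apply: (@ge0_integral_density _ RT _ mu) => //.
- exact: measurable_normal_pdf.
- by move=> x; exact: normal_pdf_ge0.
Qed.

Lemma normal_pdf01 (x : R) :
  normal_pdf 0 1 x = (normal_peak 1 * expR (- (x ^+ 2 / 2)))%R.
Proof. by rewrite normal_pdfE ?oner_eq0// /normal_fun subr0 expr1n mulNr. Qed.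

Lemma std_normal2E (F : RT * RT -> \bar R) :
  measurable_fun setT F -> (forall x, 0 <= F x) ->
  \int[std_normal]_x \int[std_normal]_y F (x, y) =
  \int[mu]_x \int[mu]_y (F (x, y) * (normal_peak 1 ^+ 2 *
     expR (- ((x ^+ 2 + y ^+ 2) / 2)))%:E).
Proof.
move=> mF F0.
have mp : measurable_fun setT (fun x : RT => (normal_pdf 0%R 1%R x)%:E).
  by apply/measurable_EFinP; exact: measurable_normal_pdf.
rewrite std_normalE; last 2 first.
- apply: (measurable_fun_fubini_tonelli_F (m2 := std_normal) F) => //.
- by move=> x; apply: integral_ge0.
apply: eq_integral => x _.
rewrite std_normalE; last 2 first.
- exact: measurableT_comp.
- by [].
rewrite -ge0_integralZr//; last 3 first.
- by apply: emeasurable_funM => //; exact: measurableT_comp.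
- by move=> y _; rewrite mule_ge0// lee_fin normal_pdf_ge0.
- by rewrite lee_fin normal_pdf_ge0.
apply: eq_integral => y _; rewrite -muleA -EFinM; congr (_ * _%:E).
rewrite !normal_pdf01 mulrDl opprD expRD; ring.
Qed.

(** The joint density depends on x^2 + y^2 only. *)
Lemma rotation_std_normal (c s : R) (F : RT * RT -> \bar R) :
  measurable_fun setT F -> (forall x, 0 <= F x) ->
  (c ^+ 2 + s ^+ 2 = 1)%R ->
  \int[std_normal]_x \int[std_normal]_y F (c * x + s * y, - s * x + c * y)%R =
  \int[std_normal]_x \int[std_normal]_y F (x, y).
Proof.
move=> mF F0 cs.
have mrot : measurable_fun setT
   (fun p : RT * RT => (c * p.1 + s * p.2, - s * p.1 + c * p.2)%R : RT * RT).
  by apply/measurable_fun_pair => /=; apply: measurable_funD; exact: measurable_funM.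
pose G (p : RT * RT) := F p * (normal_peak 1 ^+ 2 *
     expR (- ((p.1 ^+ 2 + p.2 ^+ 2) / 2)))%:E.
apply: (etrans (std_normal2E (measurableT_comp mF mrot) (fun=> F0 _))).
apply: (etrans _ (esym (std_normal2E mF F0))).
have mG : measurable_fun setT G.
  apply: emeasurable_funM => //; apply/measurable_EFinP.
  apply: measurable_funM => //; apply: measurableT_comp => //=.
  apply: measurableT_comp => //=; apply: measurable_funM => //.
  by apply: measurable_funD; apply: measurable_funX.
have G0 p : 0 <= G p by rewrite mule_ge0// lee_fin mulr_ge0 ?expR_ge0// sqr_ge0.
apply: (etrans _ (rotation_lebesgue mG G0 cs)).
apply: eq_integral => x _; apply: eq_integral => y _ /=.
have e : ((c * x + s * y) ^+ 2 + (- s * x + c * y) ^+ 2 = x ^+ 2 + y ^+ 2)%R.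
  transitivity ((c ^+ 2 + s ^+ 2) * (x ^+ 2 + y ^+ 2))%R; first by ring.
  by rewrite cs mul1r.
by rewrite /G/= e.
Qed.

(** The integrand times the standard density is [t] times the density of the centered normal law of
    deviation [t]. The choices t = sqrt 2 and t = 1 / sqrt (1 + 2 l) give the two exponential
    moments used below. *)
Lemma std_normal_expsqr (t : R) : (0 < t)%R ->
  \int[std_normal]_x (expR ((1 - t ^-2) * (x ^+ 2 / 2)))%:E = t%:E.
Proof.
move=> t0.
rewrite std_normalE; last 2 first.
- apply/measurable_EFinP; apply: measurableT_comp => //.
  by apply: measurable_funM => //; apply: measurable_funM => //; exact: measurable_funX.
- by move=> x; rewrite lee_fin expR_ge0.
transitivity (\int[mu]_x (t%:E * (normal_pdf 0%R t x)%:E)).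
  apply: eq_integral => x _; rewrite -!EFinM; congr EFin.
  rewrite normal_pdf01 normal_pdfE ?gt_eqF// /normal_fun subr0.
  rewrite mulrCA -expRD [RHS]mulrA; congr (_ * _)%R; last first.
    by congr expR; field; rewrite gt_eqF.
  rewrite /normal_peak expr1n -!mulrnAr mul1r [X in (t * X^-1)%R]sqrtrM ?sqr_ge0// sqrtr_sqr gtr0_norm//.
  by rewrite invfM mulrA divff ?mul1r// gt_eqF.
rewrite ge0_integralZl_EFin// ?ltW//.
- by rewrite integral_normal_pdf mule1.
- by move=> x _; rewrite lee_fin normal_pdf_ge0.
- by apply/measurable_EFinP; exact: measurable_normal_pdf.
Qed.
End Normal.

(** * Measurability of vector operations *)

Lemma measurable_lt d (X : measurableType d) (R : realType) (f g : X -> R) :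
  measurable_fun setT f -> measurable_fun setT g ->
  measurable [set x | f x < g x].
Proof.
move=> mf mg; rewrite -[X in measurable X]setTI.
exact: (measurable_fun_ltr mf mg measurableT (Y := [set true])).
Qed.

Lemma measurable_le d (X : measurableType d) (R : realType) (f g : X -> R) :
  measurable_fun setT f -> measurable_fun setT g ->
  measurable [set x | f x <= g x].
Proof.
move=> mf mg; rewrite -[X in measurable X]setTI.
exact: (measurable_fun_ler mf mg measurableT (Y := [set true])).
Qed.

Section BorelRV.
Context (R : realType).
Notation T n := (borel_rV R n).

Lemma open_measurable_rV n (A : set 'rV[R]_n) : open A -> measurable (A : set (T n)).
Proof. by move=> oA; exact: sub_sigma_algebra. Qed.

Lemma measurable_coord n (i : 'I_n) :
  measurable_fun setT (fun x : T n => (x : 'rV[R]_n) 0 i).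
Proof.
apply: (measurability _ (RGenOpens.measurableE R)) => _ -[_ [a [b ->]] <-].
rewrite setTI; apply: open_measurable_rV.
apply: open_comp; last exact: interval_open.
by move=> x _; exact: coord_continuous.
Qed.

(* Every open set is a countable union of rational sup-norm balls. *)
Lemma measurable_rV d (X : measurableType d) n (f : X -> T n) :
  (forall i, measurable_fun setT (fun x => (f x : 'rV[R]_n) 0 i)) ->
  measurable_fun setT f.
Proof.
move=> mf; apply: (@measurability _ _ X (T n) setT f (@open 'rV[R]_n)) => // _ [A oA <-]; rewrite setTI.
pose B (q : 'rV[rat]_n * nat) : set 'rV[R]_n :=
  [set y | forall i, `|ratr (q.1 0 i) - y 0 i| < q.2.+1%:R^-1].
pose D := [set q | B q `<=` A].
have -> : A = \bigcup_(q in D) B q.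
  apply/seteqP; split=> [x Ax|x [q Dq]]; last exact: Dq.
  have [e /= e0 xeA] : exists2 e : R, 0 < e & ball x e `<=` A.
    by move: oA; rewrite openE => /(_ x Ax) /nbhs_ballP[e e0 xeA]; exists e.
  have e20 : 0 < e / 2 by rewrite divr_gt0.
  have [N _ /(_ N (leqnn N)) /= Ne] := near_infty_natSinv_lt (PosNum e20).
  have /choice[q qx] i : exists q : rat, `|x 0 i - ratr q| < N.+1%:R^-1 :> R.
    have : x 0 i - N.+1%:R^-1 < x 0 i + N.+1%:R^-1 :> R.
      by rewrite ltrD2l gtrN// invr_gt0.
    move=> /rat_in_itvoo[q]; rewrite in_itv/= => /andP[q1 q2].
    by exists q; rewrite ltr_distlC q1 q2.
  exists (\row_i q i, N) => /=.
    move=> y By; apply: xeA; split => // j i; rewrite ord1 {j}.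
    have := By i; rewrite /= mxE => yi.
    have -> : e = e / 2 + e / 2 by field.
    rewrite /ball/=; apply: (le_lt_trans (ler_distD (ratr (q i)) _ _)).
    by apply: ltrD; [exact: (lt_trans (qx i))|exact: (lt_trans yi)].
  by move=> i; rewrite /= mxE distrC qx.
rewrite preimage_bigcup bigcup_mkcond; apply: countable_bigcupT_measurable => // q.
case: ifPn => // _.
have -> : f @^-1` B q = \bigcap_(i in setT)
    [set x | `|ratr (q.1 0 i) - (f x : 'rV[R]_n) 0 i| < q.2.+1%:R^-1].
  by apply/seteqP; split => x /= h i; [move=> _|]; exact: h.
apply: fin_bigcap_measurable => // i _.
apply: measurable_lt => //.
by apply: measurableT_comp => //; exact: measurable_funB.
Qed.

Lemma measurable_coord_comp d (X : measurableType d) n (f : X -> T n) i :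
  measurable_fun setT f -> measurable_fun setT (fun x => (f x : 'rV[R]_n) 0 i).
Proof. by move=> mf; exact: (measurableT_comp (measurable_coord i) mf). Qed.

Lemma measurable_rVD d (X : measurableType d) n (f g : X -> T n) :
  measurable_fun setT f -> measurable_fun setT g ->
  measurable_fun setT (fun x => (f x : 'rV[R]_n) + (g x : 'rV[R]_n) : T n).
Proof.
move=> mf mg; apply: measurable_rV => i; under eq_fun do rewrite mxE.
by apply: measurable_funD; exact: measurable_coord_comp.
Qed.

Lemma measurable_rVZ d (X : measurableType d) n (a : X -> R) (f : X -> T n) :
  measurable_fun setT a -> measurable_fun setT f ->
  measurable_fun setT (fun x => a x *: (f x : 'rV[R]_n) : T n).
Proof.
move=> ma mf; apply: measurable_rV => i; under eq_fun do rewrite mxE.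
by apply: measurable_funM => //; exact: measurable_coord_comp.
Qed.

Lemma measurable_dotprod d (X : measurableType d) n (f g : X -> T n) :
  measurable_fun setT f -> measurable_fun setT g ->
  measurable_fun setT (fun x => dotprod (f x) (g x)).
Proof.
move=> mf mg; apply: measurable_sum => i.
by apply: measurable_funM; exact: measurable_coord_comp.
Qed.

Lemma measurable_sqrt : measurable_fun setT (@Num.sqrt R).
Proof. by apply: continuous_measurable_fun => x; exact: sqrt_continuous. Qed.

Lemma measurable_euclid_norm d (X : measurableType d) n (f : X -> T n) :
  measurable_fun setT f -> measurable_fun setT (fun x => euclid_norm (f x)).
Proof.
by move=> mf; apply: (measurableT_comp measurable_sqrt); exact: measurable_dotprod.
Qed.

Lemma measurable_inv : measurable_fun setT (fun x : R => x^-1).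
Proof.
rewrite (_ : setT = [set 0] `|` ~` [set 0] :> set R); last by rewrite setUv.
apply/measurable_funU => //; first exact: measurableC.
split; first exact: measurable_fun_set1.
apply: open_continuous_measurable_fun.
  by apply: closed_openC; exact: closed_eq.
by move=> x; rewrite inE/= => x0; apply: inv_continuous; apply/eqP.
Qed.

(** Since [0^-1 = 0], the direction of the zero vector is 0, which lies off the sphere; this point
    is later discarded as null or treated apart. *)
Definition direction n (x : T n) : T n := (euclid_norm x)^-1 *: (x : 'rV[R]_n).

Lemma measurable_direction n : measurable_fun setT (@direction n).
Proof.
apply: measurable_rVZ => //; apply: (measurableT_comp measurable_inv).
exact: measurable_euclid_norm.
Qed.

Lemma measurable_sphere n : measurable (@sphere R n).
Proof.
rewrite (_ : @sphere R n = (fun x : T n => euclid_norm x) @^-1` [set 1]) //.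
by rewrite -[X in measurable X]setTI; exact: measurable_euclid_norm.
Qed.

(** Identifies R x R^n with R^(n+1), the new coordinate having index 0. *)
Definition rcons0 n (p : measurableTypeR R * T n) : T n.+1 :=
  \row_i oapp ((p.2 : 'rV[R]_n) 0) p.1 (unlift ord0 i).

Lemma rcons0E0 n p : (@rcons0 n p : 'rV_n.+1) 0 ord0 = p.1.
Proof. by rewrite mxE unlift_none. Qed.

Lemma rcons0ES n p i : (@rcons0 n p : 'rV_n.+1) 0 (lift ord0 i) = (p.2 : 'rV_n) 0 i.
Proof. by rewrite mxE liftK. Qed.

Lemma measurable_rcons0 n : measurable_fun setT (@rcons0 n).
Proof.
apply: measurable_rV => i.
case: (unliftP ord0 i) => [j ->|->].
  under eq_fun do rewrite rcons0ES.
  exact: (measurable_coord_comp j measurable_snd).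
under eq_fun do rewrite rcons0E0.
exact: measurable_fst.
Qed.

Lemma dotprod_rcons0 n p q :
  dotprod (@rcons0 n p) (rcons0 q) = p.1 * q.1 + dotprod p.2 q.2.
Proof.
rewrite /dotprod big_ord_recl !rcons0E0; congr (_ + _).
by apply: eq_bigr => i _; rewrite !rcons0ES.
Qed.

Lemma rV_rcons0 n (x : 'rV[R]_n.+1) : x = rcons0 (x 0 ord0, \row_i x 0 (lift ord0 i)).
Proof.
apply/rowP => i; case: (unliftP ord0 i) => [j ->|->].
  by rewrite rcons0ES mxE.
by rewrite rcons0E0.
Qed.
End BorelRV.

(** * Gaussian measures in every dimension *)

Section Gauss.
Local Open Scope ereal_scope.
Context (R : realType).
Notation T n := (borel_rV R n).
Notation RT := (measurableTypeR R).
Notation N := (std_normal R).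

HB.instance Definition _ n := isMeasurableFun.Build _ _ _ _ _ (@measurable_rcons0 R n).

(** Built one coordinate at a time, so that its properties follow by induction on the dimension from
    the normal law on the line. *)
Fixpoint gauss n : probability (T n) R :=
  if n is m.+1 then distribution (N \x gauss m) (@rcons0 R m)
  else @dirac _ (T 0) (0%R : 'rV[R]_0) R.

Lemma integral_gaussS n (F : T n.+1 -> \bar R) :
  measurable_fun setT F -> (forall x, 0 <= F x) ->
  \int[gauss n.+1]_x F x = \int[N]_a \int[gauss n]_v F (rcons0 (a, v)).
Proof.
move=> mF F0.
rewrite [LHS]ge0_integral_distribution//.
have mG : measurable_fun setT (F \o @rcons0 R n).
  by apply: measurableT_comp => //; exact: measurable_rcons0.
exact: (fubini_tonelli1 _ mG (fun=> F0 _)).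
Qed.

Lemma integral_gauss0 (F : T 0 -> \bar R) :
  measurable_fun setT F ->
  \int[gauss 0]_x F x = F (0%R : 'rV[R]_0).
Proof. by move=> mF; rewrite integral_dirac// diracT mul1e. Qed.

End Gauss.

(** * Rotational invariance of Gaussian measures *)

Section GaussInvariance.
Local Open Scope ereal_scope.
Context (R : realType).
Notation T n := (borel_rV R n).
Notation RT := (measurableTypeR R).
Notation N := (std_normal R).
Notation g := (gauss R).

Lemma measurable_partial_integral d1 d2 (X : measurableType d1) (Y : measurableType d2)
    (P : probability Y R) (f : X * Y -> \bar R) :
  measurable_fun setT f -> (forall p, 0 <= f p) ->
  measurable_fun setT (fun x => \int[P]_y f (x, y)).
Proof. by move=> mf f0; exact: (measurable_fun_fubini_tonelli_F (m2 := P) f). Qed.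

Lemma measurable_pair_rcons0 n :
  measurable_fun setT (fun p : (RT * RT) * T n * T n =>
    (rcons0 (p.1.1.1, p.1.2), rcons0 (p.1.1.2, p.2))).
Proof.
apply/measurable_fun_pair; apply: (measurableT_comp (@measurable_rcons0 R n)).
- apply/measurable_fun_pair; last exact: (measurableT_comp measurable_snd measurable_fst).
  apply: (measurableT_comp measurable_fst); exact: (measurableT_comp measurable_fst measurable_fst).
- apply/measurable_fun_pair; last exact: measurable_snd.
  apply: (measurableT_comp measurable_snd); exact: (measurableT_comp measurable_fst measurable_fst).
Qed.

Lemma measurable_rcons0_l n (a : R) : measurable_fun setT (fun v : T n => rcons0 (a, v)).
Proof. exact: (measurableT_comp (@measurable_rcons0 R n) (pair1_measurable a)). Qed.

(** Exchanging the two middle integrals brings the two first coordinates together and leaves the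
    pair of remaining vectors to an induction on the dimension. *)
Lemma integral2_gaussS n (H : T n.+1 * T n.+1 -> \bar R) :
  measurable_fun setT H -> (forall p, 0 <= H p) ->
  \int[g n.+1]_x \int[g n.+1]_y H (x, y) =
  \int[N]_a \int[N]_b \int[g n]_v \int[g n]_w H (rcons0 (a, v), rcons0 (b, w)).
Proof.
move=> mH H0.
apply: (etrans (integral_gaussS (measurable_partial_integral (g n.+1) mH H0) _)).
  by move=> x; exact: integral_ge0.
apply: eq_integral => a _.
pose K := fun p : T n * RT => \int[g n]_w H (rcons0 (a, p.1), rcons0 (p.2, w)).
have mK0 : measurable_fun setT (fun p : T n * RT * T n =>
    H (rcons0 (a, p.1.1), rcons0 (p.1.2, p.2))).
  apply: (measurableT_comp mH); apply/measurable_fun_pair.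
    apply: (measurableT_comp (measurable_rcons0_l a)).
    exact: (measurableT_comp measurable_fst measurable_fst).
  apply: (measurableT_comp (@measurable_rcons0 R n)).
  apply/measurable_fun_pair; last exact: measurable_snd.
  exact: (measurableT_comp measurable_snd measurable_fst).
have mK : measurable_fun setT K.
  exact: (measurable_partial_integral (g n) mK0 (fun=> H0 _)).
have K0 p : 0 <= K p by exact: integral_ge0.
apply: (etrans _ (fubini_tonelli (m1 := g n) (m2 := N) K mK K0)).
apply: eq_integral => v _.
apply: integral_gaussS => //.
exact: (measurableT_comp mH (pair1_measurable _)).
Qed.

Lemma rcons0_lin n (c s a b : R) (v w : T n) :
  (c *: (rcons0 (a, v) : 'rV_n.+1) + s *: (rcons0 (b, w) : 'rV_n.+1))%R =
  rcons0 ((c * a + s * b)%R, (c *: (v : 'rV_n) + s *: (w : 'rV_n))%R : T n).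
Proof.
apply/rowP => i; case: (unliftP ord0 i) => [j ->|->].
  by rewrite rcons0ES !mxE !liftK.
by rewrite rcons0E0 !mxE !unlift_none.
Qed.

Definition rot n (c s : R) (p : T n * T n) : T n * T n :=
  ((c *: (p.1 : 'rV_n) + s *: (p.2 : 'rV_n))%R, (- s *: (p.1 : 'rV_n) + c *: (p.2 : 'rV_n))%R).

Lemma measurable_lin2 d (X : measurableType d) n (c s : R) (f h : X -> T n) :
  measurable_fun setT f -> measurable_fun setT h ->
  measurable_fun setT (fun x => (c *: (f x : 'rV_n) + s *: (h x : 'rV_n))%R : T n).
Proof. by move=> mf mh; apply: measurable_rVD; exact: measurable_rVZ. Qed.

Lemma measurable_rot n c s : measurable_fun setT (@rot n c s).
Proof. by apply/measurable_fun_pair; exact: measurable_lin2. Qed.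

(** By induction on the dimension: the induction hypothesis rotates the remaining coordinates while
    the first pair is fixed, and [rotation_std_normal] rotates that pair. *)
Lemma rotation_gauss n (c s : R) (F : T n * T n -> \bar R) :
  measurable_fun setT F -> (forall p, 0 <= F p) ->
  (c ^+ 2 + s ^+ 2 = 1)%R ->
  \int[g n]_x \int[g n]_y F (rot c s (x, y)) = \int[g n]_x \int[g n]_y F (x, y).
Proof.
move=> + + cs; elim: n F => [|n IH] F mF F0.
  have e0 (x : T 0) : x = (0%R : 'rV_0) by apply/rowP => -[].
  apply: eq_integral => x _; apply: eq_integral => y _; congr F.
  by rewrite (e0 x) (e0 y); congr (_, _); apply/rowP => -[].
apply: (etrans (integral2_gaussS (measurableT_comp mF (@measurable_rot n.+1 c s)) (fun=> F0 _))).
apply: (etrans _ (esym (integral2_gaussS mF F0))).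
pose M := fun p : (RT * RT) * T n * T n =>
  F (rcons0 (p.1.1.1, p.1.2), rcons0 (p.1.1.2, p.2)).
have mM : measurable_fun setT M by exact: (measurableT_comp mF (@measurable_pair_rcons0 n)).
have M0 p : 0 <= M p by exact: F0.
pose K := fun p : RT * RT => \int[g n]_v \int[g n]_w M ((p, v), w).
have mK : measurable_fun setT K.
  apply: (measurable_partial_integral (g n) (measurable_partial_integral (g n) mM M0)).
  by move=> p; exact: integral_ge0.
have K0 p : 0 <= K p by apply: integral_ge0 => v _; exact: integral_ge0.
apply: (etrans _ (rotation_std_normal mK K0 cs)).
apply: eq_integral => a _; apply: eq_integral => b _.
pose p := (c * a + s * b, - s * a + c * b)%R.
have mMp : measurable_fun setT (fun q : T n * T n => M ((p, q.1), q.2)).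
  apply: (measurableT_comp mM); apply/measurable_fun_pair => //.
  exact: (measurableT_comp (pair1_measurable p) measurable_fst).
apply: (etrans _ (IH _ mMp (fun=> M0 _))).
apply: eq_integral => v _; apply: eq_integral => w _.
by rewrite /M/= /rot/= !rcons0_lin.
Qed.

Lemma euclid_norm_sqr n (x : 'rV[R]_n) : (euclid_norm x ^+ 2 = dotprod x x)%R.
Proof. by rewrite sqr_sqrtr// sumr_ge0// => i _; rewrite -expr2 sqr_ge0. Qed.

Lemma euclid_norm_ge0 n (x : 'rV[R]_n) : (0 <= euclid_norm x)%R.
Proof. exact: sqrtr_ge0. Qed.

Lemma euclid_norm_rcons0 n (p : RT * T n) :
  (euclid_norm (rcons0 p) ^+ 2 = p.1 ^+ 2 + euclid_norm p.2 ^+ 2)%R.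
Proof. by rewrite !euclid_norm_sqr dotprod_rcons0 -expr2. Qed.

(** The half turn of the plane, applied to a function of the first coordinate. *)
Lemma std_normalN (f : RT -> \bar R) :
  measurable_fun setT f -> (forall x, 0 <= f x) ->
  \int[N]_x f (- x)%R = \int[N]_x f x.
Proof.
move=> mf f0.
have cs : ((-1) ^+ 2 + 0 ^+ 2 = 1 :> R)%R by rewrite sqrrN expr1n expr0n addr0.
have := rotation_std_normal (measurableT_comp mf measurable_fst) (fun=> f0 _) cs.
have e (h : RT -> \bar R) x : \int[N]_(y in setT) h x = h x.
  by rewrite integral_cst// [X in _ * X]probability_setT mule1.
under eq_integral => x _.
  under eq_integral do rewrite /= mulN1r mul0r addr0.
  rewrite e; over.
by under [in RHS]eq_integral => x _ do rewrite /= e.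
Qed.

(** Plays the part of invariance under orthogonal matrices: the joint law of <x, y> and |x|^2
    depends on y through |y| only. The induction hypothesis replaces the scalar product with the
    tail y' by |y'| times one coordinate, and a rotation of the first two coordinates merges y0 and
    |y'| into |y|. *)
Lemma gauss_radial n (y : 'rV[R]_n.+1) (psi : RT * RT -> \bar R) :
  measurable_fun setT psi -> (forall p, 0 <= psi p) ->
  \int[g n.+1]_x psi (dotprod x y, dotprod x x) =
  \int[g n.+1]_x psi (euclid_norm y * (x : 'rV_n.+1) 0 ord0, dotprod x x)%R.
Proof.
have mfull m (z : 'rV[R]_m.+1) f : measurable_fun setT f ->
    measurable_fun setT (fun x : T m.+1 => f (dotprod x z, dotprod x x) : \bar R).
  move=> mf; apply: (measurableT_comp mf); apply/measurable_fun_pair;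
    exact: measurable_dotprod.
have mfirst m (r : R) f : measurable_fun setT f ->
    measurable_fun setT (fun x : T m.+1 =>
      f (r * (x : 'rV_m.+1) 0 ord0, dotprod x x)%R : \bar R).
  move=> mf; apply: (measurableT_comp mf); apply/measurable_fun_pair.
    by apply: measurable_funM => //; exact: measurable_coord.
  exact: measurable_dotprod.
elim: n y psi => [|n IH] y psi mpsi psi0; rewrite (rV_rcons0 y).
  set y0 := y 0%R ord0; set y' := (\row_i _)%R.
  have d0 (v w : 'rV[R]_0) : dotprod v w = 0%R by rewrite /dotprod big_ord0.
  have yE : (euclid_norm (rcons0 (y0, y' : T 0)) = `|y0|)%R.
    by rewrite /euclid_norm dotprod_rcons0 d0 addr0/= -expr2 sqrtr_sqr.
  apply: (etrans (integral_gaussS (mfull _ _ _ mpsi) (fun=> psi0 _))).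
  apply: (etrans _ (esym (integral_gaussS (mfirst _ _ _ mpsi) (fun=> psi0 _)))).
  pose f := fun a : RT => psi (a * y0, a * a)%R.
  have mf : measurable_fun setT f.
    by apply: (measurableT_comp mpsi); apply/measurable_fun_pair; exact: measurable_funM.
  have e (h : RT -> \bar R) x : \int[g 0]_(v in setT) h x = h x.
    by rewrite integral_cst// [X in _ * X]probability_setT mule1.
  transitivity (\int[N]_a f a).
    apply: eq_integral => a _; rewrite -(e f); apply: eq_integral => v _.
    by rewrite /f !dotprod_rcons0 !d0 !addr0.
  (* In dimension one only the sign of [y0] is lost, and the symmetry of the normal law absorbs
     it. *)
  have [y00|/ltW y00] := leP 0%R y0; last rewrite -(std_normalN mf (fun=> psi0 _)).
    apply: eq_integral => a _; rewrite -(e f); apply: eq_integral => v _.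
    by rewrite /f yE !dotprod_rcons0 !d0 !addr0 rcons0E0/= ger0_norm// mulrC.
  apply: eq_integral => a _; rewrite -(e (fun a => f (- a)%R)); apply: eq_integral => v _.
  rewrite /f yE !dotprod_rcons0 !d0 !addr0 rcons0E0/= ler0_norm//.
  by rewrite mulrNN !mulNr mulrC.
set y0 := y 0%R ord0; set y' := (\row_i _)%R.
set r := euclid_norm (rcons0 (y0, y' : T n.+1)); set r' := euclid_norm y'.
have rE : (r ^+ 2 = y0 ^+ 2 + r' ^+ 2)%R by rewrite euclid_norm_rcons0.
pose L := fun p : RT * RT * T n =>
  psi (r * p.1.1, p.1.1 ^+ 2 + (p.1.2 ^+ 2 + dotprod p.2 p.2))%R.
have m1 : measurable_fun setT (fun p : RT * RT * T n => p.1.1).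
  exact: (measurableT_comp measurable_fst measurable_fst).
have m2 : measurable_fun setT (fun p : RT * RT * T n => p.1.2).
  exact: (measurableT_comp measurable_snd measurable_fst).
have mL : measurable_fun setT L.
  apply: (measurableT_comp mpsi); apply/measurable_fun_pair.
    exact: measurable_funM.
  apply: measurable_funD; first exact: measurable_funX.
  apply: measurable_funD; first exact: measurable_funX.
  by apply: measurable_dotprod; exact: measurable_snd.
have RHSE : \int[g n.+2]_x psi (r * (x : 'rV_n.+2) 0 ord0, dotprod x x)%R =
    \int[N]_a \int[N]_b \int[g n]_w L ((a, b), w).
  apply: (etrans (integral_gaussS (mfirst _ _ _ mpsi) (fun=> psi0 _))).
  apply: eq_integral => a _.
  apply: (etrans (integral_gaussS (measurableT_comp (mfirst _ _ _ mpsi) (measurable_rcons0_l a)) (fun=> psi0 _))).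
  apply: eq_integral => b _; apply: eq_integral => w _.
  by rewrite /L/= !dotprod_rcons0 rcons0E0/= -!expr2.
rewrite RHSE.
apply: (etrans (integral_gaussS (mfull _ _ _ mpsi) (fun=> psi0 _))).
transitivity (\int[N]_a \int[N]_b \int[g n]_w
    psi (a * y0 + r' * b, a ^+ 2 + (b ^+ 2 + dotprod w w))%R).
  apply: eq_integral => a _.
  have mpa : measurable_fun setT (fun p : RT * RT => psi (a * y0 + p.1, a ^+ 2 + p.2)%R).
    by apply: (measurableT_comp mpsi); apply/measurable_fun_pair; exact: measurable_funD.
  transitivity (\int[g n.+1]_x psi (a * y0 + r' * (x : 'rV_n.+1) 0 ord0,
      a ^+ 2 + dotprod x x)%R).
    rewrite -(IH y' _ mpa (fun=> psi0 _)).
    by apply: eq_integral => x _; rewrite !dotprod_rcons0 -expr2.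
  apply: (etrans (integral_gaussS (mfirst _ _ _ mpa) (fun=> psi0 _))).
  apply: eq_integral => b _; apply: eq_integral => w _.
  by rewrite dotprod_rcons0 rcons0E0/= -expr2.
have [r0|r0] := eqVneq r 0%R.
  have [y00 r'0] : y0 = 0%R /\ r' = 0%R.
    have : (y0 ^+ 2 + r' ^+ 2 == 0)%R by rewrite -rE r0 expr0n.
    by rewrite paddr_eq0 ?sqr_ge0// !sqrf_eq0 => /andP[/eqP ? /eqP ?].
  apply: eq_integral => a _; apply: eq_integral => b _; apply: eq_integral => w _.
  by rewrite /L/= r0 y00 r'0 mulr0 !mul0r addr0.
pose K := fun p : RT * RT => \int[g n]_w L (p, w).
have mK : measurable_fun setT K.
  exact: (measurable_partial_integral (g n) mL (fun=> psi0 _)).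
have K0 p : 0 <= K p by apply: integral_ge0 => w _; exact: psi0.
have cs : ((y0 / r) ^+ 2 + (r' / r) ^+ 2 = 1)%R.
  by rewrite !expr_div_n -mulrDl -rE divff ?sqrf_eq0.
apply: (etrans _ (rotation_std_normal mK K0 cs)).
apply: eq_integral => a _; apply: eq_integral => b _; apply: eq_integral => w _.
rewrite /L/=.
have -> : (r * (y0 / r * a + r' / r * b) = a * y0 + r' * b)%R by field.
have e : ((y0 / r * a + r' / r * b) ^+ 2 + (- (r' / r) * a + y0 / r * b) ^+ 2
  = a ^+ 2 + b ^+ 2)%R.
  rewrite -[RHS]mul1r -cs; ring.
by rewrite [in RHS]addrA e addrA.
Qed.
End GaussInvariance.

(** * Gaussian moments *)

Section IntegralOnT.
Local Open Scope ereal_scope.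
Context d (X : measurableType d) (R : realType) (mu : {measure set X -> \bar R}).
Implicit Types f : X -> \bar R.

Lemma integralZl_T (k : R) f : (0 <= k)%R -> measurable_fun setT f ->
  (forall x, 0 <= f x) -> \int[mu]_x (k%:E * f x) = k%:E * \int[mu]_x f x.
Proof. by move=> k0 mf f0; exact: ge0_integralZl_EFin. Qed.

Lemma integralD_T f1 f2 : measurable_fun setT f1 -> (forall x, 0 <= f1 x) ->
  measurable_fun setT f2 -> (forall x, 0 <= f2 x) ->
  \int[mu]_x (f1 x + f2 x) = \int[mu]_x f1 x + \int[mu]_x f2 x.
Proof. by move=> *; exact: ge0_integralD. Qed.

Lemma le_integral_T f1 f2 : measurable_fun setT f1 -> (forall x, 0 <= f1 x) ->
  measurable_fun setT f2 -> (forall x, f1 x <= f2 x) ->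
  \int[mu]_x f1 x <= \int[mu]_x f2 x.
Proof. by move=> mf1 f10 mf2 f12; exact: ge0_le_integral. Qed.
End IntegralOnT.

Lemma integral_cst_prob d (X : measurableType d) (R : realType)
    (P : probability X R) (k : \bar R) : (\int[P]_(x in setT) k = k)%E.
Proof. by rewrite integral_cst// [X in (_ * X)%E]probability_setT mule1. Qed.

Section GaussMoments.
Local Open Scope ereal_scope.
Context (R : realType).
Notation T n := (borel_rV R n).
Notation RT := (measurableTypeR R).
Notation N := (std_normal R).
Notation g := (gauss R).

Lemma measurable_expsqr (c : R) :
  measurable_fun setT (fun x : RT => (expR (c * x ^+ 2))%:E).
Proof.
apply/measurable_EFinP; apply: measurableT_comp => //.
by apply: measurable_funM => //; exact: measurable_funX.
Qed.

Lemma std_normal_exp4 :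
  \int[N]_x (expR (4^-1 * x ^+ 2))%:E = (Num.sqrt 2)%:E.
Proof.
have s2 : (0 < Num.sqrt 2 :> R)%R by rewrite sqrtr_gt0.
rewrite -(std_normal_expsqr s2); apply: eq_integral => x _; congr (expR _)%:E.
have -> : (Num.sqrt 2 ^- 2 = 2^-1 :> R)%R by rewrite sqr_sqrtr.
by field.
Qed.

Lemma measurable_sqrE : measurable_fun setT (fun x : RT => (x ^+ 2)%:E).
Proof. by apply/measurable_EFinP; exact: measurable_funX. Qed.

(** From x^2 <= 4 exp (x^2 / 4), whose mean 4 sqrt 2 is at most 6. *)
Lemma std_normal_sqr : \int[N]_x (x ^+ 2)%:E <= 6%:E.
Proof.
have e0 (x : RT) : 0 <= (expR (4^-1 * x ^+ 2))%:E by rewrite lee_fin expR_ge0.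
apply: (@le_trans _ _ (\int[N]_x (4%:E * (expR (4^-1 * x ^+ 2))%:E))).
  apply: le_integral_T => //.
  - exact: measurable_sqrE.
  - by move=> x; rewrite lee_fin sqr_ge0.
  - by apply: emeasurable_funM => //; exact: measurable_expsqr.
  - move=> x; rewrite -EFinM lee_fin.
    have := expR_ge1Dx (4^-1 * x ^+ 2)%R; lra.
rewrite (integralZl_T _ _ (measurable_expsqr _) e0)//.
rewrite std_normal_exp4 -EFinM lee_fin.
have : (Num.sqrt 2 <= 3 / 2 :> R)%R.
  by rewrite -(@ler_pXn2r _ 2) ?nnegrE ?sqrtr_ge0// sqr_sqrtr//; lra.
lra.
Qed.

Lemma std_normal_abs : \int[N]_x `|x|%:E <= 4%:E.
Proof.
have m1 : measurable_fun setT (fun x : RT => 1 + (x ^+ 2)%:E).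
  by apply: emeasurable_funD => //; exact: measurable_sqrE.
have s0 (x : RT) : 0 <= (x ^+ 2)%:E by rewrite lee_fin sqr_ge0.
apply: (@le_trans _ _ (\int[N]_x (2^-1%:E * (1 + (x ^+ 2)%:E)))).
  apply: le_integral_T => //.
  - by apply/measurable_EFinP; exact: normr_measurable.
  - by apply: emeasurable_funM.
  - move=> x; rewrite -EFinD -EFinM lee_fin -[(x ^+ 2)%R]real_normK ?num_real//.
    have := sqr_ge0 (`|x| - 1)%R; nra.
rewrite (integralZl_T _ _ m1)//; last by move=> x; rewrite adde_ge0.
rewrite (integralD_T _ _ _ measurable_sqrE)//.
rewrite integral_cst_prob.
apply: (@le_trans _ _ (2^-1%:E * (1 + 6%:E))).
  by rewrite lee_pmul2l// leeD2l// std_normal_sqr.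
by rewrite -EFinD -EFinM lee_fin; lra.
Qed.

Lemma integral_gauss_first n (f : RT -> \bar R) :
  measurable_fun setT f -> (forall x, 0 <= f x) ->
  \int[g n.+1]_x f ((x : 'rV_n.+1) 0%R ord0) = \int[N]_x f x.
Proof.
move=> mf f0.
apply: (etrans (integral_gaussS (measurableT_comp mf (@measurable_coord R n.+1 ord0)) (fun=> f0 _))).
apply: eq_integral => a _; rewrite -[RHS](integral_cst_prob (g n)).
by apply: eq_integral => v _; rewrite /= rcons0E0.
Qed.

Lemma gauss_abs_dotprod n (u : 'rV[R]_n.+1) :
  \int[g n.+1]_x `|dotprod x u|%:E <= (4 * euclid_norm u)%:E.
Proof.
have mpsi : measurable_fun setT (fun p : RT * RT => `|p.1|%:E).
  by apply/measurable_EFinP; apply: measurableT_comp => //; exact: measurable_fst.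
rewrite (gauss_radial u mpsi)//=.
have mf : measurable_fun setT (fun a : RT => `|euclid_norm u * a|%:E).
  by apply/measurable_EFinP; apply: measurableT_comp => //; exact: measurable_funM.
rewrite (integral_gauss_first n mf)//.
under eq_integral do rewrite normrM EFinM.
rewrite integralZl_T//; last by apply/measurable_EFinP; exact: normr_measurable.
rewrite (ger0_norm (euclid_norm_ge0 u)) mulrC EFinM.
by rewrite lee_wpmul2l ?lee_fin ?euclid_norm_ge0// std_normal_abs.
Qed.

Lemma measurable_dotprod_self n : measurable_fun setT (fun x : T n => dotprod x x).
Proof. exact: measurable_dotprod. Qed.

Lemma dotprod_ge0 n (x : 'rV[R]_n) : (0 <= dotprod x x)%R.
Proof. by rewrite sumr_ge0// => i _; rewrite -expr2 sqr_ge0. Qed.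

Lemma gauss_dotprod_self n : \int[g n]_x (dotprod x x)%:E <= (6 * n%:R)%:E.
Proof.
elim: n => [|n IH].
  rewrite integral_gauss0; last by apply/measurable_EFinP; exact: measurable_dotprod_self.
  by rewrite /dotprod big_ord0 mulr0.
have mF : measurable_fun setT (fun x : T n.+1 => (dotprod x x)%:E).
  (apply/measurable_EFinP; exact: measurable_dotprod_self).
rewrite integral_gaussS//; last by move=> x; rewrite lee_fin dotprod_ge0.
have c0 : (0 <= 6 * n%:R :> R)%R by rewrite mulr_ge0.
apply: (@le_trans _ _ (\int[N]_a ((a ^+ 2)%:E + (6 * n%:R)%:E))).
  apply: le_integral_T => //.
  - apply: (measurable_partial_integral (g n) (f := fun p : RT * T n => (dotprod (rcons0 p) (rcons0 p))%:E)).
      exact: (measurableT_comp mF (@measurable_rcons0 R n)).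
    by move=> p; rewrite lee_fin dotprod_ge0.
  - by move=> a; apply: integral_ge0 => v _; rewrite lee_fin dotprod_ge0.
  - by apply: emeasurable_funD => //; exact: measurable_sqrE.
  - move=> a; under eq_integral do rewrite dotprod_rcons0/= -expr2 EFinD.
    rewrite integralD_T//.
    + by rewrite integral_cst_prob leeD2l.
    + by move=> x; rewrite lee_fin sqr_ge0.
    + (apply/measurable_EFinP; exact: measurable_dotprod_self).
    + by move=> x; rewrite lee_fin dotprod_ge0.
rewrite integralD_T//; last 2 first.
- exact: measurable_sqrE.
- by move=> x; rewrite lee_fin sqr_ge0.
rewrite integral_cst_prob.
rewrite (_ : (6 * n.+1%:R)%:E = 6%:E + (6 * n%:R)%:E); last first.
  by rewrite -EFinD -[n.+1]addn1 natrD; congr EFin; ring.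
by rewrite leeD2r// std_normal_sqr.
Qed.

Lemma std_normal_expN (l : R) : (0 <= l)%R ->
  \int[N]_x (expR (- l * x ^+ 2))%:E = ((Num.sqrt (1 + 2 * l))^-1)%:E.
Proof.
move=> l0; have l1 : (0 < 1 + 2 * l)%R by lra.
have s0 : (0 < (Num.sqrt (1 + 2 * l))^-1)%R by rewrite invr_gt0 sqrtr_gt0.
rewrite -(std_normal_expsqr s0); apply: eq_integral => x _; congr (expR _)%:E.
rewrite exprVn invrK sqr_sqrtr ?ltW//.
by field.
Qed.

Lemma gauss_expN n (l : R) : (0 <= l)%R ->
  \int[g n]_x (expR (- l * dotprod x x))%:E = ((Num.sqrt (1 + 2 * l)) ^- n)%:E.
Proof.
move=> l0.
have mF m : measurable_fun setT (fun x : T m => (expR (- l * dotprod x x))%:E).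
  apply/measurable_EFinP; apply: measurableT_comp => //; apply: measurable_funM => //.
  exact: measurable_dotprod_self.
elim: n => [|n IH].
  by rewrite integral_gauss0// /dotprod big_ord0 mulr0 expR0 expr0 invr1.
apply: (etrans (integral_gaussS (mF _) _)); first by move=> x; rewrite lee_fin expR_ge0.
set t := Num.sqrt _.
transitivity (\int[N]_a ((t ^- n)%:E * (expR (- l * a ^+ 2))%:E)).
  have e0 (x : T n) : 0 <= (expR (- l * dotprod x x))%:E by rewrite lee_fin expR_ge0.
  apply: eq_integral => a _; rewrite -IH muleC -(integralZl_T _ _ (mF n) e0) ?expR_ge0//.
  apply: eq_integral => v _; rewrite dotprod_rcons0/= -EFinM -expRD; congr (expR _)%:E.
  by ring.
have e0 (x : RT) : 0 <= (expR (- l * x ^+ 2))%:E by rewrite lee_fin expR_ge0.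
have t0 : (0 <= t ^- n)%R by rewrite invr_ge0 exprn_ge0// sqrtr_ge0.
rewrite (integralZl_T _ t0 (measurable_expsqr _) e0).
by rewrite std_normal_expN// -EFinM exprSr invfM mulrC.
Qed.

(** The expansion of the right side up to degree 2 exceeds the left side by n (n - 2) u^2. This
    turns the Gaussian value (1 + 2 l)^(-n/2) into the bound 1 / (1 + n l), whose decay in l makes
    the dyadic sum below converge. *)
Lemma expr_ge_sqr (u : R) n : (0 <= u)%R -> (2 <= n)%N ->
  ((1 + n%:R * u) ^+ 2 <= (1 + 2 * u) ^+ n)%R.
Proof.
move=> u0 n2.
have h m : (1 + m%:R * (2 * u) + 2 * (m%:R * (m%:R - 1)) * u ^+ 2 <= (1 + 2 * u) ^+ m)%R.
  elim: m => [|m IH]; first by rewrite expr0 !mul0r mulr0 mul0r !addr0.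
  rewrite [leRHS]exprS -[m.+1]addn1 natrD.
  apply: (@le_trans _ _ ((1 + 2 * u) * (1 + m%:R * (2 * u) + 2 * (m%:R * (m%:R - 1)) * u ^+ 2)))%R; last first.
    by rewrite ler_wpM2l// addr_ge0// mulr_ge0.
  rewrite -subr_ge0.
  have -> : ((1 + 2 * u) * (1 + m%:R * (2 * u) + 2 * (m%:R * (m%:R - 1)) * u ^+ 2) -
     (1 + (m%:R + 1) * (2 * u) + 2 * ((m%:R + 1) * (m%:R + 1 - 1)) * u ^+ 2) =
     4 * (m%:R * (m%:R - 1)) * u ^+ 3)%R by ring.
  rewrite mulr_ge0// ?exprn_ge0// mulr_ge0//.
  by case: m {IH} => [|m]; rewrite ?mul0r// mulr_ge0// subr_ge0 ler1n.
apply: le_trans (h n).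
have n2R : (2 <= n%:R :> R)%R by rewrite ler_nat.
rewrite -subr_ge0.
have -> : (1 + n%:R * (2 * u) + 2 * (n%:R * (n%:R - 1)) * u ^+ 2 - (1 + n%:R * u) ^+ 2 =
  n%:R * (n%:R - 2) * u ^+ 2)%R by ring.
by rewrite mulr_ge0// ?sqr_ge0// mulr_ge0// subr_ge0.
Qed.

Lemma gauss_expN_le n (l : R) : (0 <= l)%R -> (2 <= n)%N ->
  \int[g n]_x (expR (- l * dotprod x x))%:E <= ((1 + n%:R * l)^-1)%:E.
Proof.
move=> l0 n2; rewrite gauss_expN// lee_fin.
have s0 : (0 < Num.sqrt (1 + 2 * l))%R by rewrite sqrtr_gt0; lra.
have p0 : (0 < 1 + n%:R * l)%R by rewrite ltr_pwDl// mulr_ge0.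
rewrite lef_pV2 ?posrE ?exprn_gt0//.
rewrite -(@ler_pXn2r _ 2) ?nnegrE ?(ltW p0) ?exprn_ge0 ?(ltW s0)//.
rewrite exprAC sqr_sqrtr; last lra.
exact: (expr_ge_sqr l0 n2).
Qed.

(** Bounds sqrt n times the mean of 1 / |x|: 1 accounts for |x| >= sqrt n, and 4 e for the sum over
    the dyadic scales below. *)
Definition C_inv : R := (1 + 4 * expR 1)%R.

(* Dyadic decomposition of 1/t by comparison with Gaussians of widths 2^-k. *)
Lemma inv_le_dyadic K (t : R) : (2 ^- K <= t)%R ->
  (t^-1 <= 1 + \sum_(k < K) (2 ^+ k.+1 * expR 1) * expR (- (4 ^+ k) * t ^+ 2))%R.
Proof.
elim: K => [|K IH] tK.
  rewrite big_ord0 addr0 invf_le1//; first by rewrite expr0 invr1 in tK.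
  by apply: lt_le_trans tK; rewrite expr0 invr1.
rewrite big_ord_recr/= addrA.
have [tK'|tK'] := leP (2 ^- K)%R t.
  by apply: (le_trans (IH tK')); rewrite lerDl !mulr_ge0 ?expR_ge0.
have t0 : (0 < t)%R by apply: lt_le_trans tK; rewrite invr_gt0 exprn_gt0.
apply: (@le_trans _ _ (2 ^+ K.+1)%R).
  by rewrite -[leRHS]invrK lef_pV2 ?posrE// invr_gt0 exprn_gt0.
apply: (@le_trans _ _ (2 ^+ K.+1 * expR 1 * expR (- (4 ^+ K) * t ^+ 2)))%R; last first.
  rewrite lerDr; apply: addr_ge0 => //; apply: sumr_ge0 => i _.
  by apply: mulr_ge0; [apply: mulr_ge0|]; rewrite ?expR_ge0.
rewrite -mulrA -expRD ler_peMr ?exprn_ge0// -[leLHS]expR0 ler_expR mulNr subr_ge0.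
have -> : (4 ^+ K * t ^+ 2 = (2 ^+ K * t) ^+ 2 :> R)%R.
  by rewrite exprMn exprAC -[(2 ^+ 2 : R)%R]natrX.
rewrite exprn_ile1 ?mulr_ge0 ?(ltW t0)//.
rewrite mulrC -ler_pdivlMr ?exprn_gt0// mul1r ltW//.
Qed.

Lemma gauss_inv_norm n : (2 <= n)%N ->
  \int[g n]_x ((euclid_norm x)^-1)%:E <= (C_inv / Num.sqrt n%:R)%:E.
Proof.
move=> n2; set r := Num.sqrt n%:R.
have n0 : (0 < n%:R :> R)%R by rewrite ltr0n (leq_trans _ n2).
have r0 : (0 < r)%R by rewrite sqrtr_gt0.
pose rho (x : T n) := (euclid_norm x / r)%R.
have rho0 x : (0 <= rho x)%R by rewrite divr_ge0 ?euclid_norm_ge0 ?(ltW r0).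
have mrho : measurable_fun setT rho.
  by apply: measurable_funM => //; exact: measurable_euclid_norm.
(* Cutting off below 2^-K makes K dyadic terms sufficient. At x = 0 the truncations and their limit
   all vanish, because [0^-1 = 0]. *)
pose h (K : nat) (x : T n) := (if (2 ^- K <= rho x)%R then (rho x)^-1 else 0)%:E.
have mh K : measurable_fun setT (h K).
  apply/measurable_EFinP; apply: measurable_fun_ifT => //.
  - by apply: measurable_fun_ler.
  - exact: (measurableT_comp (@measurable_inv R) mrho).
have h0 K x : 0 <= h K x by rewrite /h lee_fin; case: ifP => // _; rewrite invr_ge0.
have hnd x : {homo h ^~ x : K L / (K <= L)%N >-> K <= L}.
  move=> K L KL; rewrite /h lee_fin; case: ifPn => [Kx|_]; last first.
    by case: ifP => // _; rewrite invr_ge0.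
  rewrite (le_trans _ Kx)// lef_pV2 ?posrE ?exprn_gt0// ler_weXn2l//.
  by rewrite ler1n.
have hlim x : h ^~ x @ \oo --> ((rho x)^-1)%:E.
  have [x0|x0] := eqVneq (rho x) 0%R.
    rewrite x0 invr0; apply: cvg_near_cst; apply: nearW => K.
    by rewrite /h x0 invr0 if_same.
  apply: cvg_near_cst.
  have xp : (0 < rho x)%R by rewrite lt_def x0 rho0.
  near=> K; rewrite /h ifT// ltW//.
  rewrite -div1r; near: K; exact: near_infty_natSinv_expn_lt (PosNum xp).
have hint K : \int[g n]_x h K x <= C_inv%:E.
  pose w (k : nat) (x : T n) := (expR (- (4 ^+ k / n%:R) * dotprod x x))%:E.
  have mw k : measurable_fun setT (w k).
    apply/measurable_EFinP; apply: measurableT_comp => //; apply: measurable_funM => //.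
    exact: measurable_dotprod_self.
  have w0 k x : 0 <= w k x by rewrite lee_fin expR_ge0.
  have c0 (k : nat) : (0 <= 2 ^+ k.+1 * expR 1 :> R)%R by rewrite mulr_ge0 ?expR_ge0.
  apply: (@le_trans _ _ (\int[g n]_x (1 + \sum_(k < K) (2 ^+ k.+1 * expR 1)%:E * w k x))).
    apply: le_integral_T => //.
      apply: emeasurable_funD => //; apply: emeasurable_sum => k.
      exact: emeasurable_funM.
    move=> x; rewrite /h; case: ifPn => [Kx|_]; last first.
      by rewrite adde_ge0// sume_ge0// => k _; rewrite mule_ge0 ?lee_fin.
    under eq_bigr do rewrite -EFinM.
    rewrite sumEFin -EFinD lee_fin; apply: (le_trans (inv_le_dyadic Kx)).
    rewrite lerD2l; apply: ler_sum => k _; rewrite ler_wpM2l ?c0// ler_expR.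
    rewrite /rho expr_div_n euclid_norm_sqr sqr_sqrtr ?(ltW n0)//.
    by rewrite !mulNr mulrAC mulrA.
  rewrite integralD_T//; last 2 first.
  - apply: emeasurable_sum => k; exact: emeasurable_funM.
  - by move=> x; rewrite sume_ge0// => k _; rewrite mule_ge0 ?lee_fin.
  rewrite integral_cst_prob ge0_integral_sum//; last 2 first.
  - by move=> k; exact: emeasurable_funM.
  - by move=> k x _; rewrite mule_ge0 ?lee_fin.
  rewrite [leRHS]EFinD leeD2l//.
  (* The scale k contributes at most 2^(k+1) e / (1 + 4^k), hence at most 2 e 2^-k. *)
  apply: (@le_trans _ _ (\sum_(k < K) (2 * expR 1 * 2^-1 ^+ k)%:E)).
    apply: lee_sum => k _; rewrite integralZl_T//.
    apply: (@le_trans _ _ ((2 ^+ k.+1 * expR 1)%:E * ((1 + n%:R * (4 ^+ k / n%:R))^-1)%:E)).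
      apply: lee_wpmul2l; first by rewrite lee_fin.
      exact: gauss_expN_le.
    rewrite -EFinM lee_fin.
    have -> : (n%:R * (4 ^+ k / n%:R) = 4 ^+ k :> R)%R by rewrite mulrC divfK// gt_eqF.
    have k4 : (4 ^+ k = 2 ^+ k * 2 ^+ k :> R)%R by rewrite -exprMn -natrM.
    have k2 : (0 < 2 ^+ k :> R)%R by rewrite exprn_gt0.
    rewrite exprVn exprS ler_pdivrMr; last by rewrite ltr_pwDl// exprn_ge0.
    rewrite k4 -subr_ge0.
    have -> : (2 * expR 1 / 2 ^+ k * (1 + 2 ^+ k * 2 ^+ k) - 2 * 2 ^+ k * expR 1 =
       2 * expR 1 / 2 ^+ k :> R)%R by field; rewrite gt_eqF.
    by rewrite divr_ge0 ?mulr_ge0 ?expR_ge0 ?(ltW k2).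
  rewrite sumEFin lee_fin -mulr_sumr.
  have hs : (\sum_(k < K) 2^-1 ^+ k <= 2 :> R)%R.
    suff -> : (\sum_(k < K) 2^-1 ^+ k = 2 - 2 * 2^-1 ^+ K :> R)%R.
      by rewrite gerBl mulr_ge0.
    elim: K => [|K IHK]; first by rewrite big_ord0 expr0 mulr1 subrr.
    by rewrite big_ord_recr/= IHK exprS; field.
  have := expR_gt0 (1 : R); nra.
have rhoint : \int[g n]_x ((rho x)^-1)%:E <= C_inv%:E.
  have <- : limn (fun K => \int[g n]_x h K x) = \int[g n]_x ((rho x)^-1)%:E.
    rewrite -monotone_convergence//.
    by apply: eq_integral => x _; apply/cvg_lim.
  apply: lime_le; last exact: nearW.
  apply: ereal_nondecreasing_is_cvgn => K L KL.
  by apply: le_integral_T => //; move=> x; exact: hnd.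
have -> : \int[g n]_x ((euclid_norm x)^-1)%:E = (r^-1)%:E * \int[g n]_x ((rho x)^-1)%:E.
  rewrite -integralZl_T ?invr_ge0 ?(ltW r0)//.
  - by apply: eq_integral => x _; rewrite -EFinM /rho invfM invrK mulrCA mulVf ?mulr1// gt_eqF.
  - apply/measurable_EFinP; exact: (measurableT_comp (@measurable_inv R) mrho).
  - by move=> x; rewrite lee_fin invr_ge0.
by rewrite mulrC EFinM lee_wpmul2l// lee_fin invr_ge0 ltW.
Unshelve. all: by end_near. Qed.
End GaussMoments.

(** * Noise stability *)

Section CauchySchwarz.
Local Open Scope ereal_scope.
Context d (X : measurableType d) (R : realType) (mu : {measure set X -> \bar R}).

(** Integrates 2 u v <= w u^2 + v^2 / w with w = (sqrt B + e) / (sqrt A + e). The shift by [e] keeps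
    the weights finite when [A] or [B] vanishes, and tends to 0 at the end. *)
Lemma cauchy_schwarz (f h : X -> R) (A B : R) :
  measurable_fun setT f -> measurable_fun setT h ->
  (forall x, 0 <= f x)%R -> (forall x, 0 <= h x)%R -> (0 <= A)%R -> (0 <= B)%R ->
  \int[mu]_x (f x ^+ 2)%:E <= A%:E -> \int[mu]_x (h x ^+ 2)%:E <= B%:E ->
  \int[mu]_x (f x * h x)%:E <= (Num.sqrt (A * B))%:E.
Proof.
move=> mf mh f0 h0 A0 B0 fA hB.
set a := Num.sqrt A; set b := Num.sqrt B.
have a0 : (0 <= a)%R by exact: sqrtr_ge0.
have b0 : (0 <= b)%R by exact: sqrtr_ge0.
have m2 (k : X -> R) : measurable_fun setT k -> measurable_fun setT (fun x => (k x ^+ 2)%:E).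
  by move=> mk; apply/measurable_EFinP; exact: measurable_funX.
have s2 (k : X -> R) x : 0 <= (k x ^+ 2)%:E by rewrite lee_fin sqr_ge0.
have key (e : R) : (0 < e)%R -> \int[mu]_x (f x * h x)%:E <= ((a + e) * (b + e))%:E.
  move=> e0; set ae := (a + e)%R; set be := (b + e)%R.
  have ae0 : (0 < ae)%R by rewrite ltr_wpDl.
  have be0 : (0 < be)%R by rewrite ltr_wpDl.
  have aae : (A <= ae ^+ 2)%R.
    by rewrite -(sqr_sqrtr A0) lerXn2r ?nnegrE ?(ltW ae0)// lerDl ltW.
  have bbe : (B <= be ^+ 2)%R.
    by rewrite -(sqr_sqrtr B0) lerXn2r ?nnegrE ?(ltW be0)// lerDl ltW.
  have k1 : (0 <= be / (2 * ae))%R by rewrite divr_ge0 ?mulr_ge0 ?(ltW be0) ?(ltW ae0).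
  have k2 : (0 <= ae / (2 * be))%R by rewrite divr_ge0 ?mulr_ge0 ?(ltW be0) ?(ltW ae0).
  apply: (@le_trans _ _ (\int[mu]_x ((be / (2 * ae))%:E * (f x ^+ 2)%:E +
      (ae / (2 * be))%:E * (h x ^+ 2)%:E))).
    apply: le_integral_T.
    - by apply/measurable_EFinP; exact: measurable_funM.
    - by move=> x; rewrite lee_fin mulr_ge0.
    - by apply: emeasurable_funD; apply: emeasurable_funM => //; exact: m2.
    - move=> x; rewrite -!EFinM -EFinD lee_fin -subr_ge0.
      have -> : (be / (2 * ae) * f x ^+ 2 + ae / (2 * be) * h x ^+ 2 - f x * h x =
        (be * f x - ae * h x) ^+ 2 / (2 * ae * be))%R by field; rewrite !gt_eqF.
      by rewrite divr_ge0 ?sqr_ge0// !mulr_ge0 ?(ltW be0) ?(ltW ae0).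
  rewrite integralD_T; last 4 first.
  - by apply: emeasurable_funM => //; exact: m2.
  - by move=> x; rewrite mule_ge0.
  - by apply: emeasurable_funM => //; exact: m2.
  - by move=> x; rewrite mule_ge0.
  rewrite !integralZl_T//; [|exact: m2|exact: m2].
  apply: (@le_trans _ _ ((be / (2 * ae))%:E * (ae ^+ 2)%:E + (ae / (2 * be))%:E * (be ^+ 2)%:E)).
    by apply: leeD; apply: lee_wpmul2l => //; [apply: (le_trans fA)|apply: (le_trans hB)].
  rewrite -!EFinM -EFinD lee_fin le_eqVlt; apply/orP; left; apply/eqP.
  by field; rewrite !gt_eqF.
rewrite sqrtrM//; apply/lee_addgt0Pr => e e0.
pose e1 : R := Num.min 1%R (e / (a + b + 1))%R.
have ab1 : (0 < a + b + 1)%R by rewrite ltr_wpDl// addr_ge0.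
have e10 : (0 < e1)%R by rewrite lt_min ltr01 divr_gt0.
apply: (le_trans (key _ e10)); rewrite -EFinD lee_fin.
have h1 : (e1 <= 1)%R by rewrite ge_min lexx.
have h2 : (e1 * (a + b + 1) <= e)%R.
  by rewrite -ler_pdivlMr// ge_min lexx orbT.
rewrite -/a -/b; nra.
Qed.
End CauchySchwarz.

Section Stability.
Local Open Scope ereal_scope.
Context (R : realType) (n : nat).
Notation T := (borel_rV R n).
Notation g := (gauss R n).

Definition lin (c s : R) (x y : T) : T := (c *: (x : 'rV_n) + s *: (y : 'rV_n))%R.

Lemma measurable_lin d (X : measurableType d) c s (f h : X -> T) :
  measurable_fun setT f -> measurable_fun setT h ->
  measurable_fun setT (fun x => lin c s (f x) (h x)).
Proof. exact: measurable_lin2. Qed.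

Lemma measurable_lin_pair c s : measurable_fun setT (fun p : T * T => lin c s p.1 p.2).
Proof. by apply: measurable_lin; [exact: measurable_fst|exact: measurable_snd]. Qed.

Lemma linE c s x y i : (lin c s x y : 'rV_n) 0%R i = (c * (x : 'rV_n) 0 i + s * (y : 'rV_n) 0 i)%R.
Proof. by rewrite !mxE. Qed.

(** [lin c s x y] is [t] times the first component of a rotation of (x, y). *)
Lemma integral_gauss_lin (c s t : R) (phi : T -> \bar R) :
  measurable_fun setT phi -> (forall x, 0 <= phi x) ->
  (0 < t)%R -> (c ^+ 2 + s ^+ 2 = t ^+ 2)%R ->
  \int[g]_x \int[g]_y phi (lin c s x y) = \int[g]_x phi (t *: (x : 'rV_n))%R.
Proof.
move=> mphi phi0 t0 cst.
pose F := fun p : T * T => phi (t *: (p.1 : 'rV_n))%R.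
have mF : measurable_fun setT F.
  by apply: (measurableT_comp mphi); apply: measurable_rVZ => //; exact: measurable_fst.
have cs : ((c / t) ^+ 2 + (s / t) ^+ 2 = 1)%R.
  by rewrite !expr_div_n -mulrDl cst divff// sqrf_eq0 gt_eqF.
transitivity (\int[g]_x \int[g]_y F (x, y)); last first.
  by apply: eq_integral => x _; rewrite -[RHS](integral_cst_prob g).
apply: (etrans _ (rotation_gauss mF (fun=> phi0 _) cs)).
apply: eq_integral => x _; apply: eq_integral => y _; congr phi.
by apply/rowP => i; rewrite linE !mxE; field; rewrite gt_eqF.
Qed.

Variable f : T -> R.
Hypotheses (mf : measurable_fun setT f) (f0 : forall x, (0 <= f x)%R) (f1 : forall x, (f x <= 1)%R).
Variable a : R.
Hypothesis fa : \int[g]_x (f x)%:E = a%:E.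

Let fsq x : (f x ^+ 2 <= f x)%R.
Proof. by rewrite expr2 ler_piMr. Qed.

Let a0 : (0 <= a)%R.
Proof. by rewrite -lee_fin -fa integral_ge0// => x _; rewrite lee_fin. Qed.

Let mfE : measurable_fun setT (EFin \o f).
Proof. exact/measurable_EFinP. Qed.

(** The Ornstein-Uhlenbeck operator of correlation [c] when c^2 + s^2 = 1. Since f takes values in
    [0, 1] the integral is finite and [fine] loses nothing. *)
Definition mehler (c s : R) (x : T) : R := fine (\int[g]_y (f (lin c s x y))%:E).

Let int01 (h : T -> R) : measurable_fun setT h -> (forall y, 0 <= h y <= 1)%R ->
  0 <= \int[g]_y (h y)%:E <= 1.
Proof.
move=> mh h01; have h0 y : 0 <= (h y)%:E by rewrite lee_fin; case/andP: (h01 y).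
rewrite integral_ge0//= -[leRHS](integral_cst_prob g).
apply: le_integral_T => //; first exact/measurable_EFinP.
by move=> y; rewrite lee_fin; case/andP: (h01 y).
Qed.

Let mlin1 c s x : measurable_fun setT (fun y => f (lin c s x y)).
Proof. by apply: (measurableT_comp mf); apply: measurable_lin. Qed.

Lemma mehlerE c s x : (mehler c s x)%:E = \int[g]_y (f (lin c s x y))%:E.
Proof.
rewrite /mehler fineK//.
have /andP[i0 i1] := @int01 (fun y => f (lin c s x y)) (mlin1 c s x) (fun=> introT andP (conj (f0 _) (f1 _))).
by rewrite ge0_fin_numE// (le_lt_trans i1)// ltry.
Qed.

Lemma mehler_ge0 c s x : (0 <= mehler c s x)%R.
Proof. by rewrite -lee_fin mehlerE integral_ge0// => y _; rewrite lee_fin. Qed.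

Lemma measurable_mehler c s : measurable_fun setT (mehler c s).
Proof.
apply/measurable_EFinP.
have -> : EFin \o mehler c s = (fun x => \int[g]_y (f (lin c s x y))%:E).
  by apply/funext => x; exact: mehlerE.
apply: (measurable_partial_integral g (f := fun p : T * T => (f (lin c s p.1 p.2))%:E)).
  by apply/measurable_EFinP; apply: (measurableT_comp mf); exact: measurable_lin_pair.
by move=> p; rewrite lee_fin.
Qed.

(** Noise stability: for the indicator of a set and c^2 + s^2 = 1, the probability that two Gaussian
    vectors of correlation [c] both fall in it. *)
Definition stab (c s : R) : \bar R := \int[g]_x \int[g]_y (f x * f (lin c s x y))%:E.

Lemma mehler_mul c s x (k : R) : (0 <= k)%R ->
  (k * mehler c s x)%:E = \int[g]_y (k * f (lin c s x y))%:E.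
Proof.
move=> k0; rewrite EFinM mehlerE.
have mh : measurable_fun setT (fun y => (f (lin c s x y))%:E).
  by apply/measurable_EFinP; exact: mlin1.
by rewrite -(integralZl_T _ k0 mh)// => y; rewrite lee_fin.
Qed.

Lemma stabE c s : stab c s = \int[g]_x (f x * mehler c s x)%:E.
Proof. by apply: eq_integral => x _; rewrite mehler_mul. Qed.

Lemma integral_fsq : \int[g]_x (f x ^+ 2)%:E <= a%:E.
Proof.
rewrite -fa; apply: le_integral_T.
- by apply/measurable_EFinP; exact: measurable_funX.
- by move=> x; rewrite lee_fin sqr_ge0.
- exact: mfE.
- by move=> x; rewrite lee_fin fsq.
Qed.

(** Semigroup law and self-adjointness at once: |P_c f|^2 = <f, P_(c^2) f>. A rotation makes x the
    argument of one factor; the argument of the other becomes c^2 x plus two independent noises of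
    variances (c s)^2 and s^2, which merge into one of variance t^2 = 1 - c^4. *)
Lemma integral_mehler_sqr (c s t : R) : (c ^+ 2 + s ^+ 2 = 1)%R -> (0 < t)%R ->
  (c ^+ 4 + t ^+ 2 = 1)%R ->
  \int[g]_x (mehler c s x ^+ 2)%:E = stab (c ^+ 2) t.
Proof.
move=> cs t0 ct.
pose K := fun p : T * T => (f (lin c s p.1 p.2) * mehler c s p.1)%:E.
have mK : measurable_fun setT K.
  apply/measurable_EFinP; apply: measurable_funM.
    by apply: (measurableT_comp mf); exact: measurable_lin_pair.
  exact: (measurableT_comp (measurable_mehler c s) measurable_fst).
have K0 p : 0 <= K p by rewrite lee_fin mulr_ge0 ?mehler_ge0.
have cs' : (c ^+ 2 + (- s) ^+ 2 = 1)%R by rewrite sqrrN.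
transitivity (\int[g]_x \int[g]_y K (x, y)).
  apply: eq_integral => x _; rewrite expr2 mehler_mul ?mehler_ge0//.
  by apply: eq_integral => y _; rewrite /K/= mulrC.
apply: (etrans (esym (rotation_gauss mK K0 cs'))).
apply: eq_integral => x _.
transitivity (\int[g]_y \int[g]_y' (f x * f (lin (c ^+ 2) 1 x (lin (- (c * s)) s y y')))%:E).
  apply: eq_integral => y _; rewrite /K/=.
  have -> : lin c s (c *: (x : 'rV_n) + - s *: (y : 'rV_n))%R
                 (- - s *: (x : 'rV_n) + c *: (y : 'rV_n))%R = x.
    apply/rowP => i; rewrite linE !mxE opprK -[RHS]mul1r -cs; ring.
  rewrite mehler_mul//; apply: eq_integral => y' _; congr (_ * f _)%:E.
  by apply/rowP => i; rewrite !linE; ring.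
pose phi := fun u : T => (f x * f (lin (c ^+ 2) 1 x u))%:E.
have mphi : measurable_fun setT phi.
  by apply/measurable_EFinP; apply: measurable_funM => //; exact: mlin1.
have phi0 u : 0 <= phi u by rewrite lee_fin mulr_ge0.
have e : ((- (c * s)) ^+ 2 + s ^+ 2 = t ^+ 2)%R.
  have -> : (t ^+ 2 = 1 - c ^+ 4)%R by rewrite -ct addrC addKr.
  have -> : (s ^+ 2 = 1 - c ^+ 2)%R by rewrite -cs addrC addKr.
  rewrite sqrrN exprMn.
  have -> : (s ^+ 2 = 1 - c ^+ 2)%R by rewrite -cs addrC addKr.
  ring.
apply: (etrans (integral_gauss_lin mphi phi0 t0 e)).
apply: eq_integral => y _; rewrite /phi; congr (_ * f _)%:E.
by apply/rowP => i; rewrite !linE ?mxE; ring.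
Qed.

(** Cauchy-Schwarz: <f, P_c f> <= |f| |P_c f|, where |f|^2 <= a because 0 <= f <= 1. *)
Lemma stab_sqrt (c s t b : R) : (c ^+ 2 + s ^+ 2 = 1)%R -> (0 < t)%R ->
  (c ^+ 4 + t ^+ 2 = 1)%R -> (0 <= b)%R ->
  stab (c ^+ 2) t <= b%:E -> stab c s <= (Num.sqrt (a * b))%:E.
Proof.
move=> cs t0 ct b0 h; rewrite stabE; apply: cauchy_schwarz => //.
- exact: measurable_mehler.
- by move=> x; exact: mehler_ge0.
- exact: integral_fsq.
- by rewrite (integral_mehler_sqr cs t0 ct).
Qed.

(** The weight 1 / sqrt 2, unrelated to the number of cells: [lin k k] applied to the three pairs
    among three independent vectors gives vectors of pairwise correlation 1/2. *)
Let k : R := Num.sqrt 2^-1.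
Let k2 : (k ^+ 2 = 2^-1)%R. Proof. by rewrite sqr_sqrtr// invr_ge0. Qed.
Let k0 : (0 < k)%R. Proof. by rewrite sqrtr_gt0 invr_gt0. Qed.
Let kk : (k ^+ 2 + k ^+ 2 = 1)%R. Proof. by rewrite k2; field. Qed.
Let kNk : (k ^+ 2 + (- k) ^+ 2 = 1)%R. Proof. by rewrite sqrrN. Qed.
Let phi := mehler k k.

Lemma integral_mehler_half : \int[g]_x (phi x)%:E = a%:E.
Proof.
rewrite -fa.
transitivity (\int[g]_x \int[g]_y (f (lin k k x y))%:E).
  by apply: eq_integral => x _; rewrite mehlerE.
have k1 : (k ^+ 2 + k ^+ 2 = 1 ^+ 2)%R by rewrite kk expr1n.
apply: (etrans (integral_gauss_lin mfE _ ltr01 k1)) => [x|]; first by rewrite lee_fin.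
by apply: eq_integral => x _; rewrite scale1r.
Qed.

(* Loomis-Whitney: each of the three Gaussians occurs in two of the three factors. *)
Lemma triangle_le :
  \int[g]_x \int[g]_y \int[g]_z (f (lin k k x y) * (f (lin k k y z) * f (lin k k x z)))%:E
  <= (a * Num.sqrt a)%:E.
Proof.
have mphi : measurable_fun setT phi by exact: measurable_mehler.
have p0 x : (0 <= phi x)%R by exact: mehler_ge0.
have msq : measurable_fun setT (fun x => Num.sqrt (phi x)).
  exact: (measurableT_comp (@measurable_sqrt R) mphi).
have sq0 x : (0 <= Num.sqrt (phi x))%R by exact: sqrtr_ge0.
have fsqint x : \int[g]_z (f (lin k k x z) ^+ 2)%:E <= (phi x)%:E.
  rewrite mehlerE; apply: le_integral_T.
  - by apply/measurable_EFinP; apply: measurable_funX; exact: mlin1.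
  - by move=> z; rewrite lee_fin sqr_ge0.
  - by apply/measurable_EFinP; exact: mlin1.
  - by move=> z; rewrite lee_fin fsq.
(* Cauchy-Schwarz in z, then in y; f^2 <= f turns the squares back into [phi]. *)
have inner x y : \int[g]_z (f (lin k k x y) * (f (lin k k y z) * f (lin k k x z)))%:E <=
    (Num.sqrt (phi x) * (f (lin k k x y) * Num.sqrt (phi y)))%:E.
  under eq_integral do rewrite EFinM.
  rewrite integralZl_T//; last 2 first.
  - by apply/measurable_EFinP; apply: measurable_funM; exact: mlin1.
  - by move=> z; rewrite lee_fin mulr_ge0.
  rewrite mulrCA EFinM lee_wpmul2l ?lee_fin// mulrC -sqrtrM//.
  by apply: cauchy_schwarz => //; exact: mlin1.
have middle x : \int[g]_y (Num.sqrt (phi x) * (f (lin k k x y) * Num.sqrt (phi y)))%:E <=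
    (Num.sqrt a * phi x)%:E.
  under eq_integral do rewrite EFinM.
  rewrite integralZl_T//; last 2 first.
  - by apply/measurable_EFinP; apply: measurable_funM => //; exact: mlin1.
  - by move=> z; rewrite lee_fin mulr_ge0.
  have -> : (Num.sqrt a * phi x = Num.sqrt (phi x) * Num.sqrt (phi x * a))%R.
    by rewrite sqrtrM// mulrA -expr2 sqr_sqrtr// mulrC.
  rewrite EFinM lee_wpmul2l ?lee_fin//.
  apply: (cauchy_schwarz (mlin1 k k x) msq (fun=> f0 _) sq0 (p0 x) a0 (fsqint x)).
  rewrite -integral_mehler_half le_eqVlt; apply/orP; left; apply/eqP.
  by apply: eq_integral => y _; rewrite sqr_sqrtr.
have m3 : measurable_fun setT (fun p : T * T * T =>
    (f (lin k k p.1.1 p.1.2) * (f (lin k k p.1.2 p.2) * f (lin k k p.1.1 p.2)))%:E).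
  have q1 : measurable_fun setT (fun p : T * T * T => p.1.1).
    exact: (measurableT_comp measurable_fst measurable_fst).
  have q2 : measurable_fun setT (fun p : T * T * T => p.1.2).
    exact: (measurableT_comp measurable_snd measurable_fst).
  have q3 : measurable_fun setT (fun p : T * T * T => p.2) by exact: measurable_snd.
  apply/measurable_EFinP.
  apply: measurable_funM; first exact: (measurableT_comp mf (measurable_lin k k q1 q2)).
  apply: measurable_funM; first exact: (measurableT_comp mf (measurable_lin k k q2 q3)).
  exact: (measurableT_comp mf (measurable_lin k k q1 q3)).
have z3 p : 0 <= (fun p : T * T * T =>
    (f (lin k k p.1.1 p.1.2) * (f (lin k k p.1.2 p.2) * f (lin k k p.1.1 p.2)))%:E) p.
  by rewrite lee_fin !mulr_ge0.
have m2 := measurable_partial_integral g m3 z3.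
have z2 p : 0 <= (fun p : T * T =>  \int[g]_z
    (f (lin k k p.1 p.2) * (f (lin k k p.2 z) * f (lin k k p.1 z)))%:E) p.
  by apply: integral_ge0 => z _; rewrite lee_fin !mulr_ge0.
apply: (@le_trans _ _ (\int[g]_x (Num.sqrt a * phi x)%:E)).
  apply: le_integral_T.
  - exact: (measurable_partial_integral g m2 z2).
  - by move=> x; apply: integral_ge0 => y _; exact: (z2 (x, y)).
  - by apply/measurable_EFinP; exact: measurable_funM.
  - move=> x; apply: le_trans (middle x); apply: le_integral_T.
    + exact: (measurableT_comp m2 (pair1_measurable x)).
    + by move=> y; exact: (z2 (x, y)).
    + apply/measurable_EFinP; apply: measurable_funM => //.
      by apply: measurable_funM => //; exact: mlin1.
    + by move=> y; exact: inner.
under eq_integral do rewrite EFinM.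
have mphiE : measurable_fun setT (fun x => (phi x)%:E) by apply/measurable_EFinP.
have p0E x : 0 <= (phi x)%:E by rewrite lee_fin.
rewrite (integralZl_T _ (sqrtr_ge0 a) mphiE p0E).
by rewrite integral_mehler_half -EFinM mulrC.
Qed.

(* Both sides are expectations of f(X1) f(X2) f(X3) for Gaussian vectors whose
   pairwise correlations are 1/2. *)
Lemma integral_mehler_cube :
  \int[g]_x (phi x ^+ 3)%:E =
  \int[g]_x \int[g]_y \int[g]_z (f (lin k k x y) * (f (lin k k y z) * f (lin k k x z)))%:E.
Proof.
have mphi : measurable_fun setT phi by exact: measurable_mehler.
have p0 x : (0 <= phi x)%R by exact: mehler_ge0.
have p1 : measurable_fun setT (fun p : T * T => p.1) by exact: measurable_fst.
have p2 : measurable_fun setT (fun p : T * T => p.2) by exact: measurable_snd.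
have q1 : measurable_fun setT (fun p : T * T * T => p.1.1).
  exact: (measurableT_comp measurable_fst measurable_fst).
have q2 : measurable_fun setT (fun p : T * T * T => p.1.2).
  exact: (measurableT_comp measurable_snd measurable_fst).
have q3 : measurable_fun setT (fun p : T * T * T => p.2) by exact: measurable_snd.
have k2' : (k * k = 2^-1)%R by rewrite -expr2.
(* The three vectors x, x / 2 + k w + s / 2 and x / 2 + k w - s / 2 are standard with mutual
   correlations 1/2. *)
pose B x := \int[g]_s \int[g]_w (f x * (f (lin 1 2^-1 (lin 2^-1 k x w) s) *
  f (lin 1 (- 2^-1) (lin 2^-1 k x w) s)))%:E.
transitivity (\int[g]_x B x).
  pose K := fun p : T * T => (f (lin k k p.1 p.2) * phi p.1 ^+ 2)%:E.
  have mK : measurable_fun setT K.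
    apply/measurable_EFinP; apply: measurable_funM.
      exact: (measurableT_comp mf (measurable_lin k k p1 p2)).
    by apply: measurable_funX; exact: (measurableT_comp mphi p1).
  have K0 p : 0 <= K p by rewrite lee_fin mulr_ge0 ?sqr_ge0.
  transitivity (\int[g]_x \int[g]_y K (x, y)).
    apply: eq_integral => x _; rewrite exprSr mehler_mul ?sqr_ge0//.
    by apply: eq_integral => y _; rewrite /K/= mulrC.
  apply: (etrans (esym (rotation_gauss mK K0 kNk))).
  apply: eq_integral => x _.
  (* the two noise variables of phi(z)^2, rotated by 45 degrees *)
  have sqE z : (phi z ^+ 2)%:E = \int[g]_s \int[g]_t
      (f (lin 1 2^-1 (lin k 2^-1 z t) s) * f (lin 1 (- 2^-1) (lin k 2^-1 z t) s))%:E.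
    pose L := fun p : T * T => (f (lin k k z p.1) * f (lin k k z p.2))%:E.
    have mL : measurable_fun setT L.
      apply/measurable_EFinP; apply: measurable_funM.
        exact: (measurableT_comp (mlin1 k k z) p1).
      exact: (measurableT_comp (mlin1 k k z) p2).
    have L0 p : 0 <= L p by rewrite lee_fin mulr_ge0.
    transitivity (\int[g]_u \int[g]_v L (u, v)).
      rewrite expr2 mehler_mul//; apply: eq_integral => u _.
      by rewrite /L/= mulrC mehler_mul.
    apply: (etrans (esym (rotation_gauss mL L0 kk))).
    apply: eq_integral => s _; apply: eq_integral => t _; rewrite /L/=.
    congr (f _ * f _)%:E; apply/rowP => i; rewrite !linE ?mxE -k2'; ring.
  transitivity (\int[g]_y \int[g]_s \int[g]_t (f x *
     (f (lin 1 2^-1 (lin k 2^-1 (lin k (- k) x y) t) s) *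
      f (lin 1 (- 2^-1) (lin k 2^-1 (lin k (- k) x y) t) s)))%:E).
    apply: eq_integral => y _; rewrite /K/=.
    have -> : lin k k (k *: (x : 'rV_n) + - k *: (y : 'rV_n))%R
                 (- - k *: (x : 'rV_n) + k *: (y : 'rV_n))%R = x.
      apply/rowP => i; rewrite linE !mxE opprK -[RHS]mul1r -kk; ring.
    rewrite EFinM sqE -integralZl_T//.
    - apply: eq_integral => s _; rewrite -integralZl_T//.
      + apply/measurable_EFinP; apply: measurable_funM; apply: (measurableT_comp mf);
          by apply: measurable_lin => //; apply: measurable_lin.
      + by move=> t; rewrite lee_fin mulr_ge0.
    - apply: (measurable_partial_integral g (f := fun p : T * T =>
        (f (lin 1 2^-1 (lin k 2^-1 _ p.2) p.1) * f (lin 1 (- 2^-1) (lin k 2^-1 _ p.2) p.1))%:E)).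
        apply/measurable_EFinP; apply: measurable_funM; apply: (measurableT_comp mf);
          by apply: measurable_lin => //; apply: measurable_lin.
      by move=> p; rewrite lee_fin mulr_ge0.
    - by move=> s; apply: integral_ge0 => t _; rewrite lee_fin mulr_ge0.
  pose M := fun p : T * T => \int[g]_t (f x *
     (f (lin 1 2^-1 (lin k 2^-1 (lin k (- k) x p.1) t) p.2) *
      f (lin 1 (- 2^-1) (lin k 2^-1 (lin k (- k) x p.1) t) p.2)))%:E.
  have mM : measurable_fun setT M.
    apply: (measurable_partial_integral g (f := fun p : T * T * T =>  (f x *
     (f (lin 1 2^-1 (lin k 2^-1 (lin k (- k) x p.1.1) p.2) p.1.2) *
      f (lin 1 (- 2^-1) (lin k 2^-1 (lin k (- k) x p.1.1) p.2) p.1.2)))%:E)).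
      apply/measurable_EFinP; apply: measurable_funM => //; apply: measurable_funM;
        apply: (measurableT_comp mf); apply: measurable_lin => //;
        apply: measurable_lin => //; exact: measurable_lin.
    by move=> p; rewrite lee_fin !mulr_ge0.
  have M0 p : 0 <= M p by apply: integral_ge0 => t _; rewrite lee_fin !mulr_ge0.
  apply: (etrans (fubini_tonelli (m1 := g) (m2 := g) M mM M0)).
  apply: eq_integral => s _.
  pose Phi := fun u : T => (f x * (f (lin 1 2^-1 (lin 2^-1 1 x u) s) *
     f (lin 1 (- 2^-1) (lin 2^-1 1 x u) s)))%:E.
  have mPhi : measurable_fun setT Phi.
    apply/measurable_EFinP; apply: measurable_funM => //; apply: measurable_funM;
      apply: (measurableT_comp mf); apply: measurable_lin => //; exact: measurable_lin.
  have Phi0 u : 0 <= Phi u by rewrite lee_fin !mulr_ge0.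
  (* The noises y and t enter only through (t - y) / 2, of variance 1/2, which is distributed as k
     w. *)
  have e : ((- 2^-1) ^+ 2 + 2^-1 ^+ 2 = k ^+ 2)%R by rewrite k2; field.
  transitivity (\int[g]_y \int[g]_t Phi (lin (- 2^-1) 2^-1 y t)).
    apply: eq_integral => y _; apply: eq_integral => t _; rewrite /Phi.
    congr (_ * (f _ * f _))%:E; apply/rowP => i; rewrite !linE -k2'; ring.
  apply: (etrans (integral_gauss_lin mPhi Phi0 k0 e)).
  apply: eq_integral => w _; rewrite /Phi.
  congr (_ * (f _ * f _))%:E; apply/rowP => i; rewrite !linE ?mxE; ring.
pose K := fun p : T * T => \int[g]_z
  (f (lin k k p.1 p.2) * (f (lin k k p.2 z) * f (lin k k p.1 z)))%:E.
have mK : measurable_fun setT K.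
  apply: (measurable_partial_integral g (f := fun p : T * T * T =>
    (f (lin k k p.1.1 p.1.2) * (f (lin k k p.1.2 p.2) * f (lin k k p.1.1 p.2)))%:E)).
    apply/measurable_EFinP.
    apply: measurable_funM; first exact: (measurableT_comp mf (measurable_lin k k q1 q2)).
    apply: measurable_funM; first exact: (measurableT_comp mf (measurable_lin k k q2 q3)).
    exact: (measurableT_comp mf (measurable_lin k k q1 q3)).
  by move=> p; rewrite lee_fin !mulr_ge0.
have K0 p : 0 <= K p by apply: integral_ge0 => t _; rewrite lee_fin !mulr_ge0.
apply: (etrans _ (rotation_gauss mK K0 kNk)).
apply: eq_integral => x _; apply: eq_integral => s _; apply: eq_integral => w _.
rewrite /=; congr (f _ * (f _ * f _))%:E; apply/rowP => i; rewrite !linE ?mxE -?k2'.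
- by rewrite opprK -[LHS]mul1r -kk; ring.
- by ring.
- by ring.
Qed.

(** The second moment of [phi] is the stability at correlation k^2 = 1/2. By Cauchy-Schwarz it is at
    most the geometric mean of the first moment, a, and of the third, at most a^(3/2); this is the
    exponent 5/4. *)
Lemma stab_half (t : R) : (0 < t)%R -> (t ^+ 2 = 3 / 4)%R ->
  stab 2^-1 t <= (Num.sqrt (a * (a * Num.sqrt a)))%:E.
Proof.
move=> t0 t2.
have k4 : (k ^+ 4 + t ^+ 2 = 1)%R.
  have -> : (k ^+ 4 = (k ^+ 2) ^+ 2)%R by rewrite -exprM.
  by rewrite t2 k2; field.
rewrite -k2 -(integral_mehler_sqr kk t0 k4) -/phi.
have mphi : measurable_fun setT phi by exact: measurable_mehler.
have p0 x : (0 <= phi x)%R by exact: mehler_ge0.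
have msq : measurable_fun setT (fun x => Num.sqrt (phi x)).
  exact: (measurableT_comp (@measurable_sqrt R) mphi).
have sq0 x : (0 <= Num.sqrt (phi x))%R by exact: sqrtr_ge0.
have e x : ((phi x ^+ 2) = Num.sqrt (phi x) * (Num.sqrt (phi x) * phi x))%R.
  by rewrite mulrA -expr2 sqr_sqrtr.
under eq_integral do rewrite e.
apply: cauchy_schwarz => //.
- exact: measurable_funM.
- by move=> x; rewrite mulr_ge0.
- by rewrite mulr_ge0 ?sqrtr_ge0.
- under eq_integral do rewrite sqr_sqrtr//.
  by rewrite integral_mehler_half.
- have e3 x : ((Num.sqrt (phi x) * phi x) ^+ 2 = phi x ^+ 3)%R.
    by rewrite exprMn sqr_sqrtr// -exprS.
  under eq_integral do rewrite e3.
  by rewrite integral_mehler_cube; exact: triangle_le.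
Qed.
End Stability.

(** * Estimates of sine and cosine, and the choice of the angle *)

Section Trigo.
Context (R : realType).
Implicit Types x : R.

Lemma sin_mvt x : 0 <= x -> exists2 z, 0 <= z <= x & sin x = cos z * x.
Proof.
rewrite le_eqVlt => /predU1P[<-|x0].
  by exists 0; rewrite ?lexx// sin0 mulr0.
have csin : {within `[0, x], continuous (@sin R)}.
  by apply: continuous_subspaceT; exact: continuous_sin.
have [z] := MVT x0 (fun y _ => is_derive_sin y) csin.
rewrite in_itv/= => /andP[z0 zx]; rewrite sin0 !subr0 => ->.
by exists z => //; rewrite !ltW.
Qed.

Lemma onem_cosE x : 1 - cos x = 2 * sin (x / 2) ^+ 2.
Proof.
have {1}-> : x = (x / 2) *+ 2 by rewrite -mulr_natr divfK.
by rewrite cos_mulr2n sin2cos2; ring.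
Qed.

Lemma sin_sqr_le x : 0 <= x -> sin x ^+ 2 <= x ^+ 2.
Proof.
move=> x0; have [z _ ->] := sin_mvt x0.
by rewrite exprMn ler_piMl ?sqr_ge0.
Qed.

Lemma cos_ge x : 0 <= x -> 1 - x ^+ 2 / 2 <= cos x.
Proof.
move=> x0; have := @sin_sqr_le (x / 2) (divr_ge0 x0 (ler0n _ 2)).
by have := onem_cosE x; lra.
Qed.

(** The half angle is at most 1, where the cosine is at least 1/2, so sin (x / 2) >= x / 4. *)
Lemma cos_le x : 0 <= x <= 2 -> x ^+ 2 / 8 <= 1 - cos x.
Proof.
move=> /andP[x0 x2]; rewrite onem_cosE.
have [z /andP[z0 zx] ->] := @sin_mvt (x / 2) (divr_ge0 x0 (ler0n _ 2)).
have c : 2^-1 <= cos z by have := cos_ge z0; nra.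
rewrite exprMn; have : 2^-1 ^+ 2 <= cos z ^+ 2 by rewrite lerXn2r ?nnegrE//; lra.
move: (cos z ^+ 2) => w; have := sqr_ge0 x; nra.
Qed.
End Trigo.

Section SmallAngle.
Context (R : realType).

(** The power a^(1 / (4 2^j)), in the form produced by repeated Cauchy-Schwarz. *)
Fixpoint sqrt_iter (a : R) j := if j is i.+1 then Num.sqrt (sqrt_iter a i) else Num.sqrt (Num.sqrt a).

Lemma sqrt_iter_ge0 a j : 0 <= sqrt_iter a j.
Proof. by case: j => [|j]; exact: sqrtr_ge0. Qed.

Lemma sqrt_iterX a j : 0 <= a -> sqrt_iter a j ^+ (4 * 2 ^ j) = a.
Proof.
move=> a0; elim: j => [|j IH] /=.
  by rewrite muln1 (_ : 4 = 2 * 2)%N// exprM !sqr_sqrtr// sqrtr_ge0.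
by rewrite expnS mulnCA exprM sqr_sqrtr// sqrt_iter_ge0.
Qed.

(** Each use of [stab_sqrt] halves the gain, from a^(1 + r) to a^(1 + r / 2), starting with r = 1/4
    at correlation 1/2. *)
Lemma stab_sqrt_iter n (f : borel_rV R n -> R) (a : R) j (c s : R) :
  measurable_fun setT f -> (forall x, 0 <= f x) -> (forall x, f x <= 1) ->
  (\int[gauss R n]_x (f x)%:E = a%:E)%E ->
  0 <= c -> 0 < s -> c ^+ 2 + s ^+ 2 = 1 -> c ^+ (2 ^ j) = 2^-1 ->
  (stab f c s <= (a * sqrt_iter a j)%:E)%E.
Proof.
move=> mf f0 f1 fa.
have a0 : 0 <= a by rewrite -lee_fin -fa integral_ge0// => x _; rewrite lee_fin.
elim: j c s => [|j IH] c s c0 s0 cs cj.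
  have c2 : c = 2^-1 by rewrite -cj expn0 expr1.
  rewrite c2; have -> : a * sqrt_iter a 0 = Num.sqrt (a * (a * Num.sqrt a)).
    by rewrite mulrA -expr2 sqrtrM ?sqr_ge0// sqrtr_sqr ger0_norm.
  by apply: (stab_half mf f0 f1 fa s0); move: cs; rewrite c2; lra.
have t0 : 0 < 1 - c ^+ 4.
  have : 0 < s ^+ 2 by rewrite exprn_gt0.
  have := sqr_ge0 c.
  have -> : c ^+ 4 = c ^+ 2 * c ^+ 2 by rewrite -exprD.
  by nra.
have -> : a * sqrt_iter a j.+1 = Num.sqrt (a * (a * sqrt_iter a j)).
  by rewrite mulrA -expr2 sqrtrM ?sqr_ge0// sqrtr_sqr ger0_norm.
have e : (c ^+ 4 + (Num.sqrt (1 - c ^+ 4)) ^+ 2 = 1).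
  by rewrite sqr_sqrtr ?ltW// addrC subrK.
apply: (stab_sqrt mf f0 f1 fa cs _ e); rewrite ?sqrtr_gt0//.
  by rewrite mulr_ge0 ?sqrt_iter_ge0.
apply: IH; rewrite ?sqr_ge0 ?sqrtr_gt0//.
  by rewrite -exprM.
by rewrite -exprM -expnS.
Qed.

(** The fourth power of the left side is k^(-1 / 2^j) <= 1/2, and 1/2 < (9/10)^4. *)
Lemma sqrt_iter_le k j : (2 ^ (2 ^ j) <= k)%N -> sqrt_iter (k%:R^-1) j <= 9 / 10.
Proof.
move=> jk; have k0 : (0 < k)%N by rewrite (leq_trans _ jk)// expn_gt0.
have a0 : 0 <= k%:R^-1 :> R by rewrite invr_ge0.
have h : (sqrt_iter (k%:R^-1) j ^+ 4) <= 2^-1.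
  rewrite -(@ler_pXn2r _ (2 ^ j)) ?nnegrE ?exprn_ge0 ?sqrt_iter_ge0 ?expn_gt0//.
  rewrite -exprM sqrt_iterX// exprVn lef_pV2 ?posrE ?ltr0n ?exprn_gt0//.
  by rewrite -natrX ler_nat.
rewrite leNgt; apply/negP => lt9.
have : (9 / 10) ^+ 4 <= sqrt_iter (k%:R^-1) j ^+ 4.
  by rewrite lerXn2r ?nnegrE ?sqrt_iter_ge0 ?ltW.
lra.
Qed.

(** Take the largest j with 2^(2^j) <= k and N = 2^j; the correlation 2^(-1/N) then gives the factor
    9/10. Its angle satisfies theta^2 / 8 <= 1 - cos theta <= 1 / N, while ln k <= 2 N by maximality
    of j. Hence theta^2 ln k <= 16. *)
Lemma small_angle k : (2 <= k)%N -> exists theta : R,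
  [/\ 0 < theta, theta <= 4 / Num.sqrt (ln k%:R) &
      forall n (f : borel_rV R n -> R), measurable_fun setT f ->
        (forall x, 0 <= f x) -> (forall x, f x <= 1) ->
        (\int[gauss R n]_x (f x)%:E = (k%:R^-1)%:E)%E ->
        (stab f (cos theta) (sin theta) <= (k%:R^-1 * (9 / 10))%:E)%E].
Proof.
move=> k2.
pose m := trunc_log 2 k; pose j := trunc_log 2 m.
have k0 : (0 < k)%N by exact: leq_trans k2.
have m1 : (1 <= m)%N by rewrite /m trunc_log_gt0.
have jm : (2 ^ j <= m)%N by rewrite trunc_logP.
have mj : (m < 2 ^ j.+1)%N by rewrite trunc_log_ltn.
have jk : (2 ^ (2 ^ j) <= k)%N.
  by apply: (@leq_trans (2 ^ m)); [rewrite leq_exp2l|rewrite trunc_logP].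
have kj : (k <= 2 ^ (2 ^ j.+1))%N.
  apply: (@leq_trans (2 ^ m.+1)); last by rewrite leq_exp2l.
  by apply: ltnW; exact: trunc_log_ltn.
pose N : R := (2 ^ j)%:R.
have N0 : 0 < N by rewrite ltr0n expn_gt0.
have N1 : 1 <= N by rewrite ler1n expn_gt0.
have ln20 : 0 < ln 2 :> R by rewrite ln_gt0// ltr1n.
have ln21 : ln 2 <= 1 :> R.
  by have := @le_ln1Dx R 1; rewrite -[1 + 1]/(2 : R); apply; lra.
pose c : R := expR (- (ln 2 / N)).
have cN : c ^+ (2 ^ j) = 2^-1.
  rewrite -expRM_natl mulrN mulrC divfK ?gt_eqF// expRN lnK ?posrE//.
have c0 : 0 < c by exact: expR_gt0.
have c1 : c < 1 by rewrite -expR0 ltr_expR oppr_lt0 divr_gt0.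
have c_ge : 1 - N^-1 <= c.
  have := @expR_ge1Dx R (- (ln 2 / N)); apply: le_trans.
  by rewrite lerD2l lerN2 -[leRHS]mul1r ler_pM2r ?invr_gt0.
have c11 : -1 <= c <= 1 by apply/andP; split; lra.
pose theta := acos c.
have cosE : cos theta = c by rewrite acosK// in_itv.
have t0 : 0 < theta by rewrite acos_gt0//; apply/andP; split; lra.
have tpi : theta <= pi by rewrite acos_lepi.
have t2 : theta <= 2.
  rewrite leNgt; apply/negP => t2.
  have : cos theta < cos (pi / 2).
    rewrite ltr_cos ?in_itv/= ?(ltW t0) ?tpi//; first exact: (lt_trans (pihalf_lt2 R)).
    by have := pi_gt0 R; move=> ?; apply/andP; split; lra.
  by rewrite cos_pihalf cosE; lra.
have sinE : sin theta = Num.sqrt (1 - c ^+ 2) by rewrite sin_acos.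
have s0 : 0 < sin theta by rewrite sinE sqrtr_gt0; nra.
exists theta; split => //.
  have lnk0 : 0 < ln (k%:R : R) by rewrite ln_gt0// ltr1n.
  have lnk : ln (k%:R : R) <= 2 * N.
    apply: (@le_trans _ _ (ln ((2 ^ (2 ^ j.+1))%:R))).
      by rewrite ler_ln ?posrE ?ltr0n ?expn_gt0// ler_nat.
    rewrite natrX lnXn// -[ln 2 *+ _]mulr_natl expnS natrM -/N.
    by rewrite ler_piMr// mulr_ge0// ltW.
  rewrite ler_pdivlMr ?sqrtr_gt0// -(@ler_pXn2r _ 2) ?nnegrE ?mulr_ge0 ?sqrtr_ge0 ?(ltW t0)//.
  rewrite exprMn sqr_sqrtr ?(ltW lnk0)//.
  have h : theta ^+ 2 <= 8 / N.
    have := @cos_le R theta; rewrite (ltW t0) t2 cosE => /(_ isT); lra.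
  apply: (@le_trans _ _ (8 / N * (2 * N))).
    by apply: ler_pM; rewrite ?sqr_ge0 ?(ltW lnk0).
  by rewrite le_eqVlt; apply/orP; left; apply/eqP; field; rewrite gt_eqF.
move=> n f mf f0 f1 fa.
have cs : cos theta ^+ 2 + sin theta ^+ 2 = 1 by rewrite cos2Dsin2.
rewrite -cosE in c0 cN.
apply: (le_trans (stab_sqrt_iter mf f0 f1 fa (ltW c0) s0 cs cN)).
by rewrite lee_fin ler_wpM2l ?invr_ge0// sqrt_iter_le.
Qed.
End SmallAngle.

(** * Rotations of the sphere *)

Section Euclid.
Context (R : realType) (n : nat).
Implicit Types x y z : 'rV[R]_n.

Lemma dotprodC x y : dotprod x y = dotprod y x.
Proof. by apply: eq_bigr => i _; rewrite mulrC. Qed.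

Lemma dotprodDl x y z : dotprod (x + y) z = dotprod x z + dotprod y z.
Proof. by rewrite /dotprod -big_split; apply: eq_bigr => i _; rewrite mxE mulrDl. Qed.

Lemma dotprodZl (a : R) x y : dotprod (a *: x) y = a * dotprod x y.
Proof. by rewrite /dotprod mulr_sumr; apply: eq_bigr => i _; rewrite mxE mulrA. Qed.

Lemma dotprodNl x y : dotprod (- x) y = - dotprod x y.
Proof. by rewrite -scaleN1r dotprodZl mulN1r. Qed.

Lemma dotprodDr x y z : dotprod x (y + z) = dotprod x y + dotprod x z.
Proof. by rewrite dotprodC dotprodDl !(dotprodC x). Qed.

Lemma dotprodZr (a : R) x y : dotprod x (a *: y) = a * dotprod x y.
Proof. by rewrite dotprodC dotprodZl dotprodC. Qed.

Lemma dotprodNr x y : dotprod x (- y) = - dotprod x y.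
Proof. by rewrite dotprodC dotprodNl dotprodC. Qed.

Lemma dotprodE x y : (x *m y^T) 0 0 = dotprod x y.
Proof. by rewrite mxE; apply: eq_bigr => i _; rewrite mxE. Qed.

Lemma euclid_normZ (a : R) x : euclid_norm (a *: x) = `|a| * euclid_norm x.
Proof.
by rewrite /euclid_norm dotprodZl dotprodZr mulrA -expr2 sqrtrM ?sqr_ge0// sqrtr_sqr.
Qed.

Lemma dotprod_eq0 x : (dotprod x x == 0) = (x == 0).
Proof.
apply/eqP/eqP => [|->]; last by rewrite /dotprod big1// => i _; rewrite mxE mul0r.
move=> x0; apply/rowP => i; rewrite mxE; apply/eqP.
have : x 0 i * x 0 i == 0.
  by move/psumr_eq0P : x0 => ->// j _; rewrite -expr2 sqr_ge0.
by rewrite mulf_eq0 orbb.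
Qed.

Lemma euclid_norm_eq0 x : (euclid_norm x == 0) = (x == 0).
Proof. by rewrite -sqrf_eq0 euclid_norm_sqr dotprod_eq0. Qed.

Lemma euclid_norm_gt0 x : (0 < euclid_norm x) = (x != 0).
Proof. by rewrite lt_def euclid_norm_eq0 euclid_norm_ge0 andbT. Qed.

Lemma cauchy_schwarz_dot x y : dotprod x y ^+ 2 <= dotprod x x * dotprod y y.
Proof.
have [->|y0] := eqVneq y 0.
  by rewrite -[X in dotprod x X](scale0r 0) dotprodZr mul0r expr0n mulr_ge0 ?dotprod_ge0.
have yy : 0 < dotprod y y by rewrite lt_def dotprod_eq0 y0 dotprod_ge0.
have := dotprod_ge0 (dotprod y y *: x - dotprod x y *: y).
rewrite dotprodDl !dotprodDr !dotprodNl !dotprodNr !dotprodZl !dotprodZr (dotprodC y x) => h.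
rewrite -subr_ge0 -(pmulr_rge0 _ yy); apply: le_trans h _.
by rewrite le_eqVlt; apply/orP; left; apply/eqP; ring.
Qed.

Lemma dotprod_le x y : `|dotprod x y| <= euclid_norm x * euclid_norm y.
Proof.
rewrite -(@ler_pXn2r _ 2) ?nnegrE ?mulr_ge0 ?euclid_norm_ge0//.
by rewrite real_normK ?num_real// exprMn !euclid_norm_sqr cauchy_schwarz_dot.
Qed.

Lemma coord_le_norm x i : `|x 0 i| <= euclid_norm x.
Proof.
rewrite -(@ler_pXn2r _ 2) ?nnegrE ?euclid_norm_ge0// real_normK ?num_real//.
rewrite euclid_norm_sqr /dotprod (bigD1 i)//= -expr2 lerDl sumr_ge0// => j _.
by rewrite -expr2 sqr_ge0.
Qed.

Lemma sphereP x : @sphere R n x <-> dotprod x x = 1.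
Proof.
rewrite /sphere/=; split=> [x1|x1]; first by rewrite -euclid_norm_sqr x1 expr1n.
by rewrite /euclid_norm x1 sqrtr1.
Qed.

Lemma direction_sphere x : x != 0 -> @sphere R n (direction x).
Proof.
move=> x0; rewrite /sphere/= /direction euclid_normZ gtr0_norm ?invr_gt0 ?euclid_norm_gt0//.
by rewrite mulVf// euclid_norm_eq0.
Qed.

Lemma dist_sphere x y : @sphere R n x -> @sphere R n y ->
  dotprod (x - y) (x - y) = 2 - 2 * dotprod x y.
Proof.
move=> /sphereP x1 /sphereP y1.
by rewrite dotprodDl !dotprodDr !dotprodNl !dotprodNr x1 y1 (dotprodC y x); ring.
Qed.

Lemma dotprod_sphere_le1 x y : @sphere R n x -> @sphere R n y -> -1 <= dotprod x y <= 1.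
Proof.
move=> x1 y1; have := dotprod_le x y; rewrite x1 y1 mulr1.
by rewrite ler_norml.
Qed.

(* Cells of a cubic grid give a finite net made of points of B. *)
Lemma finite_net (B : set 'rV[R]_n) (d : R) : B `<=` @sphere R n -> 0 < d ->
  exists s : seq 'rV[R]_n, (forall y, y \in s -> B y) /\
    forall x, B x -> exists2 y, y \in s & euclid_norm (x - y) < d.
Proof.
move=> BS d0.
(* Two points in one grid cell of side 1 / K are at distance at most sqrt n / K <= n / K < d. *)
pose K := (Num.truncn (n%:R / d)).+1.
have K0 : 0 < K%:R :> R by rewrite ltr0n.
have nK : n%:R / K%:R < d.
  by rewrite ltr_pdivrMr// -ltr_pdivrMl// mulrC truncnS_gt.
(* Coordinates lie in [-1, 1]. The shift by 1 makes them nonnegative, and the end point 1 accounts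
   for the index 2 K. *)
pose phi x : {ffun 'I_n -> 'I_(2 * K).+1} := [ffun i => inord (Num.truncn (K%:R * (x 0 i + 1)))].
have rng x i : B x -> 0 <= K%:R * (x 0 i + 1) /\ (Num.truncn (K%:R * (x 0 i + 1))%R < (2 * K).+1)%N.
  move=> /BS x1; have := coord_le_norm x i; rewrite x1 ler_norml => /andP[xl xu].
  have h0 : 0 <= K%:R * (x 0 i + 1) by rewrite mulr_ge0 ?ler0n//; lra.
  split => //; rewrite ltnS -(ler_nat R); apply: (@le_trans _ _ (K%:R * (x 0 i + 1))); first by rewrite truncn_le.
  by rewrite mulnC natrM ler_pM2l//; lra.
have close x y : B x -> B y -> phi x = phi y -> euclid_norm (x - y) < d.
  move=> Bx By e; apply: le_lt_trans nK.
  rewrite -(@ler_pXn2r _ 2) ?nnegrE ?euclid_norm_ge0 ?divr_ge0//.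
  rewrite euclid_norm_sqr.
  apply: (@le_trans _ _ (\sum_(i < n) K%:R^-2)).
    apply: ler_sum => i _; rewrite -expr2 !mxE -exprVn -real_normK ?num_real//.
    rewrite lerXn2r ?nnegrE ?invr_ge0//.
    have [x0 xn] := rng x i Bx; have [y0 yn] := rng y i By.
    have ti : Num.truncn (K%:R * (x 0 i + 1)) = Num.truncn (K%:R * (y 0 i + 1)).
      by move/ffunP : e => /(_ i); rewrite !ffunE => /(congr1 val)/=; rewrite !inordK.
    have /andP[xa xb] := truncn_itv x0; have /andP[ya yb] := truncn_itv y0.
    rewrite -(ler_pM2l K0) divff ?gt_eqF// -{1}(gtr0_norm K0) -normrM ler_norml.
    rewrite ti in xa xb; rewrite -natr1 in xb yb.
    by rewrite mulrBr; apply/andP; split; rewrite !mulrDr !mulr1 in xa xb ya yb *; lra.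
  rewrite sumr_const card_ord -[_ *+ n]mulr_natl expr_div_n ler_wpM2r ?invr_ge0 ?sqr_ge0//.
  by rewrite -natrX ler_nat; case: (n) => // m; rewrite expnS leq_pmulr// expn_gt0.
pose P (j : {ffun 'I_n -> 'I_(2 * K).+1}) := `[< exists x, B x /\ phi x = j >].
(* The default 0 of a cell without points of B never enters the net, because the cells are filtered
   by [P]. *)
pose rep j : 'rV[R]_n := match pselect (exists x, B x /\ phi x = j) with
  | left h => projT1 (cid h) | right _ => 0 end.
have repP j : P j -> B (rep j) /\ phi (rep j) = j.
  by move=> /asboolP h; rewrite /rep; case: pselect => // h'; case: cid.
exists [seq rep j | j <- enum {ffun 'I_n -> 'I_(2 * K).+1} & P j]; split.
  by move=> y /mapP[j]; rewrite mem_filter => /andP[/repP[? _] _] ->.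
move=> x Bx; have Pj : P (phi x) by apply/asboolP; exists x.
have [Br er] := repP _ Pj.
exists (rep (phi x)); last exact: close.
by apply/mapP; exists (phi x) => //; rewrite mem_filter Pj mem_enum.
Qed.
End Euclid.

(** * Rotations that move one point of the sphere to another *)

Section Transitivity.
Context (R : realType) (n : nat).
Implicit Types x y z v : 'rV[R]_n.

(* For a unit vector v, the linear map fixing v and acting as -1 on its orthogonal. *)
Definition flip v : 'M[R]_n := 2 *: (v^T *m v) - 1%:M.

Lemma mul_flip x v : x *m flip v = (2 * dotprod x v) *: v - x.
Proof.
rewrite mulmxBr mulmx1 -scalemxAr mulmxA; congr (_ - _).
by rewrite [x *m v^T]mx11_scalar dotprodE mul_scalar_mx scalerA.
Qed.

Lemma flipT v : (flip v)^T = flip v.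
Proof. by rewrite /flip linearB/= linearZ/= trmx_mul trmxK trmx1. Qed.

Lemma flip_flip v : dotprod v v = 1 -> flip v *m flip v = 1%:M.
Proof.
move=> v1; rewrite {1}/flip mulmxBl mul1mx -scalemxAl -mulmxA mul_flip v1 mulr1.
rewrite /flip; have -> : 2 *: v - v = v by rewrite scaler_nat mulr2n addrK.
by rewrite opprB addrC subrK.
Qed.

Lemma det_flip_sqr v : dotprod v v = 1 -> \det (flip v) ^+ 2 = 1.
Proof. by move=> v1; rewrite expr2 -det_mulmx flip_flip// det1. Qed.

Lemma rotation_mul (U V : 'M[R]_n) : rotation U -> rotation V -> rotation (U *m V).
Proof.
move=> [U1 dU] [V1 dV]; split; last by rewrite det_mulmx dU dV mul1r.
by rewrite trmx_mul mulmxA -(mulmxA U) V1 mulmx1.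
Qed.

Lemma flip_conj v w : dotprod v v = 1 ->
  flip (w *m flip v) = flip v *m flip w *m flip v.
Proof.
move=> v1; rewrite [flip (_ *m _)]/flip [flip w]/flip.
have := flip_flip v1; have := flipT v; move: (flip v) => V VT VV.
rewrite trmx_mul VT mulmxBr mulmxBl mulmx1 VV.
by rewrite -scalemxAr -scalemxAl !mulmxA.
Qed.

(** Determinants of flips are compared rather than computed: their value depends on the parity of
    the dimension, but the product of two equal ones is 1. *)
Lemma det_flip_conj v w : dotprod v v = 1 -> \det (flip (w *m flip v)) = \det (flip w).
Proof.
by move=> v1; rewrite flip_conj// !det_mulmx mulrC mulrA -expr2 det_flip_sqr// mul1r.
Qed.

(** The flip along the unit vector of x + y exchanges x and y; this vector exists unless y = - x. *)
Lemma bisector x y : dotprod x x = 1 -> dotprod y y = 1 -> dotprod x y != -1 ->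
  exists2 m, dotprod m m = 1 & x *m flip m = y /\ exists2 a, 0 < a & m = a *: (x + y).
Proof.
move=> x1 y1 xy.
have xyl : -1 <= dotprod x y <= 1 by apply: dotprod_sphere_le1; apply/sphereP.
have c0 : 0 < 1 + dotprod x y by move: xy xyl; rewrite -subr_eq0 opprK => ? /andP[? ?]; lra.
have d2 : dotprod (x + y) (x + y) = 2 * (1 + dotprod x y).
  by rewrite dotprodDl !dotprodDr x1 y1 (dotprodC y x); ring.
have e0 : 0 < euclid_norm (x + y) by rewrite /euclid_norm sqrtr_gt0 d2 mulr_gt0.
pose a := (euclid_norm (x + y))^-1.
have a2 : a ^+ 2 * (2 * (1 + dotprod x y)) = 1.
  by rewrite -d2 -euclid_norm_sqr exprVn mulVf// sqrf_eq0 gt_eqF.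
exists (a *: (x + y)).
  by rewrite dotprodZl dotprodZr d2 mulrA -expr2 a2.
split; last by exists a => //; rewrite invr_gt0.
rewrite mul_flip dotprodZr dotprodDr x1 scalerA.
have -> : 2 * (a * (1 + dotprod x y)) * a = 1 by rewrite -[RHS]a2; ring.
by rewrite scale1r addrC addKr.
Qed.

(** The product of [flip x], which fixes x, and of the flip along the bisector of x and y is a
    rotation of their plane. Its determinant is 1 because the bisector is itself the image of x
    under a flip, so that both factors have the same determinant. For orthogonal x and y it is a
    quarter turn. *)
Lemma rotation_to x y : dotprod x x = 1 -> dotprod y y = 1 -> dotprod x y != -1 ->
  exists2 U, rotation U & x *m U = y /\
    (dotprod x y = 0 -> y *m U = - x /\
      forall z, dotprod z x = 0 -> dotprod z y = 0 -> z *m U = z).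
Proof.
move=> x1 y1 xy; have [m m1 [xm [a a0 mE]]] := bisector x1 y1 xy.
have c0 : 0 < 1 + dotprod x y.
  have := @dotprod_sphere_le1 R n x y; rewrite !sphereP => /(_ x1 y1).
  by move: xy; rewrite -subr_eq0 opprK => ? /andP[? ?]; lra.
have xm0 : dotprod x m != -1.
  rewrite mE dotprodZr dotprodDr x1; have : 0 < a * (1 + dotprod x y) by rewrite mulr_gt0.
  by move=> ?; apply/eqP; lra.
have [m' m'1 [xm' _]] := bisector x1 m1 xm0.
have detm : \det (flip m) = \det (flip x) by rewrite -xm' det_flip_conj.
have xx : x *m flip x = x by rewrite mul_flip x1 mulr1 scaler_nat mulr2n addrK.
have ym : y *m flip m = x by rewrite -xm -mulmxA flip_flip// mulmx1.
exists (flip x *m flip m).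
  split; last by rewrite det_mulmx detm -expr2 det_flip_sqr.
  by rewrite trmx_mul !flipT mulmxA -(mulmxA (flip x)) flip_flip// mulmx1 flip_flip.
split; first by rewrite mulmxA xx.
move=> xy0; split.
  by rewrite mulmxA [y *m flip x]mul_flip (dotprodC y) xy0 mulr0 scale0r sub0r mulNmx ym.
move=> z zx zy; rewrite mulmxA [z *m flip x]mul_flip zx mulr0 scale0r sub0r mulNmx mul_flip.
by rewrite mE dotprodZr dotprodDr zx zy addr0 !mulr0 scale0r sub0r opprK.
Qed.

Definition unit_vec (i : 'I_n) : 'rV[R]_n := delta_mx 0 i.

Lemma dotprod_unit_vec x i : dotprod x (unit_vec i) = x 0 i.
Proof.
rewrite /dotprod (bigD1 i)//= mxE !eqxx mulr1 big1 ?addr0// => j /negPf ji.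
by rewrite mxE eqxx/= ji mulr0.
Qed.

Lemma unit_vec1 i : dotprod (unit_vec i) (unit_vec i) = 1.
Proof. by rewrite dotprod_unit_vec mxE !eqxx. Qed.

(** Antipodal points are joined through a basis vector different from both. One of the first two
    serves, since x0^2 + x1^2 <= 1 prevents both squares from being 1. *)
Lemma rotation_transitive x y : (2 <= n)%N -> dotprod x x = 1 -> dotprod y y = 1 ->
  exists2 U, rotation U & x *m U = y.
Proof.
move=> n2 x1 y1; have [xy|xy] := eqVneq (dotprod x y) (-1); last first.
  by have [U rU [xU _]] := rotation_to x1 y1 xy; exists U.
have yx : y = - x.
  apply/eqP; rewrite -subr_eq0 opprK -dotprod_eq0 dotprodDl !dotprodDr x1 y1 (dotprodC y) xy.
  by apply/eqP; ring.
pose i0 : 'I_n := Ordinal (ltnW n2); pose i1 : 'I_n := Ordinal n2.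
have [i xi] : exists i, x 0 i ^+ 2 != 1.
  have [x0|] := eqVneq (x 0 i0 ^+ 2) 1; last by exists i0.
  exists i1; apply/eqP => x1'.
  have : x 0 i0 ^+ 2 + x 0 i1 ^+ 2 <= dotprod x x.
    rewrite /dotprod (bigD1 i0)//= (bigD1 i1)//= -!expr2 addrA lerDl sumr_ge0// => j _.
    by rewrite -expr2 sqr_ge0.
  by rewrite x0 x1' x1; lra.
have [xi1 xiN1] : x 0 i != 1 /\ x 0 i != -1.
  by split; apply: contraNneq xi => ->; rewrite ?sqrrN expr1n.
have xe : dotprod x (unit_vec i) != -1 by rewrite dotprod_unit_vec.
have ey : dotprod (unit_vec i) y != -1.
  by rewrite dotprodC dotprod_unit_vec yx mxE eqr_opp.
have [U rU [xU _]] := rotation_to x1 (unit_vec1 i) xe.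
have [V rV [iV _]] := rotation_to (unit_vec1 i) y1 ey.
by exists (U *m V); [exact: rotation_mul|rewrite mulmxA xU iV].
Qed.

Lemma dotprod_rotation (U : 'M[R]_n) x y : rotation U ->
  dotprod (x *m U) (y *m U) = dotprod x y.
Proof. by move=> [UU _]; rewrite -!dotprodE trmx_mul mulmxA -(mulmxA x) UU mulmx1. Qed.
End Transitivity.

(** * Inner approximation of open sets, and spherical caps *)

Section OpenSets.
Context (R : realType) (n : nat).
Notation T := (borel_rV R n).
Local Open Scope ring_scope.

Lemma continuous_dotprod_aux (f : 'I_n -> 'rV[R]_n -> R) :
  (forall i, continuous (f i)) -> continuous (fun x => \sum_i f i x).
Proof.
move=> cf; have := @continuous_big R 'I_n +%R 0 xpredT (@add_continuous R^o) 'rV[R]_n (index_enum _) f.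
by apply => i _; exact: cf.
Qed.

Lemma continuous_dotprod_l (y : 'rV[R]_n) : continuous (fun x : 'rV[R]_n => dotprod x y).
Proof.
apply: continuous_dotprod_aux => i x; apply: (@continuousM R 'rV[R]_n); last exact: cst_continuous.
exact: coord_continuous.
Qed.

Lemma open_dotprod_gt (y : 'rV[R]_n) (t : R) : open [set x : 'rV[R]_n | t < dotprod x y].
Proof.
apply: (open_comp (D := [set u : R | t < u])); last exact: open_gt.
by move=> x _; exact: continuous_dotprod_l.
Qed.

Lemma continuous_euclid_norm : continuous (@euclid_norm R n).
Proof.
move=> x; rewrite /euclid_norm; apply: (continuous_comp (f := fun x => dotprod x x)).
  apply: continuous_dotprod_aux => i {}x.
  by apply: (@continuousM R 'rV[R]_n); exact: coord_continuous.
exact: sqrt_continuous.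
Qed.

Lemma open_euclid_ball (z : 'rV[R]_n) (d : R) : open [set x : 'rV[R]_n | euclid_norm (x - z) < d].
Proof.
have cs : continuous (fun x : 'rV[R]_n => x - z).
  by move=> x; apply: (@continuousB _ 'rV[R]_n); [exact: cvg_id|exact: cst_continuous].
apply: (open_comp (f := fun x : 'rV[R]_n => x - z) (D := [set u : 'rV[R]_n | euclid_norm u < d])).
  by move=> x _; exact: cs.
apply: (open_comp (D := [set u : R | u < d])); last exact: open_lt.
by move=> x _; exact: continuous_euclid_norm.
Qed.

(** A closed set at distance at least [d] from the complement of O. As d decreases to 0 these sets
    exhaust an open O, which reduces comparisons on O to points that stay in O when moved a
    little. *)
Definition inner_set (O : set 'rV[R]_n) (d : R) : set T :=
  [set x : 'rV[R]_n | forall z, euclid_norm (x - z) < d -> O z].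

Lemma measurable_inner_set O d : measurable (inner_set O d).
Proof.
have -> : inner_set O d = ~` \bigcup_(z in ~` O) [set x : 'rV[R]_n | euclid_norm (x - z) < d].
  apply/seteqP; split => [x h [z Oz /h //]|x h z xz].
  by apply: contrapT => Oz; apply: h; exists z.
apply: measurableC; apply: open_measurable_rV; apply: bigcup_open => z _.
exact: open_euclid_ball.
Qed.

Lemma inner_set_cover O : open O -> O = \bigcup_m inner_set O m.+1%:R^-1.
Proof.
move=> oO; apply/seteqP; split => [x Ox|x [m _]]; last first.
  by apply; rewrite subrr (_ : euclid_norm 0 = 0) ?invr_gt0//; apply/eqP; rewrite euclid_norm_eq0.
have [e /= e0 xeO] : exists2 e : R, 0 < e & ball x e `<=` O.
  by move: oO; rewrite openE => /(_ x Ox) /nbhs_ballP[e e0 xeO]; exists e.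
have [m _ /(_ m (leqnn m)) /= me] := near_infty_natSinv_lt (PosNum e0).
exists m => // z xz; apply: xeO; split => // i j; rewrite ord1 /ball/=.
have := coord_le_norm (x - z) j; rewrite !mxE => h.
exact: (le_lt_trans h (lt_trans xz me)).
Qed.

Lemma inner_set_mono O : {homo (fun m => inner_set O m.+1%:R^-1) : m p / (m <= p)%N >-> (m <= p)%O}.
Proof.
move=> m p mp; apply/subsetPset => x h z xz; apply: h; apply: (lt_le_trans xz).
by rewrite lef_pV2 ?posrE// ler_nat.
Qed.
End OpenSets.

Section SphereCaps.
Local Open Scope ereal_scope.
Context (R : realType) (n : nat).
Notation T := (borel_rV R n).
Variable sigma : probability T R.
Hypotheses (n2 : (2 <= n)%N) (haar : is_sphere_haar sigma).

Definition cap (x : 'rV[R]_n) (t : R) : set T :=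
  [set y : 'rV[R]_n | @sphere R n y /\ (t < dotprod y x)%R].

Lemma measurable_cap x t : measurable (cap x t).
Proof.
by apply: measurableI; [exact: measurable_sphere|apply: open_measurable_rV; exact: open_dotprod_gt].
Qed.

Lemma sigma_cap x x' t : @sphere R n x -> @sphere R n x' ->
  sigma (cap x t) = sigma (cap x' t).
Proof.
move=> /sphereP x1 /sphereP x1'; have [U rU xU] := rotation_transitive n2 x1 x1'.
rewrite -(haar.2 U _ rU (measurable_cap x' t)); congr (sigma _).
apply/seteqP; split=> y; rewrite /cap/= -xU !sphereP !dotprod_rotation//.
Qed.

(** Finitely many caps of this size cover the sphere and all have the same mass, so a null cap would
    make the sphere null. *)
Lemma sigma_cap_gt0 x t : @sphere R n x -> (t < 1)%R -> 0 < sigma (cap x t).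
Proof.
move=> x1 t1; rewrite lt_neqAle measure_ge0 andbT eq_sym; apply/eqP => c0.
have d0 : (0 < Num.sqrt (2 - 2 * t))%R by rewrite sqrtr_gt0; lra.
have [s [sS sd]] := finite_net (@subset_refl _ (@sphere R n)) d0.
have null (l : seq 'rV[R]_n) : (forall y, y \in l -> @sphere R n y) ->
    measurable [set y | exists2 z, z \in l & cap z t y] /\
    sigma [set y | exists2 z, z \in l & cap z t y] = 0.
  elim: l => [|z l IH] lS.
    rewrite (_ : [set y | _] = set0); first by rewrite measure0.
    by apply/seteqP; split => // y [].
  have -> : [set y | exists2 z0, z0 \in z :: l & cap z0 t y] =
     cap z t `|` [set y | exists2 z, z \in l & cap z t y].
    apply/seteqP; split => [y [w]|y [yz|[w wl yw]]].
    - by rewrite inE => /predU1P[->|wl yw]; [left|right; exists w].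
    - by exists z; rewrite ?inE ?eqxx.
    - by exists w; rewrite ?inE ?wl ?orbT.
  have [ml l0] := IH (fun y yl => lS y (mem_behead (s := z :: l) yl)).
  split; first by apply: measurableU => //; exact: measurable_cap.
  apply/eqP; rewrite eq_le measure_ge0 andbT.
  set A := [set y | _] in ml l0 *.
  have h : sigma (cap z t `|` A) <= sigma (cap z t) + sigma A.
    exact: measureU2 (measurable_cap z t) ml.
  apply: (le_trans h).
  by rewrite l0 adde0 (sigma_cap t (lS z (mem_head z l)) x1) c0.
have [ms s0] := null s sS.
have : sigma (@sphere R n) <= sigma [set y | exists2 z, z \in s & cap z t y].
  apply: le_measure; rewrite ?inE//; first exact: measurable_sphere.
  move=> y yS; have [z zs yz] := sd y yS; exists z => //; split => //.
  have := dist_sphere yS (sS z zs); rewrite -euclid_norm_sqr => h.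
  have : (euclid_norm ((y : 'rV_n) - z) ^+ 2 < 2 - 2 * t)%R.
    rewrite -[ltRHS]sqr_sqrtr; last lra.
    by rewrite ltrXn2r ?euclid_norm_ge0.
  by rewrite h; lra.
by rewrite s0 haar.1 leNgt lte01.
Qed.
End SphereCaps.

(** * Uniqueness of the Haar measure *)

Lemma eq_leq1 d (X : porderType d) (x y : X) : x = y -> (x <= y)%O.
Proof. by move=> ->. Qed.

Lemma integralZ_indic d (X : measurableType d) (R : realType)
    (P : {measure set X -> \bar R}) (k : R) (S : set X) : 0 <= k -> measurable S ->
  (\int[P]_y (k * \1_S y)%:E = k%:E * P S)%E.
Proof.
move=> k0 mS; have mi : measurable_fun setT (fun y => (\1_S y : R)%:E).
  by apply/measurable_EFinP; exact: measurable_indic.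
have i0 y : (0 <= (\1_S y : R)%:E)%E by rewrite lee_fin.
transitivity (k%:E * \int[P]_y (\1_S y : R)%:E)%E.
  by rewrite -(integralZl_T _ k0 mi i0).
by rewrite integral_indic// setIT.
Qed.

Lemma integral_indicZr d (X : measurableType d) (R : realType)
    (P : {measure set X -> \bar R}) (k : \bar R) (S : set X) : (0 <= k)%E -> measurable S ->
  (\int[P]_y ((\1_S y : R)%:E * k) = P S * k)%E.
Proof.
move=> k0 mS; rewrite ge0_integralZr//.
- by rewrite integral_indic// setIT.
- by apply/measurable_EFinP; exact: measurable_indic.
Qed.

Lemma pushforward_measure d d' (X : measurableType d) (Y : measurableType d') (R : realType)
    (mu : {measure set X -> \bar R}) (f : X -> Y) : measurable_fun setT f ->
  exists nu : {measure set Y -> \bar R}, forall B, nu B = mu (f @^-1` B).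
Proof.
by move=> mf; exists (measure_function_pushforward__canonical__measure_function_Measure mu mf).
Qed.

Section Uniqueness.
Local Open Scope ereal_scope.
Context (R : realType) (m : nat).
Notation n := m.+1.
Notation T := (borel_rV R n).
Notation RT := (measurableTypeR R).
Notation g := (gauss R n).
Variable sigma : probability T R.
Hypotheses (n2 : (2 <= n)%N) (haar : is_sphere_haar sigma).
Variable D : set RT.
Hypothesis mD : measurable D.

(** Restricting the norm to [D] lets a single uniqueness argument give both the law of the direction
    and its independence from the norm. The zero vector is removed because its direction is off the
    sphere. *)
Definition shell : set T := [set x | D (euclid_norm x) /\ (0 < euclid_norm x)%R].

Lemma measurable_norm_preimage (E : set RT) : measurable E ->
  measurable [set x : T | E (euclid_norm x)].
Proof.
move=> mE; rewrite -[X in measurable X]setTI.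
by apply: (@measurable_euclid_norm R _ _ n id).
Qed.

Lemma measurable_shell : measurable shell.
Proof.
apply: measurableI; first exact: measurable_norm_preimage.
by apply: measurable_lt => //; exact: measurable_euclid_norm.
Qed.

Let C (t : R) : set (T * T) :=
  [set p | [/\ shell p.1, @sphere R n p.2 & (t < dotprod (direction p.1) p.2)%R]].

Let measurable_C t : measurable (C t).
Proof.
have -> : C t = [set p | shell p.1] `&` ([set p | @sphere R n p.2] `&`
    [set p : T * T | (t < dotprod (direction p.1) p.2)%R]).
  by apply/seteqP; split => p; [case|move=> [? []]].
apply: measurableI.
  rewrite -[X in measurable X]setTI.
  by apply: (@measurable_fst _ _ T T) => //; exact: measurable_shell.
apply: measurableI.
  rewrite -[X in measurable X]setTI.
  by apply: (@measurable_snd _ _ T T) => //; exact: measurable_sphere.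
apply: measurable_lt => //; apply: measurable_dotprod; last exact: measurable_snd.
exact: (measurableT_comp (@measurable_direction R n) measurable_fst).
Qed.

(** The event depends on <x, y> and |x|^2 only, the case covered by [gauss_radial]; [Q] is this
    event written in the two variables. *)
Lemma gauss_cap y y' t : @sphere R n y -> @sphere R n y' ->
  g [set x | shell x /\ (t < dotprod (direction x) y)%R] =
  g [set x | shell x /\ (t < dotprod (direction x) y')%R].
Proof.
pose Q : set (RT * RT) := [set p | [/\ D (Num.sqrt p.2), (0 < Num.sqrt p.2)%R &
  (t < (Num.sqrt p.2)^-1 * p.1)%R]].
have ms : measurable_fun setT (fun p : RT * RT => Num.sqrt p.2).
  exact: (measurableT_comp (@measurable_sqrt R) measurable_snd).
have mQ : measurable Q.
  have -> : Q = [set p | D (Num.sqrt p.2)] `&` ([set p | (0 < Num.sqrt p.2)%R] `&`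
      [set p | (t < (Num.sqrt p.2)^-1 * p.1)%R]).
    by apply/seteqP; split => p; [case|move=> [? []]].
  apply: measurableI; first by rewrite -[X in measurable X]setTI; apply: ms.
  apply: measurableI; first exact: measurable_lt.
  apply: measurable_lt => //; apply: measurable_funM => //.
  exact: (measurableT_comp (@measurable_inv R) ms).
have mpsi : measurable_fun setT (fun p : RT * RT => (\1_Q p : R)%:E).
  by apply/measurable_EFinP; exact: measurable_indic.
have psi0 (p : RT * RT) : 0 <= (\1_Q p : R)%:E by rewrite lee_fin.
suff h z : @sphere R n z -> g [set x | shell x /\ (t < dotprod (direction x) z)%R] =
    \int[g]_x (\1_Q (1 * (x : 'rV_n) 0 ord0, dotprod x x)%R : R)%:E.
  by move=> y1 y1'; rewrite !h.
move=> z1; have <- : euclid_norm z = 1%R by exact: z1.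
apply: (etrans _ (gauss_radial z mpsi psi0)).
set E := [set x | _].
have mE : measurable E.
  apply: measurableI; first exact: measurable_shell.
  apply: measurable_lt => //; apply: measurable_dotprod => //.
  exact: measurable_direction.
rewrite -[E]setIT -integral_indic//; apply: eq_integral => x _; congr (_%:E).
rewrite !indicE; congr (nat_of_bool _)%:R; apply/idP/idP; rewrite !inE /Q/= -/(euclid_norm x).
  by move=> [[? ?]]; rewrite /direction dotprodZl.
by move=> [? ? ?]; split => //; rewrite /direction dotprodZl.
Qed.

Lemma sigma_sphereI (B : set T) : measurable B -> sigma (B `&` @sphere R n) = sigma B.
Proof.
move=> mB; apply/eqP; rewrite eq_le; apply/andP; split.
  by apply: le_measure; rewrite ?inE//; apply: measurableI => //; exact: measurable_sphere.
have mS : measurable (~` @sphere R n) by apply: measurableC; exact: measurable_sphere.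
have s0 : sigma (~` @sphere R n) = 0.
  rewrite probability_setC; last exact: measurable_sphere.
  by rewrite haar.1 subee.
have mBS : measurable (B `&` @sphere R n) by apply: measurableI => //; exact: measurable_sphere.
have h : sigma ((B `&` @sphere R n) `|` (~` @sphere R n)) <=
   sigma (B `&` @sphere R n) + sigma (~` @sphere R n).
  exact: measureU2 mBS mS.
rewrite s0 adde0 in h; apply: le_trans h; apply: le_measure; rewrite ?inE//.
  exact: measurableU.
by move=> x Bx; have [Sx|Sx] := pselect (@sphere R n x); [left|right].
Qed.

Variable x0 : 'rV[R]_n.
Hypothesis x01 : @sphere R n x0.
Let p t := sigma (cap x0 t).
Let q t := g [set x | shell x /\ (t < dotprod (direction x) x0)%R].

Let ind1 (A : set T) : measurable A ->
  measurable_fun setT (fun z : T * T => (\1_A z.1 : R)).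
Proof.
move=> mA; apply: (measurableT_comp (f := \1_A : T -> R)); last exact: measurable_fst.
exact: measurable_indic.
Qed.
Let ind2 (A : set T) : measurable A ->
  measurable_fun setT (fun z : T * T => (\1_A z.2 : R)).
Proof.
move=> mA; apply: (measurableT_comp (f := \1_A : T -> R)); last exact: measurable_snd.
exact: measurable_indic.
Qed.

(** Pairs of [C t] are counted with x fixed: each x in the shell sees a cap of mass [p t]. In
    [count2] the same integral is taken with y fixed, and each y on the sphere sees the mass
    [q t]. *)
Let count1 (A : set T) t : measurable A ->
  \int[g]_x \int[sigma]_y (\1_A x * \1_(C t) (x, y))%:E = g (A `&` shell) * p t.
Proof.
move=> mA.
have mAs : measurable (A `&` shell) by apply: measurableI => //; exact: measurable_shell.
transitivity (\int[g]_x ((\1_(A `&` shell) x : R)%:E * p t)).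
  apply: eq_integral => x _.
  have mc : measurable [set y | C t (x, y)].
    rewrite -[X in measurable X]setTI.
    by apply: (pair1_measurable x) => //; exact: measurable_C.
  transitivity ((\1_A x : R)%:E * sigma [set y | C t (x, y)]).
    have k0 : (0 <= \1_A x :> R)%R by [].
    apply: (etrans _ (integralZ_indic sigma k0 mc)).
    by apply: eq_integral => y _; rewrite !indicE.
  have [Ax|Ax] := pselect (A x); last first.
    rewrite !indicE (memNset Ax) (memNset (A := A `&` shell)) ?mul0e//.
    by move=> [].
  have [sx|sx] := pselect (shell x); last first.
    rewrite [\1_(A `&` shell) x]indicE (memNset (A := A `&` shell)); last by move=> [].
    rewrite mul0e (_ : [set y | _] = set0) ?measure0 ?mule0//.
    by apply/seteqP; split => // y [].
  rewrite !indicE !mem_set// !mul1e /p.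
  have x1 : @sphere R n (direction x).
    by apply: direction_sphere; rewrite -euclid_norm_gt0; case: sx.
  rewrite (sigma_cap n2 haar t x01 x1); congr (sigma _).
  apply/seteqP; split => y; rewrite /cap /C/=.
    by move=> [_ yS]; rewrite dotprodC.
  by move=> [yS]; rewrite dotprodC.
exact: integral_indicZr.
Qed.

Let count2 (B : set T) t : measurable B ->
  \int[g]_x \int[sigma]_y (\1_B y * \1_(C t) (x, y))%:E = sigma B * q t.
Proof.
move=> mB.
have mF : measurable_fun setT (fun z : T * T => (\1_B z.2 * \1_(C t) z : R)%:E).
  apply/measurable_EFinP; apply: measurable_funM; first exact: ind2.
  exact: measurable_indic.
have F0 (z : T * T) : 0 <= (\1_B z.2 * \1_(C t) z : R)%:E by rewrite lee_fin mulr_ge0.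
apply: (etrans (fubini_tonelli (m1 := g) (m2 := sigma) _ mF F0)).
rewrite -(sigma_sphereI mB).
have mBS : measurable (B `&` @sphere R n) by apply: measurableI => //; exact: measurable_sphere.
transitivity (\int[sigma]_y ((\1_(B `&` @sphere R n) y : R)%:E * q t)).
  apply: eq_integral => y _ /=.
  have mc : measurable [set x | C t (x, y)].
    rewrite -[X in measurable X]setTI.
    by apply: (pair2_measurable y) => //; exact: measurable_C.
  transitivity ((\1_B y : R)%:E * g [set x | C t (x, y)]).
    have k0 : (0 <= \1_B y :> R)%R by [].
    apply: (etrans _ (integralZ_indic g k0 mc)).
    by apply: eq_integral => x _; rewrite !indicE.
  have [By|By] := pselect (B y); last first.
    rewrite !indicE (memNset By) (memNset (A := B `&` @sphere R n)) ?mul0e//.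
    by move=> [].
  have [Sy|Sy] := pselect (@sphere R n y); last first.
    rewrite [\1_(B `&` @sphere R n) y]indicE (memNset (A := B `&` @sphere R n)); last by move=> [].
    rewrite mul0e (_ : [set x | _] = set0) ?measure0 ?mule0//.
    by apply/seteqP; split => // x [].
  rewrite !indicE !mem_set// !mul1e /q (gauss_cap t x01 Sy); congr (g _).
  by apply/seteqP; split => x; rewrite /C/=; [case|case].
exact: integral_indicZr.
Qed.

Let le1 (A B : set T) t : measurable A -> measurable B ->
  (forall x y, C t (x, y) -> A x -> B y) -> g (A `&` shell) * p t <= sigma B * q t.
Proof.
move=> mA mB AB; apply: (le_trans (eq_leq1 (esym (count1 t mA))) (le_trans _ (eq_leq1 (count2 t mB)))).
have mF1 : measurable_fun setT (fun z : T * T => (\1_A z.1 * \1_(C t) z : R)%:E).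
  apply/measurable_EFinP; apply: measurable_funM; first exact: ind1.
  exact: measurable_indic.
have mF2 : measurable_fun setT (fun z : T * T => (\1_B z.2 * \1_(C t) z : R)%:E).
  apply/measurable_EFinP; apply: measurable_funM; first exact: ind2.
  exact: measurable_indic.
have F1 (z : T * T) : 0 <= (\1_A z.1 * \1_(C t) z : R)%:E by rewrite lee_fin mulr_ge0.
have F2 (z : T * T) : 0 <= (\1_B z.2 * \1_(C t) z : R)%:E by rewrite lee_fin mulr_ge0.
apply: le_integral_T.
- exact: (measurable_partial_integral sigma mF1 F1).
- by move=> x; apply: integral_ge0 => y _; exact: (F1 (x, y)).
- exact: (measurable_partial_integral sigma mF2 F2).
move=> x; apply: le_integral_T.
- exact: (measurableT_comp mF1 (pair1_measurable x)).
- by move=> y; exact: (F1 (x, y)).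
- exact: (measurableT_comp mF2 (pair1_measurable x)).
move=> y; rewrite lee_fin !indicE.
have [Cxy|Cxy] := pselect (C t (x, y)); last by rewrite (memNset Cxy) !mulr0.
rewrite (mem_set Cxy) !mulr1; have [Ax|Ax] := pselect (A x); last by rewrite (memNset Ax).
by rewrite (mem_set Ax) (mem_set (AB _ _ Cxy Ax)).
Qed.

Let le2 (A B : set T) t : measurable A -> measurable B ->
  (forall x y, C t (x, y) -> B y -> A x) -> sigma B * q t <= g (A `&` shell) * p t.
Proof.
move=> mA mB AB; apply: (le_trans (eq_leq1 (esym (count2 t mB))) (le_trans _ (eq_leq1 (count1 t mA)))).
have mF1 : measurable_fun setT (fun z : T * T => (\1_A z.1 * \1_(C t) z : R)%:E).
  apply/measurable_EFinP; apply: measurable_funM; first exact: ind1.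
  exact: measurable_indic.
have mF2 : measurable_fun setT (fun z : T * T => (\1_B z.2 * \1_(C t) z : R)%:E).
  apply/measurable_EFinP; apply: measurable_funM; first exact: ind2.
  exact: measurable_indic.
have F1 (z : T * T) : 0 <= (\1_A z.1 * \1_(C t) z : R)%:E by rewrite lee_fin mulr_ge0.
have F2 (z : T * T) : 0 <= (\1_B z.2 * \1_(C t) z : R)%:E by rewrite lee_fin mulr_ge0.
apply: le_integral_T.
- exact: (measurable_partial_integral sigma mF2 F2).
- by move=> x; apply: integral_ge0 => y _; exact: (F2 (x, y)).
- exact: (measurable_partial_integral sigma mF1 F1).
move=> x; apply: le_integral_T.
- exact: (measurableT_comp mF2 (pair1_measurable x)).
- by move=> y; exact: (F2 (x, y)).
- exact: (measurableT_comp mF1 (pair1_measurable x)).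
move=> y; rewrite lee_fin !indicE.
have [Cxy|Cxy] := pselect (C t (x, y)); last by rewrite (memNset Cxy) !mulr0.
rewrite (mem_set Cxy) !mulr1; have [By|By] := pselect (B y); last by rewrite (memNset By).
by rewrite (mem_set By) (mem_set (AB _ _ Cxy By)).
Qed.

(** The two counts of all pairs agree, so the cap masses of the two measures are proportional. *)
Let qE t : q t = g shell * p t.
Proof.
apply/eqP; rewrite eq_le; apply/andP; split.
  have := @le2 setT setT t measurableT measurableT (fun _ _ _ _ => I).
  by rewrite setTI probability_setT mul1e.
have := @le1 setT setT t measurableT measurableT (fun _ _ _ _ => I).
by rewrite setTI probability_setT mul1e.
Qed.

Let cancel t (a b : \bar R) : (t < 1)%R -> a * p t <= b * p t -> a <= b.
Proof.
move=> t1; have p0 := sigma_cap_gt0 n2 haar x01 t1.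
rewrite lee_pmul2r// ge0_fin_numE// (le_lt_trans (probability_le1 _ _)) ?ltry//.
exact: measurable_cap.
Qed.

(* Sets at positive distance are compared by integrating the indicator of the pairs
   of points at distance at most r in both orders. *)
Let direction_open (O : set 'rV[R]_n) : open O ->
  g ((@direction R n) @^-1` O `&` shell) = sigma (O : set T) * g shell.
Proof.
move=> oO.
have mdir (B : set T) : measurable B -> measurable ((@direction R n) @^-1` B).
  by move=> mB; rewrite -[X in measurable X]setTI; apply: measurable_direction.
have mO := open_measurable_rV oO.
(* The chord between unit vectors is sqrt (2 - 2 <u, v>), so this t forces it below 1 / (k + 1). *)
have tE k : exists2 t : R, (t < 1)%R & forall u v, @sphere R n u -> @sphere R n v ->
    (t < dotprod u v)%R -> (euclid_norm (u - v)%R < k.+1%:R^-1)%R.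
  exists (1 - k.+1%:R^-2 / 2)%R.
    by rewrite gtrBl divr_gt0// invr_gt0 exprn_gt0.
  move=> u v u1 v1 uv; rewrite -(@ltr_pXn2r _ 2) ?nnegrE ?euclid_norm_ge0 ?invr_ge0//.
  rewrite euclid_norm_sqr dist_sphere// exprVn.
  by move: uv; move: (k.+1%:R ^- 2)%R (dotprod u v) => w d; lra.
have dirS x : shell x -> @sphere R n (direction x).
  by move=> [_]; rewrite euclid_norm_gt0; exact: direction_sphere.
apply/eqP; rewrite eq_le; apply/andP; split.
- have -> : (@direction R n) @^-1` O `&` shell =
      \bigcup_k ((@direction R n) @^-1` (inner_set O k.+1%:R^-1) `&` shell).
    by rewrite -setI_bigcupl -preimage_bigcup -inner_set_cover.
  have mk k : measurable ((@direction R n) @^-1` (inner_set O k.+1%:R^-1) `&` shell).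
    by apply: measurableI; [apply: mdir; exact: measurable_inner_set|exact: measurable_shell].
  have nd : {homo (fun k => (@direction R n) @^-1` (inner_set O k.+1%:R^-1) `&` shell) :
      i j / (i <= j)%N >-> (i <= j)%O}.
    move=> i j ij; apply/subsetPset; apply: setSI; apply: preimage_subset.
    by apply/subsetPset; exact: (inner_set_mono O ij).
  have cv := nondecreasing_cvg_mu (mu := g) mk (bigcupT_measurable _ mk) nd.
  rewrite -(cvg_lim (@ereal_hausdorff R) cv); apply: lime_le; first exact: cvgP cv.
  apply: nearW => k /=; have [t t1 th] := tE k.
  apply: (cancel t1); rewrite -muleA -qE; apply: le1 => //.
    by apply: mdir; exact: measurable_inner_set.
  move=> x y [/= sx yS xy]; apply; exact: th (dirS _ sx) yS xy.
- have -> : sigma (O : set T) = limn (fun k => sigma (inner_set O k.+1%:R^-1)).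
    have cv := nondecreasing_cvg_mu (mu := sigma) (fun k => measurable_inner_set O k.+1%:R^-1)
      (bigcupT_measurable _ (fun k => measurable_inner_set O k.+1%:R^-1)) (@inner_set_mono R n O).
    rewrite {1}(inner_set_cover oO); apply/esym/cvg_lim => //; exact: cv.
  have cv := nondecreasing_cvg_mu (mu := sigma) (fun k => measurable_inner_set O k.+1%:R^-1)
      (bigcupT_measurable _ (fun k => measurable_inner_set O k.+1%:R^-1)) (@inner_set_mono R n O).
  have gfin : g shell \is a fin_num.
    rewrite ge0_fin_numE// (le_lt_trans (probability_le1 _ _)) ?ltry//.
    exact: measurable_shell.
  have cv2 := cvgeZr gfin cv.
  rewrite (cvg_lim (@ereal_hausdorff R) cv) -(cvg_lim (@ereal_hausdorff R) cv2).
  apply: lime_le; first exact: cvgP cv2.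
  apply: nearW => k /=; have [t t1 th] := tE k.
  apply: (cancel t1); rewrite -muleA -qE; apply: le2 => //.
  - exact: mdir.
  - exact: measurable_inner_set.
  move=> x y [/= sx yS xy]; apply; apply: (th _ _ yS (dirS _ sx)).
  by rewrite dotprodC.
Qed.

(** Open sets are stable under intersection and generate the Borel sets, so two finite measures that
    agree on them coincide. *)
Lemma gauss_shell_direction (B : set T) : measurable B ->
  g ((@direction R n) @^-1` B `&` shell) = sigma B * g shell.
Proof.
have gfin : g shell \is a fin_num.
  rewrite ge0_fin_numE// (le_lt_trans (probability_le1 _ _)) ?ltry//.
  exact: measurable_shell.
have f0 : (0 <= fine (g shell))%R by rewrite fine_ge0.
have [m1 m1E] := pushforward_measure (mrestr g measurable_shell) (@measurable_direction R n).
pose m2 : {measure set T -> \bar R} := mscale (NngNum f0) sigma.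
have m2E B' : m2 B' = sigma B' * g shell by rewrite /m2/= /mscale/= fineK// muleC.
move=> mB; suff : m1 B = m2 B by rewrite m1E m2E.
apply: (@measure_unique _ R T (@open 'rV[R]_n) (fun=> setT)) => //.
- by move=> A1 A2; exact: openI.
- by move=> _; exact: openT.
- by rewrite bigcup_const//; exists 0%N.
- by move=> O oO; rewrite m1E m2E; exact: direction_open.
- move=> _; rewrite m1E /= /mrestr preimage_setT setTI.
  by rewrite -ge0_fin_numE.
Qed.
End Uniqueness.

(** * Independence of norm and direction *)

Section Polar.
Local Open Scope ereal_scope.
Context (R : realType) (m : nat).
Notation n := m.+1.
Notation T := (borel_rV R n).
Notation RT := (measurableTypeR R).
Notation g := (gauss R n).

Lemma std_normal_set1 (c : R) : std_normal R [set c] = 0.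
Proof.
apply/eqP; rewrite eq_le measure_ge0 andbT /std_normal/= /normal_prob.
rewrite (@integral_set1 R (fun x => (normal_pdf 0 1 x)%:E) c)//.
Qed.

Lemma gauss_first_null (E : set RT) : measurable E -> std_normal R E = 0 ->
  g [set x : T | E ((x : 'rV_n) 0%R ord0)] = 0.
Proof.
move=> mE E0.
have mS : measurable [set x : T | E ((x : 'rV_n) 0%R ord0)].
  rewrite -[X in measurable X]setTI; exact: (@measurable_coord R n ord0).
rewrite -[X in g X]setIT -integral_indic//.
have mi : measurable_fun setT (fun x : RT => (\1_E x : R)%:E).
  by apply/measurable_EFinP; exact: measurable_indic.
have i0 (x : RT) : 0 <= (\1_E x : R)%:E by rewrite lee_fin.
have E1 : \int[std_normal R]_x (\1_E x : R)%:E = 0.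
  by rewrite integral_indic// setIT; exact: E0.
apply: (etrans _ (etrans (integral_gauss_first m mi i0) E1)).
by apply: eq_integral => x _; rewrite !indicE.
Qed.

Lemma gauss_hyperplane (u : 'rV[R]_n) : u != 0%R -> g [set x : T | dotprod x u = 0%R] = 0.
Proof.
move=> u0.
have ru : (0 < euclid_norm u)%R by rewrite euclid_norm_gt0.
have mS : measurable [set x : T | dotprod x u = 0%R].
  rewrite (_ : [set x : T | _] = (fun x : T => dotprod x u) @^-1` [set 0%R])//.
  by rewrite -[X in measurable X]setTI; apply: (measurable_dotprod (f := id) (g := cst u)).
have mE : measurable [set p : RT * RT | p.1 = 0%R].
  rewrite (_ : [set p | _] = fst @^-1` [set 0%R])//.
  by rewrite -[X in measurable X]setTI; apply: measurable_fst.
have mi : measurable_fun setT (fun p : RT * RT => (\1_[set p : RT * RT | p.1 = 0%R] p : R)%:E).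
  by apply/measurable_EFinP; exact: measurable_indic.
have i0 (p : RT * RT) : 0 <= (\1_[set p : RT * RT | p.1 = 0%R] p : R)%:E by rewrite lee_fin.
rewrite -[X in g X]setIT -integral_indic//.
have h := gauss_radial u mi i0.
have m0 : measurable [set 0%R : RT] by [].
rewrite -(gauss_first_null m0 (std_normal_set1 0%R)).
have mS' : measurable [set x : T | [set 0%R] ((x : 'rV_n) 0%R ord0)].
  by rewrite -[X in measurable X]setTI; exact: (@measurable_coord R n ord0).
rewrite -[X in _ = g X]setIT -integral_indic//.
apply: (etrans (etrans _ h)).
  by apply: eq_integral => x _; rewrite !indicE.
apply: eq_integral => x _; rewrite !indicE; congr (nat_of_bool _)%:R%:E.
apply/idP/idP; rewrite !inE/=; last by move=> ->; rewrite mulr0.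
by move=> /eqP; rewrite mulf_eq0 gt_eqF//= => /eqP.
Qed.

Lemma gauss_null_norm : g [set x : T | euclid_norm x = 0%R] = 0.
Proof.
have mS : measurable [set x : T | euclid_norm x = 0%R].
  rewrite (_ : [set x : T | _] = (fun x : T => euclid_norm x) @^-1` [set 0%R])//.
  by rewrite -[X in measurable X]setTI; apply: (measurable_euclid_norm (f := id)).
apply/eqP; rewrite eq_le measure_ge0 andbT.
have e0 : unit_vec R (ord0 : 'I_n) != 0%R.
  by rewrite -dotprod_eq0 unit_vec1 oner_eq0.
rewrite -(gauss_hyperplane e0); apply: le_measure; rewrite ?inE//.
  rewrite (_ : [set x : T | _] = (fun x : T => dotprod x (unit_vec R ord0)) @^-1` [set 0%R])//.
  by rewrite -[X in measurable X]setTI; apply: (measurable_dotprod (f := id) (g := cst (unit_vec R ord0))).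
move=> x /= /eqP; rewrite euclid_norm_eq0 => /eqP ->.
by rewrite dotprod_unit_vec mxE.
Qed.

Variable sigma : probability T R.
Hypotheses (n2 : (2 <= n)%N) (haar : is_sphere_haar sigma).

Lemma gauss_norm_direction (D : set RT) (B : set T) : measurable D -> measurable B ->
  g [set x | D (euclid_norm x) /\ B (direction x)] =
  g [set x : T | D (euclid_norm x)] * sigma B.
Proof.
move=> mD mB.
have e1 : @sphere R n (unit_vec R ord0) by apply/sphereP; rewrite unit_vec1.
have mND := @measurable_norm_preimage R m D mD.
have mdB : measurable ((@direction R n) @^-1` B).
  by rewrite -[X in measurable X]setTI; apply: measurable_direction.
have mN0 : measurable [set x : T | euclid_norm x = 0%R].
  rewrite (_ : [set x : T | _] = (fun x : T => euclid_norm x) @^-1` [set 0%R])//.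
  by rewrite -[X in measurable X]setTI; apply: (measurable_euclid_norm (f := id)).
have drop (S : set T) : measurable S -> (forall x, S x -> D (euclid_norm x)) ->
    g S = g (S `&` shell D).
  move=> mS SD; have mSs : measurable (S `&` shell D).
    by apply: measurableI => //; exact: measurable_shell.
  apply/eqP; rewrite eq_le; apply/andP; split; last first.
    by apply: le_measure; rewrite ?inE//.
  have h : g ((S `&` shell D) `|` [set x : T | euclid_norm x = 0%R]) <=
      g (S `&` shell D) + g [set x : T | euclid_norm x = 0%R].
    exact: measureU2 mSs mN0.
  rewrite gauss_null_norm adde0 in h; apply: le_trans h.
  apply: le_measure; rewrite ?inE//; first exact: measurableU.
  move=> x Sx; have [x0|x0] := eqVneq (euclid_norm x) 0%R; [by right|left].
  by split => //; split; [exact: SD|rewrite lt_def x0 euclid_norm_ge0].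
rewrite (drop [set x : T | D (euclid_norm x)])//.
rewrite (drop [set x | D (euclid_norm x) /\ B (direction x)]); [|exact: measurableI|by move=> x []].
have -> : [set x : T | D (euclid_norm x)] `&` shell D = shell D.
  by apply/seteqP; split => [x []//|x sx]; split => //; case: sx.
rewrite muleC -(gauss_shell_direction n2 haar mD e1 mB); congr (g _).
by apply/seteqP; split => [x [[? ?] ?]//|x [? sx]]; split => //; case: sx.
Qed.

(** By [gauss_norm_direction] the joint law of norm and direction agrees on rectangles with the
    product of the law of the norm and [sigma], hence equals it. *)
Lemma gauss_polar (H : RT * T -> \bar R) : measurable_fun setT H -> (forall p, 0 <= H p) ->
  \int[g]_x H (euclid_norm x, direction x) = \int[g]_x \int[sigma]_u H (euclid_norm x, u).
Proof.
move=> mH H0.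
have mn : measurable_fun setT (fun x : T => euclid_norm x : RT).
  exact: (measurable_euclid_norm (f := id)).
have mpair : measurable_fun setT (fun x : T => (euclid_norm x : RT, direction x)).
  by apply/measurable_fun_pair => //; exact: measurable_direction.
have mK : measurable_fun setT (fun r : RT => \int[sigma]_u H (r, u)).
  exact: (measurable_partial_integral sigma mH H0).
pose X1 : {mfun T >-> RT} := HB.pack (fun x : T => euclid_norm x : RT)
  (isMeasurableFun.Build _ _ _ _ _ mn).
pose X2 : {mfun T >-> (RT * T)%type} := HB.pack (fun x : T => (euclid_norm x : RT, direction x))
  (isMeasurableFun.Build _ _ _ _ _ mpair).
transitivity (\int[distribution g X2]_p H p); first by rewrite ge0_integral_distribution.
transitivity (\int[distribution g X1]_r \int[sigma]_u H (r, u)); last first.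
  rewrite ge0_integral_distribution// => r; exact: integral_ge0.
rewrite -(fubini_tonelli1 (m1 := distribution g X1) (m2 := sigma) H mH H0).
apply: eq_measure_integral => E mE _.
apply/esym/product_measure_unique => // D B mD mB.
rewrite /distribution/= /pushforward/=.
exact: gauss_norm_direction.
Qed.
End Polar.

(** * Displacement of a cutoff function *)

Section Direction.
Context (R : realType) (n : nat).
Implicit Types u v w x y : 'rV[R]_n.

Lemma directionZ (a : R) x : 0 < a -> @direction R n (a *: x) = @direction R n x.
Proof.
move=> a0; rewrite /direction euclid_normZ gtr0_norm// scalerA invfM mulrAC mulVf ?mul1r//.
by rewrite gt_eqF.
Qed.

Lemma dotprod_direction_ge x y : @sphere R n y -> -1 <= dotprod (@direction R n x) y.
Proof.
move=> y1; have [->|x0] := eqVneq x 0.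
  by rewrite /direction scaler0 -(scale0r y) dotprodZl mul0r; lra.
by have /andP[] := dotprod_sphere_le1 (direction_sphere x0) y1.
Qed.

Lemma dotprod_direction_le x y : @sphere R n y -> dotprod (@direction R n x) y <= 1.
Proof.
move=> y1; have [->|x0] := eqVneq x 0.
  by rewrite /direction scaler0 -(scale0r y) dotprodZl mul0r; lra.
by have /andP[] := dotprod_sphere_le1 (direction_sphere x0) y1.
Qed.

(** First-order expansion of a normalized vector. The linear term sees only the part of y orthogonal
    to u. The quadratic remainder is capped at 2, the largest possible decrease, which makes the
    bound valid for every [tau]. *)
Lemma dir_move u w y (tau : R) : @sphere R n u -> @sphere R n y ->
  dotprod u y - dotprod (@direction R n (u + tau *: w)) y <=
  Num.min 2 (8 * tau ^+ 2 * dotprod w w) + 2 * `|tau| * `|dotprod w (y - dotprod u y *: u)|.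
Proof.
move=> u1 y1; set mm := dotprod u y; set be := dotprod w (y - _).
have b0 : 0 <= 2 * `|tau| * `|be| by rewrite !mulr_ge0.
have ww0 := dotprod_ge0 w.
have /andP[mm1 mm2] := dotprod_sphere_le1 u1 y1.
have dge := dotprod_direction_ge (u + tau *: w) y1.
have -> : 8 * tau ^+ 2 * dotprod w w = 8 * (tau ^+ 2 * dotprod w w) by rewrite mulrA.
have [small|big] := leP (4 * (tau ^+ 2 * dotprod w w)) 1; last first.
  rewrite min_l; last by move: big; set A := (tau ^+ 2 * _); lra.
  by move: dge mm2 b0; rewrite -/mm; lra.
rewrite min_r; last by move: small; set A := (tau ^+ 2 * _); lra.
set al := dotprod u w.
have uu : dotprod u u = 1 by apply/sphereP.
have yy : dotprod y y = 1 by apply/sphereP.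
have al2 : al ^+ 2 <= dotprod w w by have := cauchy_schwarz_dot u w; rewrite uu mul1r.
set q := dotprod (u + tau *: w) (u + tau *: w).
have qE : q = 1 + 2 * (tau * al) + tau ^+ 2 * dotprod w w.
  by rewrite /q dotprodDl !dotprodDr !dotprodZl !dotprodZr uu (dotprodC w u) -/al; ring.
have ta : `|tau * al| <= 2^-1.
  rewrite -(@ler_pXn2r _ 2) ?nnegrE// real_normK ?num_real// exprMn.
  apply: (@le_trans _ _ (tau ^+ 2 * dotprod w w)); last by lra.
  by rewrite ler_wpM2l ?sqr_ge0.
have a1 : 2^-1 <= 1 + tau * al by move: ta; rewrite ler_norml => /andP[? ?]; lra.
set r := euclid_norm (u + tau *: w).
have r2 : r ^+ 2 = q by rewrite euclid_norm_sqr.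
have r0 : 0 <= r by exact: euclid_norm_ge0.
have tal2 : (tau * al) ^+ 2 <= tau ^+ 2 * dotprod w w by rewrite exprMn ler_wpM2l ?sqr_ge0.
have rge : 1 + tau * al <= r.
  rewrite -(@ler_pXn2r _ 2) ?nnegrE//; last by lra.
  by rewrite r2 qE; lra.
have rhalf : 2^-1 <= r by lra.
have rpos : 0 < r by lra.
have diff : r - (1 + tau * al) <= tau ^+ 2 * dotprod w w.
  have e : (r - (1 + tau * al)) * (r + (1 + tau * al)) = tau ^+ 2 * dotprod w w - (tau * al) ^+ 2.
    transitivity (r ^+ 2 - (1 + tau * al) ^+ 2); first by ring.
    by rewrite r2 qE; ring.
  have : (r - (1 + tau * al)) * 1 <= (r - (1 + tau * al)) * (r + (1 + tau * al)).
    by rewrite ler_wpM2l//; lra.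
  by rewrite e mulr1; have := sqr_ge0 (tau * al); lra.
have wy : dotprod w y = be + mm * al.
  by rewrite /be dotprodDr dotprodNr dotprodZr (dotprodC w u) -/al; ring.
have dE : dotprod (@direction R n (u + tau *: w)) y = r^-1 * (mm * (1 + tau * al) + tau * be).
  by rewrite /direction dotprodZl -/r dotprodDl dotprodZl -/mm wy; congr (_ * _); ring.
have -> : mm - dotprod (@direction R n (u + tau *: w)) y =
   r^-1 * (mm * (r - (1 + tau * al)) - tau * be).
  by rewrite dE; field; rewrite gt_eqF.
have rinv : r^-1 <= 2 by rewrite invf_ple ?posrE.
have t1 : mm * (r - (1 + tau * al)) - tau * be <= tau ^+ 2 * dotprod w w + `|tau| * `|be|.
  apply: lerD; last by rewrite -normrM -normrN ler_norm.
  by apply: le_trans diff; rewrite ler_piMl//; lra.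
have p0 : 0 <= tau ^+ 2 * dotprod w w + `|tau| * `|be|.
  by rewrite addr_ge0// mulr_ge0// sqr_ge0.
apply: (@le_trans _ _ (r^-1 * (tau ^+ 2 * dotprod w w + `|tau| * `|be|))).
  by rewrite ler_wpM2l ?invr_ge0.
apply: (@le_trans _ _ (2 * (tau ^+ 2 * dotprod w w + `|tau| * `|be|))).
  by rewrite ler_wpM2r.
have : 0 <= tau ^+ 2 * dotprod w w by rewrite mulr_ge0 ?sqr_ge0.
by rewrite -[2 * `|tau| * _]mulrA; move: (tau ^+ 2 * dotprod w w) (`|tau| * `|be|) => A B; lra.
Qed.

(** The squared chordal distance from a unit vector u to a nonempty net s is 2 - 2 times this
    maximum; the initial value -1 is the least scalar product of two unit vectors. *)
Fixpoint maxdot (s : seq 'rV[R]_n) u : R :=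
  if s is y :: s' then Num.max (dotprod u y) (maxdot s' u) else -1.

Lemma maxdot_ge s u y : y \in s -> dotprod u y <= maxdot s u.
Proof.
elim: s => //= z s IH; rewrite inE le_max => /predU1P[->|/IH ->]; first by rewrite lexx.
by rewrite orbT.
Qed.

Lemma maxdot_attained s u : s != [::] -> (forall y, y \in s -> -1 <= dotprod u y) ->
  exists2 y, y \in s & maxdot s u = dotprod u y.
Proof.
elim: s => //= z s IH _ h.
have [->|s0] := eqVneq s [::].
  exists z; rewrite ?inE ?eqxx//= max_l//; exact: h (mem_head _ _).
have [y ys e] := IH s0 (fun y ys => h y (mem_behead (s := z :: s) ys)).
have [zy|yz] := leP (dotprod u z) (maxdot s u).
  by exists y; rewrite ?inE ?ys ?orbT.
by exists z; rewrite ?inE ?eqxx.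
Qed.

Lemma maxdot_le1 s u : (forall y, y \in s -> dotprod u y <= 1) -> maxdot s u <= 1.
Proof.
elim: s => /= [_|y s IH h]; first by lra.
by rewrite ge_max h ?mem_head//= IH// => z zs; apply: h; rewrite inE zs orbT.
Qed.

Lemma measurable_maxdot s d (X : measurableType d) (f : X -> borel_rV R n) :
  measurable_fun setT f -> measurable_fun setT (fun t : X => maxdot s (f t)).
Proof.
move=> mf; elim: s => [|y s IH] /=; first exact: measurable_cst.
by apply: measurable_maxr => //; exact: measurable_dotprod.
Qed.
End Direction.

(** * The cutoff built on a finite net, and its variation *)

Section Cutoff.
Context (R : realType) (n : nat).
Notation T := (borel_rV R n).
Variables (s : seq 'rV[R]_n) (e : R).
Hypotheses (s0 : s != [::]) (sS : forall y, y \in s -> @sphere R n y) (e0 : 0 < e) (e1 : e <= 1).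

(** Squared chordal distance from the direction to the net, in units of [e] and capped at 1.
    Squaring makes it linear in [maxdot] below the cap, hence easy to expand even close to the
    net. *)
Definition cutoff (x : T) : R := Num.min 1 ((2 - 2 * maxdot s (direction x)) / e ^+ 2).

(** Chordal distance to the net inside the collar and 0 outside: times 2 / e^2, it bounds the
    gradient of [cutoff] at points of the sphere. *)
Definition slope (u : T) : R :=
  if 2 - 2 * maxdot s u < e ^+ 2 then Num.sqrt (2 - 2 * maxdot s u) else 0.

Lemma measurable_cutoff : measurable_fun setT cutoff.
Proof.
apply: measurable_minr => //; apply: measurable_funM => //; apply: measurable_funB => //.
by apply: measurable_funM => //; apply: measurable_maxdot; exact: measurable_direction.
Qed.

Lemma measurable_slope : measurable_fun setT slope.
Proof.
have mm : measurable_fun setT (fun u : T => 2 - 2 * maxdot s u).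
  by apply: measurable_funB => //; apply: measurable_funM => //; exact: measurable_maxdot.
apply: measurable_fun_ifT => //; first exact: measurable_fun_ltr.
exact: (measurableT_comp (@measurable_sqrt R) mm).
Qed.

Lemma slope_ge0 u : 0 <= slope u.
Proof. by rewrite /slope; case: ifP => // _; exact: sqrtr_ge0. Qed.

Lemma cutoff_ge0 x : 0 <= cutoff x.
Proof.
rewrite /cutoff le_min ler01 divr_ge0 ?sqr_ge0// subr_ge0.
have : maxdot s (direction x) <= 1.
  by apply: maxdot_le1 => y ys; apply: dotprod_direction_le; exact: sS.
by lra.
Qed.

Lemma cutoff_le1 x : cutoff x <= 1.
Proof. by rewrite /cutoff ge_min lexx. Qed.

(* v is the component orthogonal to x of the net point closest to the direction of x. *)
Lemma cutoff_move (x : 'rV[R]_n) : exists2 v : 'rV[R]_n,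
  euclid_norm v <= slope (@direction R n x) &
  forall (z : 'rV[R]_n) (h c t : R), 2^-1 <= c -> `|t| <= h ->
    cutoff (c *: x + t *: z) - cutoff x <=
    2 / e ^+ 2 * (4 * h / euclid_norm x * `|dotprod z v| +
       Num.min 2 (32 * h ^+ 2 * (euclid_norm z / euclid_norm x) ^+ 2)).
Proof.
have ee : 0 < e ^+ 2 by rewrite exprn_gt0.
have rhs0 z h (b : R) : 0 <= h -> 0 <= 2 / e ^+ 2 * (4 * h / euclid_norm x * `|b| +
       Num.min 2 (32 * h ^+ 2 * (euclid_norm z / euclid_norm x) ^+ 2)).
  move=> h0; rewrite mulr_ge0 ?divr_ge0 ?(ltW ee)// addr_ge0//.
    by rewrite !mulr_ge0 ?invr_ge0 ?euclid_norm_ge0.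
  by rewrite le_min; apply/andP; split=> //; apply: mulr_ge0; [apply: mulr_ge0|]; rewrite ?sqr_ge0.
have [big|small] := leP (e ^+ 2) (2 - 2 * maxdot s (@direction R n x)).
  (* Where the cutoff equals 1 it cannot increase, so v = 0 serves. *)
  exists 0.
    by rewrite (_ : euclid_norm 0 = 0) ?slope_ge0//; apply/eqP; rewrite euclid_norm_eq0.
  move=> z h c t c2 th; apply: (@le_trans _ _ 0); last exact: rhs0 (le_trans (normr_ge0 t) th).
  have -> : cutoff x = 1 by rewrite /cutoff min_l// ler_pdivlMr ?mul1r.
  by rewrite subr_le0 cutoff_le1.
have [u uE] : exists u : 'rV[R]_n, @direction R n x = u by exists (@direction R n x).
rewrite uE in small *.
(* The zero vector has direction 0, where [maxdot] is 0; the collar condition would then read 2 <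
   e^2. *)
have x0 : x != 0.
  apply/eqP => x0; move: small; rewrite -uE x0 /direction scaler0 => small.
  have [y ys yE] : exists2 y, y \in s & maxdot s 0 = dotprod 0 y.
    by apply: maxdot_attained => // y _; rewrite -(scale0r y) dotprodZl mul0r; lra.
  move: small; rewrite yE -(scale0r y) dotprodZl mul0r mulr0 subr0.
  by apply/negP; rewrite -leNgt (@le_trans _ _ 1) ?exprn_ile1 ?(ltW e0)// ler1n.
have u1 : @sphere R n u by rewrite -uE; exact: direction_sphere.
have [y ys yE] := maxdot_attained s0 (fun y ys => dotprod_direction_ge x (sS ys)).
have y1 := sS ys; rewrite uE in yE.
have r0 : 0 < euclid_norm x by rewrite euclid_norm_gt0.
have uu : dotprod u u = 1 by apply/sphereP.
have yy : dotprod y y = 1 by apply/sphereP.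
have /andP[mm1 mm2] := dotprod_sphere_le1 u1 y1.
set mm := dotprod u y in yE mm1 mm2.
exists (y - mm *: u).
  rewrite /slope yE ifT; last by rewrite -yE.
  rewrite /euclid_norm ler_sqrt; last by lra.
  rewrite dotprodDl !dotprodDr !dotprodNl !dotprodNr !dotprodZl !dotprodZr uu yy (dotprodC y u) -/mm.
  by nra.
move=> z h c t c2 th.
have c0 : 0 < c by lra.
have h0 : 0 <= h := le_trans (normr_ge0 t) th.
pose w := (euclid_norm x)^-1 *: z; pose tau := t / c.
have tauh : `|tau| <= 2 * h.
  rewrite normrM normfV (gtr0_norm c0) ler_pdivrMr//; nra.
have xE : x = euclid_norm x *: u by rewrite -uE /direction scalerA divff ?scale1r// gt_eqF.
have dirE : @direction R n (c *: x + t *: z) = @direction R n (u + tau *: w).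
  rewrite -(directionZ (u + tau *: w) (mulr_gt0 c0 r0)); congr (@direction R n _).
  rewrite scalerDr -scalerA -xE; congr (_ + _).
  rewrite /w /tau !scalerA; congr (_ *: _); field; rewrite !gt_eqF//.
have Fx : cutoff x = (2 - 2 * mm) / e ^+ 2.
  by rewrite /cutoff uE yE min_r// ler_pdivrMr// mul1r -yE ltW.
(* After the move the old nearest point y still bounds the distance from above, which is why only
   increases are controlled. *)
have Fh : cutoff (c *: x + t *: z) <= (2 - 2 * dotprod (@direction R n (u + tau *: w)) y) / e ^+ 2.
  rewrite /cutoff ge_min dirE; apply/orP; right.
  rewrite ler_pM2r ?invr_gt0// lerD2l lerN2 ler_pM2l//; exact: maxdot_ge.
apply: (@le_trans _ _ (2 / e ^+ 2 * (mm - dotprod (@direction R n (u + tau *: w)) y))).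
  rewrite Fx; apply: le_trans (lerB Fh (lexx _)) _.
  by rewrite le_eqVlt; apply/orP; left; apply/eqP; field; rewrite gt_eqF.
rewrite ler_pM2l; last by rewrite divr_gt0.
apply: (le_trans (dir_move w tau u1 y1)); rewrite addrC; apply: lerD.
  have ri0 : 0 < (euclid_norm x)^-1 by rewrite invr_gt0.
  have -> : dotprod w (y - dotprod u y *: u) = (euclid_norm x)^-1 * dotprod z (y - mm *: u).
    exact: dotprodZl.
  rewrite [`|_ * dotprod z _|]normrM (gtr0_norm ri0) mulrA.
  rewrite ler_wpM2r//.
  have -> : 4 * h / euclid_norm x = 2 * (2 * h) / euclid_norm x by ring.
  by rewrite ler_wpM2r ?invr_ge0 ?(ltW r0)// ler_wpM2l.
rewrite le_min ge_min lexx/= ge_min; apply/orP; right.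
have -> : dotprod w w = (euclid_norm z / euclid_norm x) ^+ 2.
  by rewrite -euclid_norm_sqr /w euclid_normZ gtr0_norm ?invr_gt0// mulrC.
rewrite ler_wpM2r ?sqr_ge0//.
have th2 : tau ^+ 2 <= 4 * h ^+ 2.
  have -> : 4 * h ^+ 2 = (2 * h) ^+ 2 by ring.
  by rewrite -[tau ^+ 2]real_normK ?num_real// lerXn2r ?nnegrE ?mulr_ge0.
by move: th2; move: (tau ^+ 2) (h ^+ 2) => A B; lra.
Qed.
End Cutoff.

(** * Mean displacement of a function along a rotation *)

Section Displacement.
Local Open Scope ereal_scope.
Context (R : realType) (n : nat).
Notation T := (borel_rV R n).
Notation g := (gauss R n).
Variable F : T -> R.
Hypothesis mF : measurable_fun setT F.

Definition displacement (h : R) : \bar R :=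
  \int[g]_x \int[g]_z `|F (lin (cos h) (sin h) x z) - F x|%:E.

(** Counts increases only, in accordance with the one-sided bound [cutoff_move]. *)
Definition climb (h : R) : \bar R :=
  \int[g]_x \int[g]_z (Num.max 0 (F (lin (cos h) (sin h) x z) - F x))%:E.

Let mFlin c s : measurable_fun setT (fun p : T * T => F (lin c s p.1 p.2)).
Proof. exact: (measurableT_comp mF (measurable_lin_pair c s)). Qed.

Let mF1 : measurable_fun setT (fun p : T * T => F p.1).
Proof. exact: (measurableT_comp mF measurable_fst). Qed.

Let mDlin c s : measurable_fun setT (fun p : T * T => `|F (lin c s p.1 p.2) - F p.1|%:E).
Proof. by apply/measurable_EFinP; apply: measurableT_comp => //; exact: measurable_funB. Qed.

Let lin_rot c1 s1 c2 s2 (x z : T) :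
  lin c2 s2 (rot c1 s1 (x, z)).1 (rot c1 s1 (x, z)).2 =
  lin (c2 * c1 - s2 * s1) (s2 * c1 + c2 * s1) x z.
Proof. by apply/rowP => i; rewrite linE !mxE; ring. Qed.

Let pmeas (G : T * T -> \bar R) : measurable_fun setT G -> (forall p, 0 <= G p) ->
  measurable_fun setT (fun x => \int[g]_y G (x, y)).
Proof. exact: (measurable_partial_integral g). Qed.

Let pmeas1 (G : T * T -> \bar R) x : measurable_fun setT G ->
  measurable_fun setT (fun z => G (x, z)).
Proof. by move=> mG; exact: (measurableT_comp mG (measurable_pair1 x)). Qed.

(** The rotation by h1 preserves the law of the Gaussian pair and turns the second leg of the path
    into a move by h2 from a Gaussian starting point. *)
Lemma displacementD h1 h2 : displacement (h1 + h2) <= displacement h1 + displacement h2.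
Proof.
pose G2 := fun p : T * T => `|F (lin (cos h2) (sin h2) p.1 p.2) - F p.1|%:E.
pose G1 := fun p : T * T => `|F (lin (cos h1) (sin h1) p.1 p.2) - F p.1|%:E.
have mG2 : measurable_fun setT G2 by exact: mDlin.
have mG1 : measurable_fun setT G1 by exact: mDlin.
have G20 p : 0 <= G2 p by rewrite lee_fin.
have G10 p : 0 <= G1 p by rewrite lee_fin.
have cs : (cos h1 ^+ 2 + sin h1 ^+ 2 = 1)%R by exact: cos2Dsin2.
have mG2r : measurable_fun setT (fun p => G2 (rot (cos h1) (sin h1) p)).
  exact: (measurableT_comp mG2 (@measurable_rot R n _ _)).
have e2 : displacement h2 = \int[g]_x \int[g]_z G2 (rot (cos h1) (sin h1) (x, z)).
  by apply: esym; exact: (rotation_gauss mG2 G20 cs).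
have e : displacement h1 + displacement h2 =
    \int[g]_x (\int[g]_z G1 (x, z) + \int[g]_z G2 (rot (cos h1) (sin h1) (x, z))).
  rewrite e2; apply: esym; apply: integralD_T.
  - exact: pmeas.
  - by move=> x; exact: integral_ge0.
  - exact: (pmeas mG2r).
  - by move=> x; exact: integral_ge0.
rewrite e; apply: le_integral_T.
- exact: (pmeas (mDlin _ _)).
- by move=> x; apply: integral_ge0.
- by apply: emeasurable_funD; [exact: pmeas|exact: (pmeas mG2r)].
- move=> x.
  have -> : \int[g]_z G1 (x, z) + \int[g]_z G2 (rot (cos h1) (sin h1) (x, z)) =
     \int[g]_z (G1 (x, z) + G2 (rot (cos h1) (sin h1) (x, z))).
    apply: esym; apply: integralD_T.
    - exact: pmeas1.
    - by move=> z; exact: G10.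
    - exact: (pmeas1 _ mG2r).
    - by move=> z; exact: G20.
  apply: le_integral_T.
  + exact: (pmeas1 _ (mDlin (cos (h1 + h2)) (sin (h1 + h2)))).
  + by move=> z; rewrite lee_fin.
  + by apply: emeasurable_funD; [exact: pmeas1|exact: (pmeas1 _ mG2r)].
  + move=> z; rewrite /G1 /G2 lin_rot /= -EFinD lee_fin [leRHS]addrC.
    have -> : (cos h2 * cos h1 - sin h2 * sin h1 = cos (h1 + h2))%R by rewrite cosD; ring.
    have -> : (sin h2 * cos h1 + cos h2 * sin h1 = sin (h1 + h2))%R by rewrite sinD; ring.
    exact: (ler_distD (F (lin (cos h1) (sin h1) x z))).
Qed.

Lemma displacementMn h N : displacement (N.+1%:R * h) <= N.+1%:R%:E * displacement h.
Proof.
have d0 h' : 0 <= displacement h'.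
  by apply: integral_ge0 => x _; apply: integral_ge0 => z _; rewrite lee_fin.
elim: N => [|N IH]; first by rewrite mul1r mul1e.
rewrite -[in leLHS](natr1 N.+1) mulrDl mul1r (le_trans (displacementD _ _))//.
by rewrite -[in leRHS](natr1 N.+1) EFinD ge0_muleDl ?lee_fin// mul1e leeD2r.
Qed.

(** A decrease over the angle h becomes an increase over - h when a rotation exchanges the start and
    end points. *)
Lemma displacementE h : displacement h = climb h + climb (- h).
Proof.
pose Gm c s := fun p : T * T => (Num.max 0 (F p.1 - F (lin c s p.1 p.2)))%:E.
pose Gp c s := fun p : T * T => (Num.max 0 (F (lin c s p.1 p.2) - F p.1))%:E.
have mGm c s : measurable_fun setT (Gm c s).
  by apply/measurable_EFinP; apply: measurable_maxr => //; exact: measurable_funB.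
have mGp c s : measurable_fun setT (Gp c s).
  by apply/measurable_EFinP; apply: measurable_maxr => //; exact: measurable_funB.
have Gm0 c s p : 0 <= Gm c s p by rewrite lee_fin le_max lexx.
have Gp0 c s p : 0 <= Gp c s p by rewrite lee_fin le_max lexx.
have -> : climb (- h) = \int[g]_x \int[g]_z Gm (cos h) (sin h) (x, z).
  have cs : (cos (- h) ^+ 2 + sin (- h) ^+ 2 = 1)%R by exact: cos2Dsin2.
  apply: etrans _ (rotation_gauss (mGm (cos h) (sin h)) (Gm0 _ _) cs).
  apply: eq_integral => x _; apply: eq_integral => z _; rewrite /Gm lin_rot /=.
  rewrite cosN sinN.
  have -> : (cos h * cos h - sin h * - sin h = 1)%R by rewrite -(cos2Dsin2 h); ring.
  have -> : (sin h * cos h + cos h * - sin h = 0)%R by ring.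
  congr (Num.max 0 (F _ - F _))%:E; by apply/rowP => i; rewrite !mxE; ring.
apply: etrans (integralD_T g (pmeas (mGp (cos h) (sin h)) (Gp0 _ _)) _
  (pmeas (mGm (cos h) (sin h)) (Gm0 _ _)) _).
- apply: eq_integral => x _.
  apply: etrans (integralD_T g (pmeas1 x (mGp (cos h) (sin h))) _
    (pmeas1 x (mGm (cos h) (sin h))) _) => //.
  apply: eq_integral => z _; rewrite /Gp /Gm /= -EFinD; congr EFin.
  rewrite -(opprB _ (F x)); move: (F _ - F x)%R => t.
  rewrite /Num.max; have [t0|t0|<-] := ltgtP 0%R t.
  + by rewrite gtr0_norm// oppr_gt0 ltNge (ltW t0)/= addr0.
  + by rewrite ltr0_norm// oppr_gt0 t0 add0r.
  + by rewrite normr0 oppr0 ltxx addr0.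
- by move=> x; exact: integral_ge0.
- by move=> x; exact: integral_ge0.
Qed.
End Displacement.

(** * Second-order error terms *)

Section CutoffDisplacement.
Local Open Scope ereal_scope.
Context (R : realType) (m : nat).
Notation n := m.+1.
Notation T := (borel_rV R n).
Notation g := (gauss R n).
Hypothesis n2 : (2 <= n)%N.

Definition move_error (h : R) (x z : T) : R :=
  (Num.min 2 (32 * h ^+ 2 * (euclid_norm z / euclid_norm x) ^+ 2))%R.

Lemma measurable_move_error h : measurable_fun setT (fun p : T * T => (move_error h p.1 p.2)%:E).
Proof.
apply/measurable_EFinP; apply: measurable_minr => //; apply: measurable_funM => //.
apply: measurable_funX; apply: measurable_funM.
  by apply: measurable_euclid_norm; exact: measurable_snd.
apply: (measurableT_comp (@measurable_inv R)).
by apply: measurable_euclid_norm; exact: measurable_fst.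
Qed.

Lemma move_error_ge0 h x z : (0 <= move_error h x z)%R.
Proof. by rewrite le_min ler0n/= mulr_ge0 ?sqr_ge0// mulr_ge0 ?sqr_ge0. Qed.

(** The first term is linear in the inverse norm [t], hence integrable. The second is quadratic in
    [h], hence negligible for each fixed x even after multiplication by the number of steps. In
    dimension 2 both are required. *)
Definition move_bound (h t : R) : R :=
  (Num.min (12 * h * t * (1 + 6 * n%:R)) (32 * h ^+ 2 * t ^+ 2 * (6 * n%:R)))%R.

Lemma integral_move_error h x : (0 <= h)%R ->
  \int[g]_z (move_error h x z)%:E <= (move_bound h (euclid_norm x)^-1)%:E.
Proof.
move=> h0; set t := (euclid_norm x)^-1%R.
have t0 : (0 <= t)%R by rewrite invr_ge0 euclid_norm_ge0.
have mE : measurable_fun setT (fun z => (move_error h x z)%:E).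
  exact: (measurableT_comp (measurable_move_error h) (measurable_pair1 x)).
have E0 z : 0 <= (move_error h x z)%:E by rewrite lee_fin move_error_ge0.
have md : measurable_fun setT (fun z : T => (dotprod z z)%:E).
  by apply/measurable_EFinP; exact: measurable_dotprod_self.
have d0 (z : T) : 0 <= (dotprod z z)%:E by rewrite lee_fin dotprod_ge0.
have b0 : (0 <= 12 * h * t)%R by rewrite !mulr_ge0.
have b1 : (0 <= 32 * h ^+ 2 * t ^+ 2)%R by rewrite !mulr_ge0 ?sqr_ge0.
rewrite /move_bound EFin_min le_min; apply/andP; split.
- apply: (@le_trans _ _ (\int[g]_z ((12 * h * t)%:E * (1%:E + (dotprod z z)%:E)))).
    apply: le_integral_T => //.
      by apply: emeasurable_funM => //; exact: emeasurable_funD.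
    move=> z; rewrite -EFinD -EFinM lee_fin /move_error -/t -euclid_norm_sqr.
    have z0 := euclid_norm_ge0 z; set r := euclid_norm z in z0 *.
    have rt0 : (0 <= h * (r * t))%R by rewrite !mulr_ge0.
    apply: (@le_trans _ _ (12 * (h * (r * t)))%R).
      have -> : (32 * h ^+ 2 * (r * t) ^+ 2 = 32 * (h * (r * t)) ^+ 2)%R by ring.
      set b := (h * (r * t))%R in rt0 *.
      (* At b = 1/4 both terms of the minimum equal 2. Below, the quadratic term is at most 8 b;
         above, the constant one is. *)
      by have [b3|b3] := leP b 4^-1%R; rewrite ge_min; apply/orP; [right|left]; nra.
    have -> : (12 * (h * (r * t)) = 12 * h * t * r)%R by ring.
    by rewrite ler_wpM2l//; nra.
  rewrite integralZl_T//; [|exact: emeasurable_funD|by move=> z; rewrite adde_ge0].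
  rewrite [leRHS]EFinM lee_wpmul2l//.
  rewrite integralD_T// integral_cst_prob EFinD leeD2l//; exact: gauss_dotprod_self.
- apply: (@le_trans _ _ (\int[g]_z ((32 * h ^+ 2 * t ^+ 2)%:E * (dotprod z z)%:E))).
    apply: le_integral_T => //; first by apply: emeasurable_funM.
    move=> z; rewrite -EFinM lee_fin /move_error -/t -euclid_norm_sqr ge_min.
    by apply/orP; right; rewrite exprMn mulrA mulrAC.
  by rewrite integralZl_T// [leRHS]EFinM lee_wpmul2l//; exact: gauss_dotprod_self.
Qed.

(* Only the first moment of 1/|x| is finite when n = 2, which is why the error
   term is controlled by dominated convergence. *)
Lemma move_error_small (theta eps : R) : (0 < theta)%R -> (0 < eps)%R -> exists N : nat,
  (theta / N.+1%:R <= 1)%R /\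
  N.+1%:R%:E * \int[g]_x \int[g]_z (move_error (theta / N.+1%:R) x z)%:E <= eps%:E.
Proof.
move=> th0 eps0.
pose t (x : T) := (euclid_norm x)^-1%R.
have t0 x : (0 <= t x)%R by rewrite invr_ge0 euclid_norm_ge0.
have mt : measurable_fun setT t.
  by apply: (measurableT_comp (@measurable_inv R)); exact: measurable_euclid_norm.
pose K1 := (12 * theta * (1 + 6 * n%:R) : R)%R.
pose K2 := (32 * theta ^+ 2 * (6 * n%:R) : R)%R.
have K10 : (0 <= K1)%R by rewrite mulr_ge0 ?addr_ge0 ?mulr_ge0 ?(ltW th0).
have K20 : (0 <= K2)%R.
  by apply: mulr_ge0; [apply: mulr_ge0; rewrite ?sqr_ge0|apply: mulr_ge0].
pose f (N : nat) (x : T) := (Num.min (K1 * t x) (K2 * t x ^+ 2 * N.+1%:R^-1))%R.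
have mf N : measurable_fun setT (f N).
  by apply: measurable_minr; apply: measurable_funM => //; apply: measurable_funM => //;
     exact: measurable_funX.
have f0 N x : (0 <= f N x)%R.
  rewrite le_min; apply/andP; split; first exact: mulr_ge0.
  by apply: mulr_ge0; [apply: mulr_ge0; rewrite ?sqr_ge0|rewrite invr_ge0].
have scale N x : (N.+1%:R * move_bound (theta / N.+1%:R) (t x) = f N x)%R.
  have : (0 < N.+1%:R :> R)%R by [].
  rewrite /move_bound /f /K1 /K2; move: (N.+1%:R : R)%R (6 * n%:R : R)%R (t x) => M D u M0.
  rewrite minr_pMr ?(ltW M0)//; congr Num.min.
    by field; rewrite gt_eqF.
  by field; rewrite gt_eqF.
have cvgf : \int[g]_x (f N x)%:E @[N --> \oo] --> 0.
  rewrite -[X in _ --> X](integral0 g setT).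
  apply: (@dominated_cvg _ _ _ g setT measurableT (fun N x => (f N x)%:E) (fun=> 0)
     (fun x => (K1 * t x)%:E)) => //.
  - by move=> N; apply/measurable_EFinP.
  - move=> x _; apply/fine_cvgP; split; first by near=> N.
    apply: (@squeeze_cvgr _ _ _ _ (fun=> 0%R) (fun N => (K2 * t x ^+ 2) * N.+1%:R^-1)%R).
    + by near=> N; rewrite /= f0/= ge_min lexx orbT.
    + exact: cvg_cst.
    + rewrite -[X in _ --> X](mulr0 (K2 * t x ^+ 2)%R).
      by apply: cvgM; [exact: cvg_cst|exact: cvg_harmonic].
  - apply/integrableP; split; first by apply/measurable_EFinP; exact: measurable_funM.
    apply: (@le_lt_trans _ _ (K1%:E * \int[g]_x (t x)%:E)).
      rewrite -integralZl_T//; [|exact/measurable_EFinP].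
      apply: le_integral_T => //.
      + by apply/measurable_EFinP; apply: measurableT_comp => //; exact: measurable_funM.
      + by apply: emeasurable_funM => //; exact/measurable_EFinP.
      + by move=> x; rewrite /= -EFinM lee_fin ger0_norm// mulr_ge0.
    apply: (@le_lt_trans _ _ (K1%:E * (C_inv R / Num.sqrt n%:R)%:E)); last by rewrite -EFinM ltry.
    by rewrite lee_wpmul2l//; exact: gauss_inv_norm.
  - by move=> N x _; rewrite /= lee_fin ger0_norm ?f0// ge_min lexx.
have [N [hN1 hN2]] : exists N : nat, (theta / N.+1%:R <= 1)%R /\ \int[g]_x (f N x)%:E <= eps%:E.
  have h1 : \forall N \near \oo, (theta / N.+1%:R <= 1)%R.
    have : (theta * N.+1%:R^-1)%R @[N --> \oo] --> (theta * 0)%R.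
      by apply: cvgM; [exact: cvg_cst|exact: cvg_harmonic].
    rewrite mulr0 => /cvgr_le; exact.
  have h2 : \forall N \near \oo, \int[g]_x (f N x)%:E <= eps%:E.
    have /fine_cvgP[fin cv] := cvgf.
    have : \forall N \near \oo, (fine (\int[g]_x (f N x)%:E) <= eps)%R.
      by move/cvgr_le : cv; exact.
    move=> le; near=> N; rewrite -[leLHS]fineK; first by rewrite lee_fin; near: N.
    by near: N.
  have [N _ /(_ N (leqnn N)) hN] : \forall N \near \oo, (theta / N.+1%:R <= 1)%R /\ \int[g]_x (f N x)%:E <= eps%:E.
    by near=> N; split; near: N.
  by exists N.
exists N; split => //.
apply: le_trans hN2.
have mE := measurable_move_error (theta / N.+1%:R).
have h0 : (0 <= theta / N.+1%:R)%R by rewrite divr_ge0// ltW.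
rewrite -integralZl_T//.
- apply: le_integral_T.
  + apply: emeasurable_funM => //.
    by apply: (measurable_partial_integral g mE) => p; rewrite lee_fin move_error_ge0.
  + move=> x; rewrite mule_ge0 ?lee_fin// integral_ge0// => z _.
    by rewrite lee_fin move_error_ge0.
  + exact/measurable_EFinP.
  + by move=> x; rewrite -scale EFinM lee_wpmul2l ?lee_fin//; exact: integral_move_error.
- by apply: (measurable_partial_integral g mE) => p; rewrite lee_fin move_error_ge0.
- by move=> x; apply: integral_ge0 => z _; rewrite lee_fin move_error_ge0.
Unshelve. all: by end_near.
Qed.
End CutoffDisplacement.

Section CutoffDisplacementBound.
Local Open Scope ereal_scope.
Context (R : realType) (m : nat).
Notation n := m.+1.
Notation T := (borel_rV R n).
Notation g := (gauss R n).
Variable sigma : probability T R.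
Hypotheses (n2 : (2 <= n)%N) (haar : is_sphere_haar sigma).
Variables (s : seq 'rV[R]_n) (e : R).
Hypotheses (s0 : s != [::]) (sS : forall y, y \in s -> @sphere R n y).
Hypotheses (e0 : (0 < e)%R) (e1 : (e <= 1)%R).

Let mdivslope : measurable_fun setT (fun x : T => (slope s e (direction x) / euclid_norm x)%R).
Proof.
apply: measurable_funM.
  by apply: (measurableT_comp (measurable_slope s e)); exact: measurable_direction.
by apply: (measurableT_comp (@measurable_inv R)); exact: measurable_euclid_norm.
Qed.

Let divslope_ge0 x : (0 <= slope s e (direction x) / euclid_norm x)%R.
Proof. by rewrite divr_ge0 ?slope_ge0 ?euclid_norm_ge0. Qed.

(** Integrates [cutoff_move] over the noise z: the mean of |<z, v>| is at most 4 |v|, and with the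
    factor 4 already there this gives 16. The step enters through the bound [h0] on |sin h|, so that
    h and - h are treated alike. *)
Lemma climb_cutoff (h0 h : R) : (0 <= h0)%R -> (`|sin h| <= h0)%R -> (2^-1 <= cos h)%R ->
  climb (cutoff s e) h <= (2 / e ^+ 2)%:E *
    ((16 * h0)%:E * \int[g]_x (slope s e (direction x) / euclid_norm x)%:E +
     \int[g]_x \int[g]_z (move_error h0 x z)%:E).
Proof.
move=> h00 sh ch.
have mE := @measurable_move_error R m h0.
have mE1 (x : T) : measurable_fun setT (fun z : T => (move_error h0 x z)%:E).
  exact: (measurableT_comp mE (measurable_pair1 x)).
have E0 (p : T * T) : 0 <= (move_error h0 p.1 p.2)%:E by rewrite lee_fin move_error_ge0.
have mIE : measurable_fun setT (fun x : T => \int[g]_z (move_error h0 x z)%:E).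
  exact: (measurable_partial_integral g mE E0).
have IE0 x : 0 <= \int[g]_z (move_error h0 x z)%:E.
  by apply: integral_ge0 => z _; exact: (E0 (x, z)).
have c0 : (0 <= 2 / e ^+ 2)%R by rewrite divr_ge0 ?sqr_ge0.
have h160 : (0 <= 16 * h0)%R by rewrite mulr_ge0.
have mdE : measurable_fun setT (fun x : T => (slope s e (direction x) / euclid_norm x)%:E).
  by apply/measurable_EFinP.
have mc := measurable_cutoff s e.
have mcl : measurable_fun setT (fun p : T * T =>
    (Num.max 0 (cutoff s e (lin (cos h) (sin h) p.1 p.2) - cutoff s e p.1))%:E).
  apply/measurable_EFinP; apply: measurable_maxr => //; apply: measurable_funB.
    exact: (measurableT_comp mc (measurable_lin_pair _ _)).
  exact: (measurableT_comp mc measurable_fst).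
have cl0 (p : T * T) : 0 <= (Num.max 0 (cutoff s e (lin (cos h) (sin h) p.1 p.2) - cutoff s e p.1))%:E.
  by rewrite lee_fin le_max lexx.
have [J JE] : exists J : T -> \bar R, (fun x => \int[g]_z (move_error h0 x z)%:E) = J.
  by eexists.
have JEx x : J x = \int[g]_z (move_error h0 x z)%:E by rewrite -JE.
have -> : \int[g]_x \int[g]_z (move_error h0 x z)%:E = \int[g]_x J x by rewrite -JE.
rewrite JE in mIE; have {}IE0 x : 0 <= J x by rewrite -JE.
have -> : (2 / e ^+ 2)%:E *
    ((16 * h0)%:E * \int[g]_x (slope s e (direction x) / euclid_norm x)%:E +
     \int[g]_x J x) =
  \int[g]_x ((2 / e ^+ 2)%:E * ((16 * h0)%:E * (slope s e (direction x) / euclid_norm x)%:E + J x)).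
  rewrite integralZl_T//; first last.
  - by move=> x; rewrite adde_ge0// mule_ge0// lee_fin.
  - by apply: emeasurable_funD => //; exact: emeasurable_funM.
  congr (_ * _); rewrite integralD_T//.
  - by congr (_ + _); rewrite integralZl_T// => x; rewrite lee_fin.
  - by apply: emeasurable_funM.
  - by move=> x; rewrite mule_ge0// lee_fin.
apply: le_integral_T.
- exact: (measurable_partial_integral g mcl cl0).
- by move=> x; apply: integral_ge0 => z _; exact: (cl0 (x, z)).
- by apply: emeasurable_funM => //; apply: emeasurable_funD => //; exact: emeasurable_funM.
move=> x.
have [v vle hv] := cutoff_move s0 sS e0 e1 x.
have x0 := euclid_norm_ge0 x.
have k0 : (0 <= 4 * h0 / euclid_norm x)%R by rewrite mulr_ge0 ?invr_ge0 ?mulr_ge0.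
have mzv : measurable_fun setT (fun z : T => `|dotprod z v|%:E).
  by apply/measurable_EFinP; apply: measurableT_comp => //; exact: measurable_dotprod.
apply: (@le_trans _ _ (\int[g]_z ((2 / e ^+ 2)%:E *
    ((4 * h0 / euclid_norm x)%:E * `|dotprod z v|%:E + (move_error h0 x z)%:E)))).
  apply: le_integral_T.
  - exact: (measurableT_comp mcl (measurable_pair1 x)).
  - by move=> z; exact: (cl0 (x, z)).
  - by apply: emeasurable_funM => //; apply: emeasurable_funD => //; exact: emeasurable_funM.
  - move=> z.
    rewrite -[leRHS]/((2 / e ^+ 2 *
      (4 * h0 / euclid_norm x * `|dotprod z v| + move_error h0 x z))%:E).
    rewrite lee_fin ge_max; apply/andP; split.
      apply: mulr_ge0 => //; apply: addr_ge0; last exact: move_error_ge0.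
      exact: mulr_ge0.
    exact: hv.
rewrite integralZl_T//; first last.
- by move=> z; rewrite adde_ge0// ?mule_ge0// ?lee_fin//; exact: (E0 (x, z)).
- by apply: emeasurable_funD => //; exact: emeasurable_funM.
rewrite lee_wpmul2l// integralD_T//; last 3 first.
- exact: emeasurable_funM.
- by move=> z; rewrite mule_ge0.
- by move=> z; exact: (E0 (x, z)).
rewrite JEx leeD2r// integralZl_T//.
apply: (@le_trans _ _ ((4 * h0 / euclid_norm x)%:E * (4 * euclid_norm v)%:E)).
  by rewrite lee_wpmul2l//; exact: gauss_abs_dotprod.
rewrite -!EFinM lee_fin.
have -> : (4 * h0 / euclid_norm x * (4 * euclid_norm v) =
  16 * h0 * (euclid_norm v / euclid_norm x))%R by ring.
by rewrite ler_wpM2l// ler_wpM2r ?invr_ge0.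
Qed.

(** The slope depends on the direction alone, which is independent of the norm, so the mean of the
    quotient splits. *)
Lemma integral_slope_norm (q : R) : (0 <= q)%R -> \int[sigma]_u (slope s e u)%:E <= q%:E ->
  \int[g]_x (slope s e (direction x) / euclid_norm x)%:E <= (q * (C_inv R / Num.sqrt n%:R))%:E.
Proof.
move=> q0 hq.
(* The absolute value makes [H] nonnegative on the whole line and changes nothing at norms. *)
pose H := fun p : measurableTypeR R * T => (slope s e p.2 / `|p.1|)%:E.
have mH : measurable_fun setT H.
  apply/measurable_EFinP; apply: measurable_funM.
    exact: (measurableT_comp (measurable_slope s e) measurable_snd).
  apply: (measurableT_comp (@measurable_inv R)).
  by apply: measurableT_comp => //; exact: measurable_fst.
have H0 p : 0 <= H p by rewrite lee_fin divr_ge0 ?slope_ge0.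
have nE (x : T) : (`|euclid_norm x| = euclid_norm x)%R by rewrite ger0_norm ?euclid_norm_ge0.
have -> : \int[g]_x (slope s e (direction x) / euclid_norm x)%:E =
   \int[g]_x \int[sigma]_u H (euclid_norm x, u).
  apply: etrans _ (gauss_polar n2 haar mH H0).
  by apply: eq_integral => x _; rewrite /H /= nE.
have mi : measurable_fun setT (fun x : T => (euclid_norm x)^-1%:E).
  apply/measurable_EFinP; apply: (measurableT_comp (@measurable_inv R)).
  exact: measurable_euclid_norm.
have i0 (x : T) : 0 <= (euclid_norm x)^-1%:E by rewrite lee_fin invr_ge0 euclid_norm_ge0.
apply: (@le_trans _ _ (\int[g]_x (q%:E * (euclid_norm x)^-1%:E))).
  apply: le_integral_T.
  - have mn : measurable_fun setT (fun x : T => euclid_norm x : measurableTypeR R).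
      exact: (measurable_euclid_norm (f := id)).
    exact: (measurableT_comp (measurable_partial_integral sigma mH H0) mn).
  - by move=> x; exact: integral_ge0.
  - by apply: emeasurable_funM.
  - move=> x.
    have -> : \int[sigma]_u H (euclid_norm x, u) =
       \int[sigma]_u ((euclid_norm x)^-1%:E * (slope s e u)%:E).
      by apply: eq_integral => u _; rewrite /H /= nE -EFinM mulrC.
    rewrite integralZl_T//.
    + by rewrite muleC lee_wpmul2r.
    + by rewrite invr_ge0 euclid_norm_ge0.
    + by apply/measurable_EFinP; exact: measurable_slope.
    + by move=> u; rewrite lee_fin slope_ge0.
rewrite integralZl_T// [leRHS]EFinM lee_wpmul2l//; exact: gauss_inv_norm.
Qed.

(** The angle is cut into N + 1 equal steps. The first-order terms add up to the bound, with 64 = 2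
    * 2 * 16 for the two orientations, the factor of 2 / e^2 and the constant of [climb_cutoff]; the
    second-order terms add up to at most [eps]. *)
Lemma displacement_cutoff (theta q : R) : (0 < theta)%R -> (0 <= q)%R ->
  \int[sigma]_u (slope s e u)%:E <= q%:E ->
  displacement (cutoff s e) theta <=
    (64 * theta / e ^+ 2 * (q * (C_inv R / Num.sqrt n%:R)))%:E.
Proof.
move=> th0 q0 hq.
have ee : (0 < e ^+ 2)%R by rewrite exprn_gt0.
apply/lee_addgt0Pr => eps eps0.
have eps'0 : (0 < eps * e ^+ 2 / 4)%R by rewrite divr_gt0 ?mulr_gt0.
have [N [hN1 hN2]] := move_error_small n2 th0 eps'0.
set h := (theta / N.+1%:R)%R in hN1 hN2.
have M0 : (0 < N.+1%:R :> R)%R by [].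
have h0 : (0 < h)%R by rewrite divr_gt0.
have thE : theta = (N.+1%:R * h)%R by rewrite /h mulrC divfK// gt_eqF.
have sh : (`|sin h| <= h)%R.
  rewrite -(@ler_pXn2r _ 2) ?nnegrE ?(ltW h0)// real_normK ?num_real//.
  by rewrite sin_sqr_le// ltW.
have ch : (2^-1 <= cos h)%R.
  apply: le_trans (cos_ge (ltW h0)).
  have : (h ^+ 2 <= 1)%R by rewrite exprn_ile1// ltW.
  by move: (h ^+ 2)%R => h2; lra.
set I := \int[g]_x (slope s e (direction x) / euclid_norm x)%:E.
set E := \int[g]_x \int[g]_z _ in hN2.
have IQ := integral_slope_norm q0 hq; rewrite -/I in IQ.
have I0 : 0 <= I by apply: integral_ge0 => x _; rewrite lee_fin.
have E0 : 0 <= E by apply: integral_ge0 => x _; apply: integral_ge0 => z _; rewrite lee_fin move_error_ge0.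
have cl1 : climb (cutoff s e) h <= (2 / e ^+ 2)%:E * ((16 * h)%:E * I + E).
  by apply: climb_cutoff => //; rewrite ltW.
have cl2 : climb (cutoff s e) (- h) <= (2 / e ^+ 2)%:E * ((16 * h)%:E * I + E).
  by apply: climb_cutoff; rewrite ?sinN ?normrN ?cosN// ltW.
rewrite thE; apply: (le_trans (displacementMn (measurable_cutoff s e) h N)).
rewrite (displacementE (measurable_cutoff s e)).
have Ifin : I \is a fin_num by rewrite ge0_fin_numE// (le_lt_trans IQ)// ltry.
have Efin : E \is a fin_num.
  rewrite ge0_fin_numE// ltNge leye_eq; apply/negP => /eqP Einf.
  by move: hN2; rewrite Einf mulry gtr0_sg// mul1e leye_eq.
have [i Ii] : exists i, I = i%:E by exists (fine I); rewrite fineK.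
have [r Er] : exists r, E = r%:E by exists (fine E); rewrite fineK.
apply: (le_trans (lee_wpmul2l _ (leeD cl1 cl2))) => //.
move: IQ hN2; rewrite Ii Er; set Q := (q * _)%R => iQ rE.
rewrite lee_fin in iQ; have {}rE : (N.+1%:R * r <= eps * e ^+ 2 / 4)%R by rewrite -lee_fin EFinM.
rewrite -[leLHS]/((N.+1%:R * (2 / e ^+ 2 * (16 * h * i + r) + 2 / e ^+ 2 * (16 * h * i + r)))%:E).
rewrite -EFinD lee_fin.
apply: (@le_trans _ _ (64 * (N.+1%:R * h) / e ^+ 2 * i + 4 / e ^+ 2 * (N.+1%:R * r)))%R.
  by rewrite le_eqVlt; apply/orP; left; apply/eqP; field; rewrite gt_eqF.
apply: lerD.
  by rewrite ler_wpM2l// divr_ge0 ?(ltW ee)// !mulr_ge0// ltW.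
apply: le_trans (ler_wpM2l _ rE) _; first by rewrite divr_ge0 ?(ltW ee).
by rewrite le_eqVlt; apply/orP; left; apply/eqP; field; rewrite gt_eqF.
Qed.
End CutoffDisplacementBound.

(** * Lower bound *)

Section Neighborhood.
Context (R : realType) (n : nat).
Notation T := (borel_rV R n).

Lemma acos_lt (t e : R) : -1 <= t <= 1 -> 0 <= e <= 1 -> (acos t < e) = (cos e < t).
Proof.
move=> t1 /andP[e0 e1].
rewrite -[in RHS](acosK (x := t)); last by rewrite in_itv.
rewrite ltr_cos// in_itv/= ?acos_ge0 ?acos_lepi ?e0//=.
by rewrite (le_trans e1)// (le_trans _ (pi_ge2 R))// ler1n.
Qed.

(** The infimum condition becomes a union of open caps, so the neighborhood of any subset of the
    sphere is measurable. *)
Lemma sphere_nbhdE (B : set T) (e : R) : B `<=` @sphere R n -> 0 <= e <= 1 ->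
  sphere_nbhd B e = @sphere R n `&` \bigcup_(b in B) [set x : T | cos e < dotprod x b].
Proof.
move=> BS e01; apply/seteqP; split => x.
  move=> [xS] /ereal_inf_lt[_ [b Bb <-]]; rewrite lte_fin /geodesic_dist.
  rewrite acos_lt//; last exact: dotprod_sphere_le1 xS (BS _ Bb).
  by move=> h; split => //; exists b.
move=> [xS [b Bb h]]; split => //; apply/ereal_inf_ltP.
exists (geodesic_dist x b)%:E; first by exists b.
by rewrite lte_fin /geodesic_dist acos_lt//; exact: dotprod_sphere_le1 xS (BS _ Bb).
Qed.

Lemma measurable_sphere_nbhd (B : set T) (e : R) : B `<=` @sphere R n -> 0 <= e <= 1 ->
  measurable (sphere_nbhd B e).
Proof.
move=> BS e01; rewrite sphere_nbhdE//; apply: measurableI; first exact: measurable_sphere.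
apply: open_measurable_rV; apply: bigcup_open => b _; exact: open_dotprod_gt.
Qed.
End Neighborhood.

(** * The collar inside one cell *)

Section CellBound.
Context (R : realType) (m : nat).
Notation n := m.+1.
Notation T := (borel_rV R n).
Notation g := (gauss R n).
Variable sigma : probability T R.
Hypotheses (n2 : (2 <= n)%N) (haar : is_sphere_haar sigma).
Variables (A : set T) (a e b theta : R).
Hypothesis mA : measurable A.
Hypotheses (sA : sigma A = a%:E) (a1 : a < 1).
Hypotheses (e0 : 0 < e) (e1 : e <= 1) (theta0 : 0 < theta).
Let B := @sphere R n `\` A.
Let N := A `&` sphere_nbhd B e.
Hypothesis sN : sigma N = b%:E.

(** The chordal scale of the cutoff. A point of [A] off [N] is at geodesic distance at least e from
    [B], hence at chordal distance at least e / 2, because 2 - 2 cos e >= e^2 / 4. *)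
Let ep := e / 2.
Let ep0 : 0 < ep. Proof. by rewrite divr_gt0. Qed.
Let ep1 : ep <= 1. Proof. by rewrite ler_pdivrMr// (le_trans e1)// mul1r ler1n. Qed.

Let BS : B `<=` @sphere R n. Proof. by move=> x []. Qed.

Let mN : measurable N.
Proof. by apply: measurableI => //; apply: measurable_sphere_nbhd => //; rewrite ltW. Qed.

Let mSc : measurable (~` (@sphere R n : set T)).
Proof. by apply: measurableC; exact: measurable_sphere. Qed.

Let sSc : sigma (~` @sphere R n) = 0%E.
Proof.
have [s1 _] := haar.
by rewrite probability_setC ?s1 ?subee//; exact: measurable_sphere.
Qed.

Let B_nonempty : B !=set0.
Proof.
apply/set0P/eqP => B0.
have SA : @sphere R n `<=` A.
  by move=> x xS; apply: contrapT => xA; have : B x by []; rewrite B0.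
have [s1 _] := haar.
have : (sigma (@sphere R n) <= sigma A)%E.
  by apply: le_measure => //; rewrite inE//; exact: measurable_sphere.
by rewrite s1 sA lee_fin leNgt a1.
Qed.

Section Net.
Variables (s : seq 'rV[R]_n) (d : R).
Hypotheses (d0 : 0 < d) (sB : forall y, y \in s -> B y).
Hypothesis net : forall x, B x -> exists2 y, y \in s & euclid_norm (x - y) < d.

Let s0 : s != [::].
Proof. by have [x /net[y]] := B_nonempty; case: (s). Qed.

Let sS y : y \in s -> @sphere R n y. Proof. by move=> /sB []. Qed.

Let direction_unit (u : 'rV[R]_n) : @sphere R n u -> @direction R n u = u.
Proof. by move=> uS; rewrite /direction uS invr1 scale1r. Qed.

Let gap u : @sphere R n u -> A u -> ~ N u -> ep ^+ 2 <= 2 - 2 * maxdot s u.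
Proof.
move=> uS Au nN.
have [y ys ->] : exists2 y, y \in s & maxdot s u = dotprod u y.
  apply: maxdot_attained => // y ys.
  by have /andP[] := dotprod_sphere_le1 uS (sS ys).
have le : dotprod u y <= cos e.
  rewrite leNgt; apply/negP => lt; apply: nN; split => //.
  rewrite sphere_nbhdE//; last by rewrite ltW.
  by split => //; exists y => //; exact: sB.
have : e ^+ 2 / 8 <= 1 - cos e by apply: cos_le; rewrite (ltW e0)/= (le_trans e1)// ler1n.
have -> : ep ^+ 2 = e ^+ 2 / 4 by rewrite /ep; field.
by move: le; move: (e ^+ 2) => e2; lra.
Qed.

Let close u : B u -> 2 - 2 * maxdot s u <= d ^+ 2.
Proof.
move=> Bu; have [y ys uy] := net Bu.
apply: (@le_trans _ _ (dotprod (u - y) (u - y))).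
  rewrite (dist_sphere (BS Bu) (sS ys)) lerD2l lerN2 ler_pM2l//.
  exact: maxdot_ge.
by rewrite -euclid_norm_sqr lerXn2r ?nnegrE ?euclid_norm_ge0 ?(ltW d0)// ltW.
Qed.

Let indicI (S : set T) u : (\1_S u = 1 :> R /\ S u) \/ (\1_S u = 0 :> R /\ ~ S u).
Proof.
have [Su|Su] := pselect (S u); [left|right]; split => //.
  by rewrite indicE mem_set.
by rewrite indicE memNset.
Qed.

(** The functions differ on the collar [N], on [B] by at most d^2 / ep^2 since the net is d-dense
    there, and off the sphere, which is null for [sigma]. *)
Lemma cutoff_approx u :
  `|\1_A u - cutoff s ep u| <= \1_N u + d ^+ 2 / ep ^+ 2 + \1_(~` @sphere R n) u.
Proof.
have dd : 0 <= d ^+ 2 / ep ^+ 2 by rewrite divr_ge0 ?sqr_ge0.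
have ee : 0 < ep ^+ 2 by rewrite exprn_gt0.
have c0 := cutoff_ge0 ep sS u.
have c1 := cutoff_le1 s ep u.
have [[-> _]|[-> uS]] := indicI (~` @sphere R n) u.
  have N0 : (0 : R) <= \1_N u by rewrite indicE.
  by rewrite ler_norml; have [[-> _]|[-> _]] := indicI A u; lra.
have {}uS : @sphere R n u by exact: contrapT.
have cE : cutoff s ep u = Num.min 1 ((2 - 2 * maxdot s u) / ep ^+ 2).
  by rewrite /cutoff (direction_unit uS).
rewrite addr0; have [[-> Au]|[-> Au]] := indicI A u.
  have [[-> _]|[-> nN]] := indicI N u.
    by rewrite ler_norml; lra.
  have -> : cutoff s ep u = 1.
    by rewrite cE min_l// ler_pdivlMr// mul1r; exact: gap.
  by rewrite subrr normr0 add0r.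
have [[_ [//]]|[-> _]] := indicI N u.
rewrite sub0r normrN add0r ger0_norm// cE ge_min; apply/orP; right.
by rewrite ler_pM2r ?invr_gt0//; exact: close.
Qed.

(** The slope never exceeds [ep]; on [B] it is at most [d], and on [A] outside the collar it
    vanishes. *)
Lemma slope_approx u : slope s ep u <= ep * \1_N u + d + ep * \1_(~` @sphere R n) u.
Proof.
have le : slope s ep u <= ep.
  rewrite /slope; case: ifPn => [h|_]; last exact: ltW.
  rewrite -[leRHS](ger0_norm (ltW ep0)) -sqrtr_sqr ler_sqrt ?sqr_ge0//.
  exact: ltW.
have sl := slope_ge0 s ep u.
have [[-> _]|[-> uS]] := indicI (~` @sphere R n) u.
  have := d0;   have : 0 <= ep * \1_N u by rewrite mulr_ge0 ?(ltW ep0)// indicE.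
  by lra.
have {}uS : @sphere R n u by exact: contrapT.
have [[-> _]|[-> nN]] := indicI N u; first by have := d0; lra.
rewrite !mulr0 add0r addr0.
have [Au|Au] := pselect (A u).
  by rewrite /slope ifF ?(ltW d0)//; apply/negbTE; rewrite -leNgt; exact: gap.
rewrite /slope; case: ifPn => _; last exact: ltW.
by rewrite -[leRHS](ger0_norm (ltW d0)) -sqrtr_sqr ler_sqrt ?sqr_ge0//; exact: close.
Qed.

Local Open Scope ereal_scope.

Let mind : measurable_fun setT (fun u : T => \1_A u : R).
Proof. exact: measurable_indic. Qed.

Let b0 : (0 <= b)%R.
Proof. by rewrite -lee_fin -sN. Qed.

Let direction_idem x : @direction R n (direction x) = direction x.
Proof.
have [->|x0] := eqVneq (x : 'rV[R]_n) 0%R; last by rewrite direction_unit//; exact: direction_sphere.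
by rewrite /direction !scaler0.
Qed.

Lemma integral_direction (H : T -> \bar R) : measurable_fun setT H -> (forall u, 0 <= H u) ->
  \int[g]_x H (direction x) = \int[sigma]_u H u.
Proof.
move=> mH H0.
have mH2 : measurable_fun setT (fun p : measurableTypeR R * T => H p.2).
  exact: (measurableT_comp mH measurable_snd).
apply: etrans (gauss_polar n2 haar mH2 (fun=> H0 _)) _ => /=.
exact: integral_cst_prob.
Qed.

Lemma integral_cutoff_approx :
  \int[g]_x `|\1_A (@direction R n x) - cutoff s ep x|%:E <= (b + d ^+ 2 / ep ^+ 2)%:E.
Proof.
have mH : measurable_fun setT (fun u : T => `|\1_A u - cutoff s ep u|%:E).
  apply/measurable_EFinP; apply: measurableT_comp => //; apply: measurable_funB => //.
  exact: measurable_cutoff.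
have -> : \int[g]_x `|\1_A (@direction R n x) - cutoff s ep x|%:E =
    \int[sigma]_u `|\1_A u - cutoff s ep u|%:E.
  apply: etrans (integral_direction mH _); last by move=> u; rewrite lee_fin.
  by apply: eq_integral => x _; rewrite /cutoff direction_idem.
have mN1 : measurable_fun setT (fun u : T => (\1_N u : R)%:E).
  by apply/measurable_EFinP; exact: measurable_indic.
have mS1 : measurable_fun setT (fun u : T => (\1_(~` @sphere R n) u : R)%:E).
  by apply/measurable_EFinP; exact: measurable_indic.
have i0 (S : set T) u : 0 <= (\1_S u : R)%:E by rewrite lee_fin indicE.
have dd : 0 <= (d ^+ 2 / ep ^+ 2)%:E by rewrite lee_fin divr_ge0 ?sqr_ge0.
apply: (@le_trans _ _ (\int[sigma]_u ((\1_N u : R)%:E + (d ^+ 2 / ep ^+ 2)%:E +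
    (\1_(~` @sphere R n) u : R)%:E))).
  apply: le_integral_T => //.
  - by apply: emeasurable_funD => //; exact: emeasurable_funD.
  - by move=> u; rewrite -!EFinD lee_fin; exact: cutoff_approx.
rewrite integralD_T//; [|exact: emeasurable_funD|by move=> u; rewrite adde_ge0].
rewrite integralD_T// integral_cst_prob !integral_indic// !setIT.
by rewrite [X in X + _ + _]sN [X in _ + X]sSc adde0.
Qed.

Lemma integral_slope_approx : \int[sigma]_u (slope s ep u)%:E <= (ep * b + d)%:E.
Proof.
have mN1 : measurable_fun setT (fun u : T => (ep * \1_N u)%:E).
  by apply/measurable_EFinP; apply: measurable_funM => //; exact: measurable_indic.
have mS1 : measurable_fun setT (fun u : T => (ep * \1_(~` @sphere R n) u)%:E).
  by apply/measurable_EFinP; apply: measurable_funM => //; exact: measurable_indic.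
have i0 (S : set T) u : 0 <= (ep * \1_S u)%:E by rewrite lee_fin mulr_ge0 ?(ltW ep0)// indicE.
have dd : 0 <= d%:E by rewrite lee_fin ltW.
apply: (@le_trans _ _ (\int[sigma]_u ((ep * \1_N u)%:E + d%:E +
    (ep * \1_(~` @sphere R n) u)%:E))).
  apply: le_integral_T => //.
  - by apply/measurable_EFinP; exact: measurable_slope.
  - by move=> u; rewrite lee_fin slope_ge0.
  - by apply: emeasurable_funD => //; exact: emeasurable_funD.
  - by move=> u; rewrite -!EFinD lee_fin; exact: slope_approx.
rewrite integralD_T//; [|exact: emeasurable_funD|by move=> u; rewrite adde_ge0].
rewrite integralD_T// integral_cst_prob !integralZ_indic ?(ltW ep0)//.
by rewrite [X in _ * X + _ + _]sN [X in _ + _ * X]sSc mule0 adde0.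
Qed.

Let pmeas (G : T * T -> \bar R) : measurable_fun setT G -> (forall p, 0 <= G p) ->
  measurable_fun setT (fun x => \int[g]_y G (x, y)).
Proof. exact: (measurable_partial_integral g). Qed.

Let pmeas1 (G : T * T -> \bar R) x : measurable_fun setT G ->
  measurable_fun setT (fun z => G (x, z)).
Proof. by move=> mG; exact: (measurableT_comp mG (measurable_pair1 x)). Qed.

Let dintD (G1 G2 : T * T -> \bar R) : measurable_fun setT G1 -> (forall p, 0 <= G1 p) ->
  measurable_fun setT G2 -> (forall p, 0 <= G2 p) ->
  \int[g]_x \int[g]_y (G1 (x, y) + G2 (x, y)) =
  \int[g]_x \int[g]_y G1 (x, y) + \int[g]_x \int[g]_y G2 (x, y).
Proof.
move=> mG1 G10 mG2 G20.
apply: etrans _ (integralD_T g (pmeas mG1 G10) _ (pmeas mG2 G20) _).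
- apply: eq_integral => x _; apply: integralD_T => //; exact: pmeas1.
- by move=> x; exact: integral_ge0.
- by move=> x; exact: integral_ge0.
Qed.

Let le_dint (G1 G2 : T * T -> \bar R) : measurable_fun setT G1 -> (forall p, 0 <= G1 p) ->
  measurable_fun setT G2 -> (forall p, G1 p <= G2 p) ->
  \int[g]_x \int[g]_y G1 (x, y) <= \int[g]_x \int[g]_y G2 (x, y).
Proof.
move=> mG1 G10 mG2 G12.
have G20 p : 0 <= G2 p := le_trans (G10 p) (G12 p).
apply: le_integral_T.
- exact: pmeas.
- by move=> x; exact: integral_ge0.
- exact: pmeas.
- move=> x; apply: le_integral_T => //; exact: pmeas1.
Qed.

Let dint1 (h : T -> \bar R) : \int[g]_x \int[g]_(y in setT) h x = \int[g]_x h x.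
Proof. by apply: eq_integral => x _; rewrite integral_cst_prob. Qed.

Let dint2 (h : T -> \bar R) : measurable_fun setT h -> (forall x, 0 <= h x) ->
  \int[g]_x \int[g]_y h (lin (cos theta) (sin theta) x y) = \int[g]_x h x.
Proof.
move=> mh h0; apply: etrans (integral_gauss_lin (t := 1%R) mh h0 ltr01 _) _.
  by rewrite cos2Dsin2 expr1n.
by apply: eq_integral => x _; rewrite scale1r.
Qed.

Let f (x : T) : R := \1_A (@direction R n x).
Hypothesis stabA : stab f (cos theta) (sin theta) <= (a * (9 / 10))%:E.

Let mf : measurable_fun setT f.
Proof. exact: (measurableT_comp mind (@measurable_direction R n)). Qed.

Let f0 x : (0 <= f x)%R. Proof. by rewrite /f indicE. Qed.

Let fint : \int[g]_x (f x)%:E = a%:E.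
Proof.
have mi : measurable_fun setT (fun u : T => (\1_A u : R)%:E) by exact/measurable_EFinP.
apply: etrans (integral_direction mi _) _; first by move=> u; rewrite lee_fin indicE.
by rewrite integral_indic// setIT.
Qed.

(** For values 0 and 1, f + f' = 2 f f' + |f - f'|, so a stability of at most 9/10 of [a] forces the
    mean of |f - f'| to be at least a / 5, where f' is f at the rotated point. Through the cutoff,
    this mean is at most the displacement of the cutoff plus twice its mean distance to f. *)
Lemma cell_bound_net :
  (a / 5 <= 2 * (b + d ^+ 2 / ep ^+ 2) +
     64 * theta / ep ^+ 2 * ((ep * b + d) * (C_inv R / Num.sqrt n%:R)))%R.
Proof.
pose F := cutoff s ep.
have mF : measurable_fun setT F by exact: measurable_cutoff.
pose L (p : T * T) := lin (cos theta) (sin theta) p.1 p.2.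
have mL : measurable_fun setT L by exact: measurable_lin_pair.
pose ph (x : T) : R := `|f x - F x|%R.
have mph : measurable_fun setT ph.
  by apply: measurableT_comp => //; exact: measurable_funB.
pose P1 (p : T * T) := (2 * (f p.1 * f (L p)))%:E.
pose P2 (p : T * T) := `|F (L p) - F p.1|%:E.
pose P3 (p : T * T) := (ph (L p))%:E.
pose P4 (p : T * T) := (ph p.1)%:E.
pose Q1 (p : T * T) := (f p.1)%:E.
pose Q2 (p : T * T) := (f (L p))%:E.
have m1 (h : T -> R) : measurable_fun setT h -> measurable_fun setT (fun p : T * T => h p.1).
  by move=> mh; exact: (measurableT_comp mh measurable_fst).
have mLc (h : T -> R) : measurable_fun setT h -> measurable_fun setT (fun p : T * T => h (L p)).
  by move=> mh; exact: (measurableT_comp mh mL).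
have mP1 : measurable_fun setT P1.
  apply/measurable_EFinP; apply: measurable_funM => //; apply: measurable_funM; [exact: m1|exact: mLc].
have mP2 : measurable_fun setT P2.
  apply/measurable_EFinP; apply: measurableT_comp => //; apply: measurable_funB; [exact: mLc|exact: m1].
have mP3 : measurable_fun setT P3 by apply/measurable_EFinP; exact: mLc.
have mP4 : measurable_fun setT P4 by apply/measurable_EFinP; exact: m1.
have mQ1 : measurable_fun setT Q1 by apply/measurable_EFinP; exact: m1.
have mQ2 : measurable_fun setT Q2 by apply/measurable_EFinP; exact: mLc.
have P10 p : 0 <= P1 p by rewrite lee_fin mulr_ge0// mulr_ge0.
have P20 p : 0 <= P2 p by rewrite lee_fin.
have P30 p : 0 <= P3 p by rewrite lee_fin normr_ge0.
have P40 p : 0 <= P4 p by rewrite lee_fin normr_ge0.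
have Q10 p : 0 <= Q1 p by rewrite lee_fin f0.
have Q20 p : 0 <= Q2 p by rewrite lee_fin f0.
have mP12 := emeasurable_funD mP1 mP2.
have mP34 := emeasurable_funD mP3 mP4.
have P120 p : 0 <= P1 p + P2 p by rewrite adde_ge0.
have P340 p : 0 <= P3 p + P4 p by rewrite adde_ge0.
have QE : \int[g]_x \int[g]_y (Q1 (x, y) + Q2 (x, y)) = (a + a)%:E.
  apply: etrans (dintD mQ1 Q10 mQ2 Q20) _.
  rewrite EFinD; congr (_ + _); first by rewrite -fint; exact: (dint1 (fun x => (f x)%:E)).
  by rewrite -fint; apply: (dint2 (h := fun x => (f x)%:E)) => //; apply/measurable_EFinP.
have le : \int[g]_x \int[g]_y (Q1 (x, y) + Q2 (x, y)) <=
    \int[g]_x \int[g]_y ((P1 (x, y) + P2 (x, y)) + (P3 (x, y) + P4 (x, y))).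
  apply: (@le_dint (fun p => Q1 p + Q2 p) (fun p => (P1 p + P2 p) + (P3 p + P4 p))).
  - exact: emeasurable_funD.
  - by move=> p; rewrite adde_ge0.
  - exact: emeasurable_funD.
  - move=> p; rewrite -!EFinD lee_fin /ph.
    have tri : (`|f (L p) - f p.1| <= `|F (L p) - F p.1| + (`|f (L p) - F (L p)| + `|f p.1 - F p.1|))%R.
      have -> : (f (L p) - f p.1 = (f (L p) - F (L p)) + ((F (L p) - F p.1) + (F p.1 - f p.1)))%R by ring.
      apply: le_trans (ler_normD _ _) _; rewrite [leRHS]addrCA lerD2l.
      by apply: le_trans (ler_normD _ _) _; rewrite (distrC (F p.1)).
    have : (f p.1 + f (L p) = 2 * (f p.1 * f (L p)) + `|f (L p) - f p.1|)%R.
      have f01 x : f x = 0%R \/ f x = 1%R.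
        by rewrite /f; have [[-> _]|[-> _]] := indicI A (direction x); [right|left].
      by have [->|->] := f01 p.1; have [->|->] := f01 (L p);
        rewrite ?subrr ?normr0 ?subr0 ?sub0r ?normrN ?normr1; lra.
    by move=> ->; rewrite -addrA lerD2l.
have phE : \int[g]_x (ph x)%:E <= (b + d ^+ 2 / ep ^+ 2)%:E by exact: integral_cutoff_approx.
have st : \int[g]_x \int[g]_y P1 (x, y) <= (2 * (a * (9 / 10)))%:E.
  have -> : \int[g]_x \int[g]_y P1 (x, y) = 2%:E * stab f (cos theta) (sin theta).
    have mff : measurable_fun setT (fun p : T * T => (f p.1 * f (L p))%:E).
      by apply/measurable_EFinP; apply: measurable_funM; [exact: m1|exact: mLc].
    have ff0 p : 0 <= (f p.1 * f (L p))%:E by rewrite lee_fin mulr_ge0.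
    apply: etrans _ (integralZl_T g _ (pmeas mff ff0) _) => //; last by move=> x; exact: integral_ge0.
    apply: eq_integral => x _.
    apply: etrans _ (integralZl_T g _ (pmeas1 x mff) _) => //.
  by rewrite EFinM lee_wpmul2l.
have dis : \int[g]_x \int[g]_y P2 (x, y) <=
    (64 * theta / ep ^+ 2 * ((ep * b + d) * (C_inv R / Num.sqrt n%:R)))%:E.
  apply: (displacement_cutoff n2 haar s0 sS ep0 ep1 theta0); last exact: integral_slope_approx.
  by rewrite addr_ge0 ?(ltW d0)// mulr_ge0 ?(ltW ep0).
have p34 : \int[g]_x \int[g]_y (P3 (x, y) + P4 (x, y)) <=
    (2 * (b + d ^+ 2 / ep ^+ 2))%:E.
  rewrite [leLHS](dintD mP3 P30 mP4 P40) (_ : 2 * (b + d ^+ 2 / ep ^+ 2) =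
     (b + d ^+ 2 / ep ^+ 2) + (b + d ^+ 2 / ep ^+ 2))%R; last by ring.
  rewrite EFinD; apply: leeD.
    rewrite [leLHS](dint2 (h := fun x => (ph x)%:E))//; first by apply/measurable_EFinP.
    by move=> x; rewrite lee_fin normr_ge0.
  by rewrite [leLHS](dint1 (fun x => (ph x)%:E)).
rewrite QE in le.
have := le_trans le (eq_leq1 (dintD mP12 P120 mP34 P340)).
move=> {}le; have p12 := le_trans (eq_leq1 (dintD mP1 P10 mP2 P20)) (leeD st dis).
have := le_trans le (leeD p12 p34).
rewrite -!EFinD lee_fin; move: (_ * (_ + _ / _))%R (64 * _ * _)%R => X Y; lra.
Qed.
End Net.
End CellBound.

Section Cell.
Context (R : realType) (m : nat).
Notation n := m.+1.
Notation T := (borel_rV R n).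
Variable sigma : probability T R.
Hypotheses (n2 : (2 <= n)%N) (haar : is_sphere_haar sigma).

(** Letting d tend to 0 refines the net and leaves only the terms in [b]. With the scale e / 2, the
    factor 64 (e / 2) / (e / 2)^2 is 128 / e. *)
Lemma cell_bound (A : set T) (a e b theta : R) :
  measurable A -> sigma A = a%:E -> a < 1 ->
  0 < e -> e <= 1 -> 0 < theta ->
  sigma (A `&` sphere_nbhd (@sphere R n `\` A) e) = b%:E ->
  (stab (fun x : T => \1_A (@direction R n x)) (cos theta) (sin theta) <= (a * (9 / 10))%:E)%E ->
  a / 5 <= b * (2 + 128 * theta * (C_inv R / Num.sqrt n%:R) / e).
Proof.
move=> mA sA a1 e0 e1 th0 sN st.
set K := C_inv R / Num.sqrt n%:R.
have K0 : 0 <= K by rewrite divr_ge0 ?sqrtr_ge0// addr_ge0// mulr_ge0// expR_ge0.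
have ee : 0 < (e / 2) ^+ 2 by rewrite exprn_gt0 ?divr_gt0.
pose M := 2 / (e / 2) ^+ 2 + 64 * theta / (e / 2) ^+ 2 * K.
have M0 : 0 <= M.
  apply: addr_ge0; first by rewrite divr_ge0// ltW.
  by rewrite mulr_ge0// divr_ge0 ?(ltW ee)// mulr_ge0// ltW.
apply/ler_addgt0Pr => eps eps0.
pose d := Num.min 1 (eps / (M + 1)).
have M1 : 0 < M + 1 by rewrite ltr_wpDl.
have d0 : 0 < d by rewrite lt_min ltr01 divr_gt0.
have d1 : d <= 1 by rewrite ge_min lexx.
have dM : d * (M + 1) <= eps by rewrite -ler_pdivlMr// ge_min lexx orbT.
have BS : @sphere R n `\` A `<=` @sphere R n by move=> x [].
have [s [sB net]] := finite_net BS d0.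
have := cell_bound_net n2 haar mA sA a1 e0 e1 th0 sN d0 sB net st.
rewrite -/K => /le_trans; apply.
have dd : d ^+ 2 <= d by rewrite expr2 ler_piMr ?(ltW d0).
have -> : 2 * (b + d ^+ 2 / (e / 2) ^+ 2) + 64 * theta / (e / 2) ^+ 2 * ((e / 2 * b + d) * K) =
   b * (2 + 128 * theta * K / e) + (2 / (e / 2) ^+ 2 * d ^+ 2 + d * (64 * theta / (e / 2) ^+ 2 * K)).
  by field; rewrite gt_eqF.
rewrite lerD2l; apply: le_trans dM.
apply: (@le_trans _ _ (d * M)); last by rewrite ler_pM2l// lerDl.
by rewrite /M mulrDr lerD2r mulrC ler_wpM2r// divr_ge0// ltW.
Qed.
End Cell.

Lemma measure_bigcup_ord d (X : measurableType d) (R : realType) (mu : {measure set X -> \bar R})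
    (K : nat) (F : 'I_K -> set X) : (forall i, measurable (F i)) -> trivIset setT F ->
  mu (\bigcup_i F i) = (\sum_(i < K) mu (F i))%E.
Proof.
move=> mF tF; rewrite measure_fin_bigcup//; last exact: finite_finset.
rewrite [RHS]fsbig_seq ?index_enum_uniq//; apply: eq_fsbigl.
by apply/seteqP; split => i //= _; exact: mem_index_enum.
Qed.

(** * Summation over the cells *)

Section LowerBound.
Context (R : realType) (m k : nat).
Notation n := m.+1.
Notation T := (borel_rV R n).
Variable sigma : probability T R.
Hypotheses (n2 : (2 <= n)%N) (haar : is_sphere_haar sigma).
Variable A : 'I_k -> set T.
Hypothesis pA : sphere_partition A.

Lemma sphere_cell i : A i `<=` @sphere R n.
Proof. by case: pA => _ _ <- x Ax; exists i. Qed.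

Lemma other_cellsE i : other_cells A i = @sphere R n `\` A i.
Proof.
case: pA => mA tA uA; apply/seteqP; split => x.
  move=> [j /= ji Ajx]; split; first exact: sphere_cell Ajx.
  move=> Aix; move: ji => /eqP; apply; apply: tA => //.
  by exists x.
move=> [xS nA]; move: xS; rewrite -uA => -[j _ Ajx]; exists j => //=.
by apply/eqP => ji; apply: nA; rewrite -ji.
Qed.

(** In a partition, a point of the sphere off the other cells lies in the cell itself. The boundary
    is thus the disjoint union of the inner collars, and their masses add up. *)
Lemma eps_boundaryE e : eps_boundary A e =
  \bigcup_i (A i `&` sphere_nbhd (@sphere R n `\` A i) e).
Proof.
apply: eq_bigcupr => i _; rewrite other_cellsE; apply/seteqP; split => x.
  move=> [xN nB]; split => //; apply: contrapT => nA; apply: nB; split => //.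
  by case: xN.
by move=> [Ax xN]; split => // -[_].
Qed.

Lemma measurable_cell_boundary i e : 0 <= e <= 1 ->
  measurable (A i `&` sphere_nbhd (@sphere R n `\` A i) e).
Proof.
case: pA => mA _ _ e01; apply: measurableI => //; apply: measurable_sphere_nbhd => //.
Qed.

Lemma measurable_eps_boundary e : 0 <= e <= 1 -> measurable (eps_boundary A e).
Proof.
move=> e01; rewrite eps_boundaryE; apply: fin_bigcup_measurable => // i _.
exact: measurable_cell_boundary.
Qed.

Lemma sigma_eps_boundary e : 0 <= e <= 1 ->
  sigma (eps_boundary A e) = (\sum_(i < k) sigma (A i `&` sphere_nbhd (@sphere R n `\` A i) e))%E.
Proof.
move=> e01; rewrite eps_boundaryE; apply: measure_bigcup_ord => [i|].
  exact: measurable_cell_boundary.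
by case: pA => _ tA _ i j _ _ [x [[Ai _] [Aj _]]]; apply: tA => //; exists x.
Qed.

Hypotheses (k2 : (2 <= k)%N) (eA : equal_measure sigma A).

(** Each of the k cells contributes 1 / (5 k). Here k >= 2 makes the mass of a cell less than 1, so
    that its complement is nonempty. *)
Lemma eps_boundary_ge (e b theta : R) : 0 < e -> e <= 1 -> 0 < theta ->
  (forall f : T -> R, measurable_fun setT f ->
    (forall x, 0 <= f x) -> (forall x, f x <= 1) ->
    (\int[gauss R n]_x (f x)%:E = (k%:R^-1)%:E)%E ->
    (stab f (cos theta) (sin theta) <= (k%:R^-1 * (9 / 10))%:E)%E) ->
  sigma (eps_boundary A e) = b%:E ->
  1 / 5 <= b * (2 + 128 * theta * (C_inv R / Num.sqrt n%:R) / e).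
Proof.
move=> e0 e1 th0 hst sb; set Q := 2 + _.
have e01 : 0 <= e <= 1 by rewrite ltW.
have [mA _ _] := pA.
pose be i := fine (sigma (A i `&` sphere_nbhd (@sphere R n `\` A i) e)).
have beE i : sigma (A i `&` sphere_nbhd (@sphere R n `\` A i) e) = (be i)%:E.
  by rewrite /be fineK//; apply: fin_num_measure; exact: measurable_cell_boundary.
have -> : b = \sum_(i < k) be i.
  apply: EFin_inj; rewrite -sb sigma_eps_boundary// -sumEFin.
  by apply: eq_bigr => i _; rewrite beE.
have k0 : (0 < k%:R :> R) by rewrite ltr0n (leq_trans _ k2).
have -> : 1 / 5 = \sum_(i < k) k%:R^-1 / 5 :> R.
  by rewrite sumr_const card_ord -[RHS]mulr_natl mulrA divff// gt_eqF.
rewrite mulr_suml; apply: ler_sum => i _.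
have a1 : k%:R^-1 < 1 :> R by rewrite invf_lt1// ltr1n.
apply: (cell_bound n2 haar (mA i) (eA i) a1 e0 e1 th0 (beE i)).
apply: hst.
- have mind : measurable_fun setT (fun u : T => \1_(A i) u : R) by exact: measurable_indic.
  exact: (measurableT_comp mind (@measurable_direction R n)).
- by move=> x; rewrite indicE.
- by move=> x; rewrite indicE; case: (_ \in _).
- have mi : measurable_fun setT (fun u : T => (\1_(A i) u : R)%:E).
    by apply/measurable_EFinP; exact: measurable_indic.
  apply: etrans (integral_direction n2 haar mi _) _; first by move=> u; rewrite lee_fin indicE.
  by rewrite integral_indic// setIT; exact: eA.
Qed.

Lemma limf_einf_right_ge (h : R -> \bar R) (l : \bar R) (e0 : R) : 0 < e0 ->
  (forall e, 0 < e -> e < e0 -> (l <= h e)%E) -> (l <= limf_einf h 0^'+)%E.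
Proof.
move=> e00 hl; rewrite /limf_einf leeNr; apply: ereal_inf_le.
exists (ereal_sup [set (- h x)%E | x in [set x | 0 < x < e0]]).
  by exists [set x | 0 < x < e0] => //=; near=> x; apply/andP; split.
apply: ge_ereal_sup => _ [x /= /andP[x0 xe] <-]; rewrite leeN2; exact: hl.
Unshelve. all: by end_near.
Qed.

(** Write L = sqrt (ln k), S = sqrt n and C = [C_inv R]. After multiplication by e S L, the summand
    2 of [eps_boundary_ge] becomes at most 2 C as soon as e <= C / (L S), and the other one at most
    128 * 4 C because theta <= 4 / L. Since pi >= 2, the normalization sqrt (2 n / pi) is at most
    S. *)
Lemma boundary_lower_bound :
  (((5 * (2 + 128 * 4) * C_inv R)^-1 * Num.sqrt (ln k%:R))%:E <= boundary_measure sigma A)%E.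
Proof.
have [theta [th0 th1 hst]] := small_angle R k2.
have key0 e b (x0 : 0 < e) (x1 : e <= 1) := @eps_boundary_ge e b theta x0 x1 th0 (hst _).
have : 0 < C_inv R by rewrite ltr_pwDl// mulr_ge0// expR_ge0.
have : 0 < 128 :> R by [].
move: key0; move: (C_inv R) (128 : R) => C w key0 w0 C0 {hst}.
set L := Num.sqrt _ in th1 *.
have L0 : 0 < L by rewrite sqrtr_gt0 ln_gt0// ltr1n.
have n0 : 0 < n%:R :> R by [].
have s0 : 0 < Num.sqrt n%:R :> R by rewrite sqrtr_gt0.
have p0 : 0 < pi :> R by exact: pi_gt0.
have D1 : Num.sqrt (2 * n%:R / pi) <= Num.sqrt n%:R :> R.
  rewrite ler_sqrt ?(ltW n0)// ler_pdivrMr// mulrC ler_pM2l//; exact: pi_ge2.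
have D2 : 0 < Num.sqrt (2 * n%:R / pi) :> R.
  by rewrite sqrtr_gt0 divr_gt0// mulr_gt0.
have thL : theta * L <= 4 by rewrite -ler_pdivlMr.
rewrite /boundary_measure.
move: (Num.sqrt n%:R) (Num.sqrt (2 * n%:R / pi)) s0 D1 D2 key0 => S D s0 D1 D2 key0.
pose e0 := Num.min 1 (C / (L * S)).
have LS0 : 0 < L * S by rewrite mulr_gt0.
have e00 : 0 < e0 by rewrite lt_min ltr01 divr_gt0.
apply: (limf_einf_right_ge e00) => e ep0 ee0.
have [e1 e2] : e <= 1 /\ e * (L * S) <= C.
  move: ee0; rewrite lt_min => /andP[h1 h2]; split; first exact: ltW.
  by rewrite -ler_pdivlMr// ltW.
have e01 : 0 <= e <= 1 by rewrite ltW.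
have [b bE] : exists b, sigma (eps_boundary A e) = b%:E.
  exists (fine (sigma (eps_boundary A e))); rewrite fineK//.
  by apply: fin_num_measure; exact: measurable_eps_boundary.
have b0 : 0 <= b by rewrite -lee_fin -bE.
have key := key0 e b ep0 e1 bE.
rewrite bE -EFinM lee_fin.
have De0 : 0 < D * e by rewrite mulr_gt0.
rewrite ler_pdivlMr//.
have Q0 : 0 < 5 * (2 + w * 4) * C by rewrite mulr_gt0// mulr_gt0// addr_gt0// mulr_gt0.
rewrite mulrC mulrCA mulrC ler_pdivrMr//.
apply: (@le_trans _ _ (S * e * L)).
  by rewrite ler_pM2r// ler_pM2r.
have le : 2 * (e * (L * S)) + w * (C * (theta * L)) <= (2 + w * 4) * C.
  have -> : (2 + w * 4) * C = 2 * C + w * (C * 4) by ring.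
  by apply: lerD; rewrite ler_pM2l// ler_pM2l.
have h1 := ler_wpM2l b0 le.
have : 1 / 5 * (e * S * L) <= b * (2 + w * theta * (C / S) / e) * (e * S * L).
  by rewrite ler_pM2r// !mulr_gt0.
have -> : b * (2 + w * theta * (C / S) / e) * (e * S * L) =
   b * (2 * (e * (L * S)) + w * (C * (theta * L))) by field; rewrite !gt_eqF.
move=> /le_trans /(_ h1) h2.
have -> : S * e * L = 5 * (1 / 5 * (e * S * L)) by field.
have -> : b * (5 * (2 + w * 4) * C) = 5 * (b * ((2 + w * 4) * C)) by ring.
by rewrite ler_pM2l.
Qed.
End LowerBound.

(** * Hazard rate of the Gaussian *)

Section Hazard.
Local Open Scope ereal_scope.
Context (R : realType).
Notation RT := (measurableTypeR R).
Notation N := (std_normal R).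
Notation mu := (@lebesgue_measure R).

Let pdf (x : R) : R := normal_pdf 0 1 x.

Let pdf_ge0 x : (0 <= pdf x)%R. Proof. exact: normal_pdf_ge0. Qed.

Let peak0 : (0 <= normal_peak 1 :> R)%R.
Proof. by rewrite /normal_peak invr_ge0 sqrtr_ge0. Qed.

Let pdf_le (x y : R) : (0 <= x)%R -> (x <= y)%R -> (pdf y <= pdf x)%R.
Proof.
move=> x0 xy; rewrite /pdf !normal_pdf01 ler_wpM2l// ler_expR lerN2 ler_wpM2r//.
by rewrite lerXn2r ?nnegrE// (le_trans x0).
Qed.

Let mu_segment (x h : R) : (0 <= h)%R -> mu `[x, (x + h)%R]%classic = h%:E.
Proof.
move=> h0; rewrite lebesgue_measure_itv/= lte_fin; case: ifPn => [_|].
  by rewrite -EFinB addrAC subrr add0r.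
by rewrite ltrDl -leNgt => h1; congr EFin; apply/le_anti; rewrite h0 h1.
Qed.

Let std_normal_segmentE (x h : R) :
  N `[x, (x + h)%R]%classic = \int[mu]_t ((\1_`[x, (x + h)%R]%classic t : R)%:E * (pdf t)%:E).
Proof.
have mS : measurable (`[x, (x + h)%R]%classic : set RT) by exact: measurable_itv.
have mi : measurable_fun setT (fun t : RT => (\1_`[x, (x + h)%R]%classic t : R)%:E).
  by apply/measurable_EFinP; exact: measurable_indic.
rewrite -[X in N X]setIT -integral_indic//.
by apply: std_normalE => // t; rewrite lee_fin.
Qed.

Lemma std_normal_segment_le (x h : R) : (0 <= x)%R -> (0 <= h)%R ->
  N `[x, (x + h)%R]%classic <= (h * pdf x)%:E.
Proof.
move=> x0 h0.
have mS : measurable (`[x, (x + h)%R]%classic : set RT) by exact: measurable_itv.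
have mi : measurable_fun setT (fun t : RT => (\1_`[x, (x + h)%R]%classic t : R)%:E).
  by apply/measurable_EFinP; exact: measurable_indic.
have mp : measurable_fun setT (fun t : RT => (pdf t)%:E).
  by apply/measurable_EFinP; exact: measurable_normal_pdf.
rewrite std_normal_segmentE.
apply: (@le_trans _ _ (\int[mu]_t (pdf x * \1_`[x, (x + h)%R]%classic t)%:E)).
  apply: le_integral_T.
  - exact: emeasurable_funM.
  - by move=> t; rewrite -EFinM lee_fin mulr_ge0.
  - by apply/measurable_EFinP; apply: measurable_funM => //; exact: measurable_indic.
  - move=> t; rewrite -EFinM lee_fin mulrC indicE; case: (boolP (t \in _)) => tS.
      rewrite !mulr1; apply: pdf_le => //.
      by move: tS; rewrite inE/= in_itv/= => /andP[].
    by rewrite !mulr0.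
by rewrite integralZ_indic// [X in _ * X]mu_segment// -EFinM mulrC.
Qed.

Lemma std_normal_segment_ge (x h : R) : (0 <= x)%R -> (0 <= h)%R ->
  (h * pdf (x + h))%:E <= N `[x, (x + h)%R]%classic.
Proof.
move=> x0 h0.
have mS : measurable (`[x, (x + h)%R]%classic : set RT) by exact: measurable_itv.
have mi : measurable_fun setT (fun t : RT => (\1_`[x, (x + h)%R]%classic t : R)%:E).
  by apply/measurable_EFinP; exact: measurable_indic.
have mp : measurable_fun setT (fun t : RT => (pdf t)%:E).
  by apply/measurable_EFinP; exact: measurable_normal_pdf.
rewrite std_normal_segmentE.
apply: (@le_trans _ _ (\int[mu]_t (pdf (x + h)%R * \1_`[x, (x + h)%R]%classic t)%:E)).
  by rewrite integralZ_indic// [X in _ * X]mu_segment// -EFinM mulrC.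
apply: le_integral_T.
- by apply/measurable_EFinP; apply: measurable_funM => //; exact: measurable_indic.
- by move=> t; rewrite lee_fin mulr_ge0.
- exact: emeasurable_funM.
- move=> t; rewrite -EFinM lee_fin [leLHS]mulrC indicE; case: (boolP (t \in _)) => tS.
    rewrite !mul1r; move: tS; rewrite inE/= in_itv/= => /andP[xt th].
    by apply: pdf_le => //; exact: le_trans x0 xt.
  by rewrite !mul0r.
Qed.

(** Over the length h = 1 / (1 + M) the density falls by a factor of at most e^(3/2), since (M +
    h)^2 - M^2 <= 3; so the tail beyond M, weighted by 1 + M, has at least e^(-3/2) times the
    density at M. The weight is put as 1 + |t| under the integral because M will be the maximum of
    the other coordinates, and the bound can then be integrated over them. *)
Lemma std_normal_hazard (M d : R) : (0 <= M)%R -> (0 <= d)%R ->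
  N [set t : R | (M <= `|t|)%R /\ (`|t| <= M + d)%R] <=
  (2 * d * expR (3 / 2))%:E *
    \int[N]_t ((1 + `|t|) * \1_[set t : R | (M <= `|t|)%R] t)%:E.
Proof.
move=> M0 d0.
have mSeg x h : measurable (`[x, (x + h)%R]%classic : set RT) by exact: measurable_itv.
pose Neg := (fun t : RT => (- t)%R : RT) @^-1` `[M, (M + d)%R]%classic.
have mopp : measurable_fun setT (fun t : RT => (- t)%R : RT) by exact: oppr_measurable.
have mNeg : measurable Neg by rewrite -[X in measurable X]setTI; exact: mopp.
have NNeg : N Neg = N `[M, (M + d)%R]%classic.
  have mi : measurable_fun setT (fun t : RT => (\1_`[M, (M + d)%R]%classic t : R)%:E).
    by apply/measurable_EFinP; exact: measurable_indic.
  rewrite -[X in N X = _]setIT -[X in _ = N X]setIT -!integral_indic//.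
  apply: etrans _ (std_normalN mi _); last by move=> t; rewrite lee_fin.
  by apply: eq_integral => t _; rewrite !indicE.
have up : N [set t : R | (M <= `|t|)%R /\ (`|t| <= M + d)%R] <= (2 * d * pdf M)%:E.
  apply: (@le_trans _ _ (N (`[M, (M + d)%R]%classic `|` Neg))).
    apply: le_measure; rewrite ?inE.
    - rewrite (_ : mkset _ = (fun t : RT => `|t|%R : RT) @^-1` `[M, (M + d)%R]%classic); last first.
        by apply/seteqP; split=> t /=; rewrite in_itv/= => /andP.
      by rewrite -[X in measurable X]setTI; apply: normr_measurable.
    - exact: measurableU.
    - move=> t [/= Mt td]; have [t0|t0] := leP 0%R t.
        by left; rewrite /= in_itv/=; move: Mt td; rewrite ger0_norm// => -> ->.
      by right; rewrite /Neg /= in_itv/=; move: Mt td; rewrite ltr0_norm// => -> ->.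
  have hU : N (`[M, (M + d)%R]%classic `|` Neg) <= N `[M, (M + d)%R]%classic + N Neg.
    by apply: measureU2 => //; exact: mNeg.
  apply: (le_trans hU).
  rewrite [X in _ + X]NNeg.
  have h := std_normal_segment_le M0 d0.
  apply: (le_trans (leeD h h)); rewrite -EFinD lee_fin.
  by rewrite -mulrA [leRHS]mulr_natl mulr2n.
apply: (le_trans up).
pose h := ((1 + M)^-1)%R.
have M1 : (0 < 1 + M)%R by rewrite ltr_pwDl.
have h0 : (0 < h)%R by rewrite invr_gt0.
have lowS : ((1 + M) * (h * pdf (M + h)))%:E <=
    \int[N]_t ((1 + `|t|) * \1_[set t : R | (M <= `|t|)%R] t)%:E.
  apply: (@le_trans _ _ (\int[N]_t ((1 + M) * \1_`[M, (M + h)%R]%classic t)%:E)).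
    rewrite integralZ_indic ?(ltW M1)// EFinM lee_wpmul2l ?lee_fin ?(ltW M1)//.
    exact: std_normal_segment_ge (ltW h0).
  have mT : measurable ([set t : R | (M <= `|t|)%R] : set RT).
    by apply: measurable_le => //; exact: normr_measurable.
  apply: le_integral_T.
  - by apply/measurable_EFinP; apply: measurable_funM => //; exact: measurable_indic.
  - by move=> t; rewrite lee_fin mulr_ge0// ?(ltW M1)// indicE.
  - apply/measurable_EFinP; apply: measurable_funM; last exact: measurable_indic.
    by apply: measurable_funD => //; exact: normr_measurable.
  - move=> t; rewrite lee_fin !indicE; case: (boolP (t \in `[M, _]%classic)) => [|_]; last first.
      by rewrite mulr0 mulr_ge0// addr_ge0.
    rewrite inE/= in_itv/= => /andP[Mt _].
    have Mt' : (M <= `|t|)%R by rewrite ger0_norm// (le_trans M0).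
    by rewrite mem_set// !mulr1 lerD2l.
have hz : (pdf M <= expR (3 / 2) * ((1 + M) * (h * pdf (M + h))))%R.
  have -> : ((1 + M) * (h * pdf (M + h)) = pdf (M + h))%R by rewrite mulrA mulfV ?gt_eqF// mul1r.
  rewrite /pdf !normal_pdf01 mulrCA ler_wpM2l// -expRD ler_expR.
  have hM : (h * (1 + M) = 1)%R by rewrite mulVf// gt_eqF.
  have h1 : (h <= 1)%R by rewrite invf_le1// lerDl.
  by have hh0 := ltW h0; nra.
have := lee_wpmul2l (_ : 0 <= (2 * d * expR (3 / 2))%:E) lowS.
rewrite lee_fin !mulr_ge0 ?expR_ge0// => /(_ isT); apply: le_trans.
by rewrite -EFinM lee_fin -[leRHS]mulrA ler_wpM2l ?mulr_ge0.
Qed.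
End Hazard.

(** * Gap between the dominating coordinate and the others *)

Section Gap.
Local Open Scope ereal_scope.
Context (R : realType) (m k : nat).
Notation n := m.+1.
Notation T := (borel_rV R n).
Notation RT := (measurableTypeR R).
Notation N := (std_normal R).
Notation g := (gauss R n).
Hypothesis kn : (k <= n)%N.

Definition coordk (l : 'I_k) (x : T) : R := (x : 'rV_n) 0%R (widen_ord kn l).

Definition rest (j : 'I_k) (x : T) : R := \big[Num.max/0%R]_(l < k | l != j) `|coordk l x|%R.

Definition dominates (j : 'I_k) : set T := [set x | (rest j x <= `|coordk j x|)%R].

Definition gap_set (j : 'I_k) (d : R) : set T :=
  [set x | (rest j x <= `|coordk j x|)%R /\ (`|coordk j x| <= rest j x + d)%R].

Lemma restP j x (t : R) : (0 <= t)%R ->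
  (rest j x <= t)%R <-> forall l, l != j -> (`|coordk l x| <= t)%R.
Proof.
move=> t0; split => [h l lj|h]; last by apply/bigmax_leP; split.
by apply: le_trans h; apply: (le_bigmax_cond _ (fun l => `|coordk l x|%R)).
Qed.

Lemma rest_ge0 j x : (0 <= rest j x)%R.
Proof. exact: bigmax_ge_id. Qed.

Lemma rest_ge j l x : l != j -> (`|coordk l x| <= rest j x)%R.
Proof. by move=> lj; apply: (le_bigmax_cond _ (fun l => `|coordk l x|%R)). Qed.

Lemma measurable_abs_coordk l : measurable_fun setT (fun x : T => `|coordk l x|%R : RT).
Proof. by apply: measurableT_comp => //; exact: measurable_coord. Qed.

Lemma measurable_rest j : measurable_fun setT (rest j : T -> RT).
Proof.
rewrite /rest; elim: (index_enum _) => [|l s IH].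
  by under eq_fun do rewrite big_nil; exact: measurable_cst.
under eq_fun do rewrite big_cons; case: (l != j) => //.
by apply: measurable_maxr => //; exact: measurable_abs_coordk.
Qed.

Lemma measurable_dominates j : measurable (dominates j).
Proof. apply: measurable_le; [exact: measurable_rest|exact: measurable_abs_coordk]. Qed.

Lemma measurable_gap_set j d : measurable (gap_set j d).
Proof.
apply: (measurableI (dominates j)); first exact: measurable_dominates.
apply: measurable_le; first exact: measurable_abs_coordk.
by apply: measurable_funD => //; exact: measurable_rest.
Qed.

(** Stated for coordinate 0, the one that [gauss] splits off: the maximum of the others does not
    depend on it, so the hazard bound applies with the others fixed. The remaining coordinates are
    reached later by the symmetry of [sigma]. *)
Lemma gauss_gap (j : 'I_k) (d : R) : val j = 0%N -> (0 <= d)%R ->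
  g (gap_set j d) <= (2 * d * expR (3 / 2))%:E *
    \int[g]_x ((1 + `|(x : 'rV_n) 0%R ord0|) * \1_(dominates j) x)%:E.
Proof.
move=> j0 d0.
have wj : widen_ord kn j = ord0 by apply: val_inj.
have cj (a : R) (v : borel_rV R m) : coordk j (rcons0 (a, v)) = a.
  by rewrite /coordk wj rcons0E0.
have rj (a b : R) (v : borel_rV R m) : rest j (rcons0 (a, v)) = rest j (rcons0 (b, v)).
  apply: eq_bigr => l lj; congr (`|_|%R); rewrite /coordk.
  case: (unliftP ord0 (widen_ord kn l)) => [i ->|]; first by rewrite !rcons0ES.
  rewrite -wj => /(congr1 val)/= /val_inj lE.
  by rewrite lE eqxx in lj.
pose M (v : borel_rV R m) := rest j (rcons0 (0%R, v)).
have mG := measurable_gap_set j d; have mD := measurable_dominates j.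
have swap (H : T -> \bar R) : measurable_fun setT H -> (forall x, 0 <= H x) ->
    \int[g]_x H x = \int[gauss R m]_v \int[N]_a H (rcons0 (a, v)).
  move=> mH H0; apply: etrans (integral_gaussS mH H0) _.
  apply: (@fubini_tonelli _ _ _ _ R N (gauss R m) (fun p => H (rcons0 p))) => //.
  exact: (measurableT_comp mH (@measurable_rcons0 R m)).
have mI (S : set T) : measurable S -> measurable_fun setT (fun x : T => (\1_S x : R)%:E).
  by move=> mS; apply/measurable_EFinP; exact: measurable_indic.
have mF : measurable_fun setT
    (fun x : T => ((1 + `|(x : 'rV_n) 0%R ord0|) * \1_(dominates j) x)%:E).
  apply/measurable_EFinP; apply: measurable_funM; last exact: measurable_indic.
  by apply: measurable_funD => //; apply: measurableT_comp => //; exact: measurable_coord.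
have F0 (x : T) : 0 <= ((1 + `|(x : 'rV_n) 0%R ord0|) * \1_(dominates j) x)%:E.
  by rewrite lee_fin mulr_ge0 ?addr_ge0// indicE.
have K0 : (0 <= 2 * d * expR (3 / 2))%R by rewrite !mulr_ge0// expR_ge0.
have mFr : measurable_fun setT (fun p : borel_rV R m * RT =>
    ((1 + `|(rcons0 (p.2, p.1) : 'rV_n) 0%R ord0|) * \1_(dominates j) (rcons0 (p.2, p.1)))%:E).
  apply: (measurableT_comp mF); apply: (measurableT_comp (@measurable_rcons0 R m)).
  by apply/measurable_fun_pair; [exact: measurable_snd|exact: measurable_fst].
have mGr : measurable_fun setT (fun p : borel_rV R m * RT =>
    (\1_(gap_set j d) (rcons0 (p.2, p.1)) : R)%:E).
  apply: (measurableT_comp (mI _ mG)); apply: (measurableT_comp (@measurable_rcons0 R m)).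
  by apply/measurable_fun_pair; [exact: measurable_snd|exact: measurable_fst].
rewrite (swap _ mF F0) -[X in g X]setIT -integral_indic// swap//; [|exact: mI].
have mI2 : measurable_fun setT (fun v => \int[N]_a ((1 + `|(rcons0 (a, v) : 'rV_n) 0%R ord0|) *
    \1_(dominates j) (rcons0 (a, v)))%:E).
  exact: (measurable_partial_integral N mFr).
rewrite -integralZl_T//; last by move=> v; exact: integral_ge0.
apply: le_integral_T.
- exact: (measurable_partial_integral N mGr).
- by move=> v; apply: integral_ge0 => a _; rewrite lee_fin.
- exact: emeasurable_funM.
- move=> v.
  have mb : measurable ([set t : RT | (M v <= `|t|)%R /\ (`|t| <= M v + d)%R]).
    apply: (measurableI [set t : RT | (M v <= `|t|)%R]); apply: measurable_le => //; exact: normr_measurable.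
  have e1 : \int[N]_a (\1_(gap_set j d) (rcons0 (a, v)) : R)%:E =
      N [set t : RT | (M v <= `|t|)%R /\ (`|t| <= M v + d)%R].
    rewrite -[X in N X]setIT -integral_indic//; apply: eq_integral => a _.
    rewrite !indicE; congr (nat_of_bool _)%:R%:E; apply/idP/idP;
      by rewrite !inE /gap_set /= cj (rj a 0%R).
  have e2 : \int[N]_a ((1 + `|(rcons0 (a, v) : 'rV_n) 0%R ord0|) *
        \1_(dominates j) (rcons0 (a, v)))%:E =
      \int[N]_t ((1 + `|t|) * \1_[set t : R | (M v <= `|t|)%R] t)%:E.
    apply: eq_integral => a _; rewrite rcons0E0 !indicE.
    congr ((_ * (nat_of_bool _)%:R)%:E); apply/idP/idP;
      by rewrite !inE /dominates /= cj (rj a 0%R).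
  rewrite e1 e2; exact: (std_normal_hazard (rest_ge0 j (rcons0 (0%R, v))) d0).
Qed.
End Gap.

(** * First absolute moment on an event of probability 1/k *)

Section Moment.
Local Open Scope ereal_scope.
Context (R : realType) (m k : nat).
Notation n := m.+1.
Notation T := (borel_rV R n).
Notation g := (gauss R n).
Hypothesis k2 : (2 <= k)%N.
Let L : R := Num.sqrt (ln k%:R).

Let k0 : (0 < k%:R :> R)%R. Proof. by rewrite ltr0n (leq_trans _ k2). Qed.

(** Keeps L away from 0, so that constants can be absorbed into multiples of L. *)
Lemma ln_ge_half : (2^-1 <= ln k%:R :> R)%R.
Proof.
apply: (@le_trans _ _ (ln 2)); last by rewrite ler_ln ?posrE// ler_nat.
have := @le_ln1Dx R (- 2^-1)%R; rewrite ltrN2.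
have -> : (1 + - 2^-1 = 2^-1 :> R)%R by lra.
by rewrite lnV ?posrE// lerN2 => ->//; rewrite invf_lt1// ltr1n.
Qed.

Let L2 : (L ^+ 2 = ln k%:R)%R.
Proof. by rewrite sqr_sqrtr// (le_trans _ ln_ge_half). Qed.

Let L0 : (0 < L)%R.
Proof. by rewrite sqrtr_gt0 (lt_le_trans _ ln_ge_half). Qed.

(* Young's inequality in the form w <= ln k + exp(w) / k, with w = t^2 / 4. *)
Lemma abs_le_exp (t : R) :
  (`|t| <= 5 / 2 * L + 2 / (k%:R * L) * expR (4^-1 * t ^+ 2))%R.
Proof.
set E := expR _.
have hw : (4^-1 * t ^+ 2 <= L ^+ 2 + E / k%:R)%R.
  have := expR_ge1Dx (4^-1 * t ^+ 2 - ln k%:R)%R.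
  by rewrite expRD expRN lnK ?posrE// -/E L2; move: (E / k%:R)%R (4^-1 * t ^+ 2)%R => X Y; lra.
rewrite -(@ler_pM2r _ (2 * L)) ?mulr_gt0//.
have -> : ((5 / 2 * L + 2 / (k%:R * L) * E) * (2 * L) = 5 * L ^+ 2 + 4 * (E / k%:R))%R.
  by field; rewrite !gt_eqF.
have : (`|t| * (2 * L) <= `|t| ^+ 2 + L ^+ 2)%R.
  have := sqr_ge0 (`|t| - L)%R; rewrite sqrrB -mulr_natl.
  by move: (`|t| ^+ 2)%R (L ^+ 2)%R => X Y; lra.
rewrite real_normK ?num_real//; move: hw; move: (E / k%:R)%R (t ^+ 2)%R (L ^+ 2)%R => X Y Z; lra.
Qed.

(** On E the linear part of [abs_le_exp] is paid by the mass 1 / k; the exponential part already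
    carries a factor 1 / k and is integrated over the whole space. The total is below 13 L / k
    because 1 <= 2 L^2. *)
Lemma gauss_first_moment (E : set T) : measurable E -> g E <= (k%:R^-1)%:E ->
  \int[g]_x ((1 + `|(x : 'rV_n) 0%R ord0|) * \1_E x)%:E <= (13 * L / k%:R)%:E.
Proof.
move=> mE gE.
have a0 : (0 <= 1 + 5 / 2 * L)%R by rewrite addr_ge0// mulr_ge0// ltW.
have b0 : (0 <= 2 / (k%:R * L))%R by rewrite divr_ge0// mulr_ge0// ltW.
have mc : measurable_fun setT (fun x : T => (x : 'rV_n) 0%R ord0) by exact: measurable_coord.
have me : measurable_fun setT (fun t : measurableTypeR R => (expR (4^-1 * t ^+ 2))%:E).
  exact: measurable_expsqr.
have mec : measurable_fun setT (fun x : T => (expR (4^-1 * (x : 'rV_n) 0%R ord0 ^+ 2))%:E).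
  exact: (measurableT_comp me mc).
have m1 : measurable_fun setT (fun x : T => ((1 + 5 / 2 * L) * \1_E x)%:E).
  by apply/measurable_EFinP; apply: measurable_funM => //; exact: measurable_indic.
apply: (@le_trans _ _ (\int[g]_x (((1 + 5 / 2 * L) * \1_E x)%:E +
    (2 / (k%:R * L))%:E * (expR (4^-1 * (x : 'rV_n) 0%R ord0 ^+ 2))%:E))).
  apply: le_integral_T.
  - apply/measurable_EFinP; apply: measurable_funM; last exact: measurable_indic.
    by apply: measurable_funD => //; exact: measurableT_comp.
  - by move=> x; rewrite lee_fin mulr_ge0 ?addr_ge0// indicE.
  - by apply: emeasurable_funD => //; exact: emeasurable_funM.
  - move=> x; rewrite -EFinM -EFinD lee_fin.
    have h := abs_le_exp ((x : 'rV_n) 0%R ord0).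
    have e0 : (0 <= 2 / (k%:R * L) * expR (4^-1 * (x : 'rV_n) 0 ord0 ^+ 2))%R.
      by rewrite mulr_ge0// expR_ge0.
    move: h e0; move: (2 / _ * _)%R => X h e0; rewrite indicE; case: (_ \in _).
      by rewrite !mulr1 -addrA lerD2l.
    by rewrite !mulr0 add0r.
rewrite integralD_T//; last 3 first.
- by move=> x; rewrite lee_fin mulr_ge0// indicE.
- exact: emeasurable_funM.
- by move=> x; rewrite -EFinM lee_fin mulr_ge0// expR_ge0.
rewrite integralZ_indic// integralZl_T//.
apply: (le_trans (leeD2r _ (lee_wpmul2l _ gE))); first by rewrite lee_fin.
rewrite (integral_gauss_first m me)//.
rewrite std_normal_exp4 -!EFinM -EFinD lee_fin.
have L12 : (1 <= 2 * L ^+ 2)%R by rewrite L2; have := ln_ge_half; lra.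
have L1 : (1 <= 2 * L)%R by have := L0; nra.
have s2 : (Num.sqrt 2 <= 2 :> R)%R.
  by rewrite -[leRHS](@ger0_norm R)// -sqrtr_sqr ler_sqrt// expr2; lra.
rewrite -(@ler_pM2r _ (k%:R * L)) ?mulr_gt0//.
have -> : (((1 + 5 / 2 * L) / k%:R + 2 / (k%:R * L) * Num.sqrt 2) * (k%:R * L) =
   (1 + 5 / 2 * L) * L + 2 * Num.sqrt 2)%R by field; rewrite !gt_eqF.
have -> : (13 * L / k%:R * (k%:R * L) = 13 * L ^+ 2)%R by field; rewrite gt_eqF.
by have := L0; nra.
Qed.
End Moment.

(** * Cells of dominating coordinates *)

(** Exchanging two coordinates has determinant -1; the quarter turn is the rotation that does so up
    to one sign. *)
Lemma quarter_turn (R : realType) (n : nat) (i l : 'I_n) : i != l ->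
  exists2 U : 'M[R]_n, rotation U & forall x : 'rV[R]_n,
    [/\ (x *m U) 0 l = x 0 i, (x *m U) 0 i = - x 0 l &
        forall r, r != i -> r != l -> (x *m U) 0 r = x 0 r].
Proof.
move=> il; have li : l != i by rewrite eq_sym.
have o (r s : 'I_n) : r != s -> dotprod (unit_vec R r) (unit_vec R s) = 0.
  by move=> rs; rewrite dotprod_unit_vec mxE eqxx/= eq_sym (negPf rs).
have oil := o _ _ il.
have [] := rotation_to (unit_vec1 R i) (unit_vec1 R l); first by rewrite oil; lra.
move=> U rU [Ui /(_ oil)[Ul Ur]]; exists U => // x; split.
- by rewrite -(dotprod_unit_vec (x *m U)) -Ui dotprod_rotation// dotprod_unit_vec.
- rewrite -(dotprod_unit_vec (x *m U)) -[unit_vec R i]opprK -Ul dotprodNr dotprod_rotation//.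
  by rewrite dotprod_unit_vec.
- move=> r ri rl; rewrite -(dotprod_unit_vec (x *m U)) -(Ur (unit_vec R r)) ?o//.
  by rewrite dotprod_rotation// dotprod_unit_vec.
Qed.

Section Cells.
Context (R : realType) (m k : nat).
Notation n := m.+1.
Notation T := (borel_rV R n).
Notation g := (gauss R n).
Variable sigma : probability T R.
Hypotheses (n2 : (2 <= n)%N) (haar : is_sphere_haar sigma).
Hypotheses (k2 : (2 <= k)%N) (kn : (k <= n)%N).
Implicit Types (j l : 'I_k) (x y : T) (b : bool).
Notation crd := (coordk kn).
Notation rst := (rest kn).

Let w_inj j l : j != l -> widen_ord kn j != widen_ord kn l.
Proof. by apply: contra => /eqP/(congr1 val)/= h; apply/eqP/val_inj. Qed.

Lemma rest_turn j l : j != l -> exists2 U : 'M[R]_n, rotation U & forall x : T,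
  [/\ crd l ((x : 'rV_n) *m U) = crd j x, crd j ((x : 'rV_n) *m U) = - crd l x,
      rst l ((x : 'rV_n) *m U) = rst j x & rst j ((x : 'rV_n) *m U) = rst l x].
Proof.
move=> jl; have lj : l != j by rewrite eq_sym.
have [U rU hU] := quarter_turn R (w_inj jl); exists U => // x.
have [hl hj hr] := hU x.
have cl : crd l ((x : 'rV_n) *m U) = crd j x by [].
have cj : crd j ((x : 'rV_n) *m U) = - crd l x by [].
have cr r : r != j -> r != l -> crd r ((x : 'rV_n) *m U) = crd r x.
  by move=> rj rl; apply: hr; exact: w_inj.
split => //; apply/le_anti/andP; split; apply/restP; rewrite ?rest_ge0// => r.
- have [->|rj] := eqVneq r j; first by rewrite cj normrN => _; exact: rest_ge.
  by move=> rl; rewrite cr//; exact: rest_ge.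
- have [->|rl] := eqVneq r l; first by move=> _; rewrite -normrN -cj; exact: rest_ge.
  by move=> rj; rewrite -cr//; exact: rest_ge.
- have [->|rl] := eqVneq r l; first by rewrite cl => _; exact: rest_ge.
  by move=> rj; rewrite cr//; exact: rest_ge.
- have [->|rj] := eqVneq r j; first by move=> _; rewrite -cl; exact: rest_ge.
  by move=> rl; rewrite -cr//; exact: rest_ge.
Qed.

Definition open_cell b j : set T := [set x | rst j x < if b then crd j x else - crd j x].

Lemma measurable_open_cell b j : measurable (open_cell b j).
Proof.
apply: measurable_lt; first exact: measurable_rest.
have mc : measurable_fun setT (crd j : T -> R) by exact: measurable_coord.
by case: b => //; exact: measurableT_comp.
Qed.

Let sigma_preim (U : 'M[R]_n) (B C : set T) : rotation U -> measurable B ->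
  (forall x : T, B ((x : 'rV_n) *m U) <-> C x) -> sigma B = sigma C.
Proof.
move=> rU mB BC; rewrite -(haar.2 _ _ rU mB); congr (sigma _).
by apply/seteqP; split => x /BC.
Qed.

(** One quarter turn carries sign b at j to sign b at l, and sign b at l to the opposite sign at j.
    Since k >= 2 there is a second coordinate, and combining the two moves through it changes the
    sign. *)
Lemma sigma_open_cell b b' j l : sigma (open_cell b j) = sigma (open_cell b' l).
Proof.
have same b1 j1 l1 : j1 != l1 -> sigma (open_cell b1 l1) = sigma (open_cell b1 j1).
  move=> jl; have [U rU hU] := rest_turn jl.
  apply: (sigma_preim rU (measurable_open_cell _ _)) => x.
  by have [cl _ rl _] := hU x; rewrite /open_cell /= cl rl.
have flip b1 j1 l1 : j1 != l1 -> sigma (open_cell b1 j1) = sigma (open_cell (~~ b1) l1).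
  move=> jl; have [U rU hU] := rest_turn jl.
  apply: (sigma_preim rU (measurable_open_cell _ _)) => x.
  have [_ cj _ rj] := hU x; rewrite /open_cell /= cj rj.
  by case: b1 => //=; rewrite opprK.
have [r rj] : exists r : 'I_k, r != j.
  have [j0|j0] := eqVneq (val j) 0%N.
    by exists (Ordinal k2); apply/eqP => /(congr1 val)/=; rewrite j0.
  by exists (Ordinal (ltnW k2)); apply/eqP => /(congr1 val)/= h; case/eqP: j0; exact: esym h.
have all1 b1 : sigma (open_cell b1 j) = sigma (open_cell true j).
  have jr : j != r by rewrite eq_sym.
  by case: b1 => //; rewrite (flip false j r jr); exact: same.
have allj b1 l1 : sigma (open_cell b1 l1) = sigma (open_cell b1 j).
  by have [->//|jl] := eqVneq l1 j; apply: same; rewrite eq_sym.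
by rewrite all1 allj all1.
Qed.

Lemma sigma_gap_set j l d : sigma (gap_set kn j d) = sigma (gap_set kn l d).
Proof.
have [->//|jl] := eqVneq j l; have [U rU hU] := rest_turn jl; apply: esym.
apply: (sigma_preim rU (measurable_gap_set _ _ _)) => x.
by have [cl _ rl _] := hU x; rewrite /gap_set /= cl rl.
Qed.

(** Ties go to the smallest index and a zero coordinate counts as positive, so that the cells
    partition the sphere exactly and not merely up to null sets. *)
Definition cell b j : set T := [set x | @sphere R n x /\ [/\ (0 <= crd j x) = b,
  forall l, `|crd l x| <= `|crd j x| &
  forall l, (l < j)%N -> `|crd l x| < `|crd j x|]].

Let measurable_forall (P : 'I_k -> T -> Prop) : (forall l, measurable [set x | P l x]) ->
  measurable [set x : T | forall l, P l x].
Proof.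
move=> mP; rewrite (_ : mkset _ = \bigcap_l [set x | P l x]); last first.
  by apply/seteqP; split => x h l; [move=> _; exact: h|exact: h].
exact: fin_bigcap_measurable.
Qed.

Lemma measurable_cell b j : measurable (cell b j).
Proof.
have mc l : measurable_fun setT (crd l : T -> R) by exact: measurable_coord.
rewrite (_ : cell b j = @sphere R n `&` ([set x | (0 <= crd j x) = b] `&`
  ([set x | forall l, `|crd l x| <= `|crd j x|] `&`
   [set x | forall l, (l < j)%N -> `|crd l x| < `|crd j x|]))); last first.
  by apply/seteqP; split => x; [move=> [? []]|move=> [? [? []]]].
apply: measurableI; first exact: measurable_sphere.
apply: measurableI; [|apply: measurableI].
- have mle : measurable [set x : T | 0 <= crd j x] by exact: measurable_le.
  case: b; first exact: mle.
  rewrite (_ : mkset _ = ~` [set x : T | 0 <= crd j x]); first exact: measurableC.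
  by apply/seteqP; split => x /=; [move=> ->|move/negP/negbTE].
- by apply: measurable_forall => l; apply: measurable_le; exact: measurable_abs_coordk.
- apply: measurable_forall => l.
  have [lj|lj] := boolP (l < j)%N.
    rewrite (_ : mkset _ = [set x | `|crd l x| < `|crd j x|]).
      by apply: measurable_lt; exact: measurable_abs_coordk.
    by apply/seteqP; split => x /=; [exact|].
  by rewrite (_ : mkset _ = setT)//; apply/seteqP; split.
Qed.

Lemma cell_disjoint b b' j l x : cell b j x -> cell b' l x -> b = b' /\ j = l.
Proof.
move=> [_ [bj hj hj']] [_ [bl hl hl']].
have jl : j = l.
  apply/val_inj; have [lt|lt|//] := ltngtP (val j) (val l).
    by have := hl' _ lt; rewrite ltNge hj.
  by have := hj' _ lt; rewrite ltNge hl.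
by split => //; rewrite -bj -bl jl.
Qed.

Lemma cell_cover x : @sphere R n x -> exists b j, cell b j x.
Proof.
move=> xS.
have [i hi] : exists i : 'I_k, [forall l, `|crd l x| <= `|crd i x|].
  pose i := [arg max_(i > Ordinal (ltnW k2)) `|crd i x|]%O.
  exists i; apply/forallP => l; rewrite /i.
  by case: arg_maxP => // r _ h; exact: h.
(* Minimality of j among the coordinates of largest absolute value yields the strict inequalities of
   the tie-breaking clause. *)
case: (@arg_minnP _ i (fun i : 'I_k => [forall l, `|crd l x| <= `|crd i x|]) val hi) => j /forallP hj jmin; exists (0 <= crd j x), j; split => //; split => // l lj.
rewrite lt_neqAle hj andbT; apply/eqP => e.
have : [forall r, `|crd r x| <= `|crd l x|] by apply/forallP => r; rewrite e.
by move=> /jmin; rewrite leqNgt lj.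
Qed.
End Cells.

(** * The cells have equal mass *)

Section EqualCells.
Context (R : realType) (m k : nat).
Notation n := m.+1.
Notation T := (borel_rV R n).
Notation g := (gauss R n).
Variable sigma : probability T R.
Hypotheses (n2 : (2 <= n)%N) (haar : is_sphere_haar sigma).
Hypotheses (k2 : (2 <= k)%N) (kn : (k <= n)%N).
Implicit Types (j l : 'I_k) (x y : T) (b : bool).
Notation crd := (coordk kn).
Notation rst := (rest kn).

Let measurable_hyperplane (u : 'rV[R]_n) : measurable [set x : T | dotprod x u = 0].
Proof.
rewrite (_ : mkset _ = (fun x : T => dotprod x u) @^-1` [set 0])//.
by rewrite -[X in measurable X]setTI; apply: (measurable_dotprod (f := id) (g := cst u)).
Qed.

Lemma sigma_hyperplane (u : 'rV[R]_n) : u != 0 -> sigma [set x : T | dotprod x u = 0] = 0%E.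
Proof.
move=> u0; have mS := measurable_hyperplane u.
have mi : measurable_fun setT (fun x : T => (\1_[set x : T | dotprod x u = 0] x : R)%:E).
  by apply/measurable_EFinP; exact: measurable_indic.
rewrite -(gauss_hyperplane u0) -[X in sigma X]setIT -[X in _ = gauss _ _ X]setIT -!integral_indic//.
apply: etrans (esym (integral_direction n2 haar mi _)) _; first by move=> x; rewrite lee_fin.
apply: eq_integral => x _; rewrite !indicE; congr (nat_of_bool _)%:R%:E.
have [->|x0] := eqVneq (x : 'rV[R]_n) 0; first by rewrite /direction scaler0.
have r0 : euclid_norm (x : 'rV[R]_n) != 0 by rewrite euclid_norm_eq0.
apply/idP/idP; rewrite !inE/= /direction dotprodZl.
  by move/eqP; rewrite mulf_eq0 invr_eq0 (negPf r0)/= => /eqP.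
by move=> ->; rewrite mulr0.
Qed.

Let tie j l : set T := [set x | `|crd l x| = `|crd j x|].

Let sigmaU (B C : set T) : measurable B -> measurable C ->
  (sigma (B `|` C) <= sigma B + sigma C)%E.
Proof. exact: measureU2. Qed.

(** The condition |x_l| = |x_j| describes two hyperplanes, x_l = x_j and x_l = - x_j. *)
Let sigma_tie j l : l != j -> measurable (tie j l) /\ sigma (tie j l) = 0%E.
Proof.
move=> lj.
have wlj : widen_ord kn l != widen_ord kn j.
  by apply: contra lj => /eqP/(congr1 val)/= h; apply/eqP/val_inj.
pose um : 'rV[R]_n := unit_vec R (widen_ord kn l) - unit_vec R (widen_ord kn j).
pose up : 'rV[R]_n := unit_vec R (widen_ord kn l) + unit_vec R (widen_ord kn j).
have um0 : um != 0.
  apply/eqP => /(congr1 (fun v : 'rV[R]_n => v 0 (widen_ord kn l))).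
  by rewrite !mxE !eqxx/= (negPf wlj) subr0 => /eqP; rewrite oner_eq0.
have up0 : up != 0.
  apply/eqP => /(congr1 (fun v : 'rV[R]_n => v 0 (widen_ord kn l))).
  by rewrite !mxE !eqxx/= (negPf wlj) addr0 => /eqP; rewrite oner_eq0.
have tE : tie j l = [set x : T | dotprod x um = 0] `|` [set x : T | dotprod x up = 0].
  apply/seteqP; split => x; rewrite /tie /= !dotprodDr dotprodNr !dotprod_unit_vec.
    move=> /eqP; rewrite eqr_norm2 => /orP[/eqP h|/eqP h]; [left|right].
      by rewrite -/(crd l x) h subrr.
    by rewrite -/(crd l x) h addNr.
  by case=> /eqP; rewrite ?subr_eq0 ?addr_eq0 => /eqP h; rewrite /coordk h ?normrN.
have mt : measurable (tie j l).
  by rewrite tE; apply: measurableU; exact: measurable_hyperplane.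
split => //; apply/eqP; rewrite eq_le measure_ge0 andbT tE.
apply: (le_trans (sigmaU (measurable_hyperplane um) (measurable_hyperplane up))).
by rewrite !sigma_hyperplane// adde0.
Qed.

Let ties j : set T := \bigcup_(l in [set l | l != j]) tie j l.

Let sigma_ties j : measurable (ties j) /\ sigma (ties j) = 0%E.
Proof.
have fin : finite_set [set l : 'I_k | l != j] by exact: finite_finset.
have mt : measurable (ties j).
  by apply: fin_bigcup_measurable => // l lj; case: (sigma_tie lj).
split => //; apply/eqP; rewrite eq_le measure_ge0 andbT.
have mtl l : [set l | l != j] l -> measurable (tie j l) by move=> lj; case: (sigma_tie lj).
apply: (le_trans (content_sub_fsum sigma fin mtl mt (fun _ h => h))).
by rewrite fsbig1// => l /= lj; case: (sigma_tie lj).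
Qed.

Let neighbor j : exists l, l != j.
Proof.
have [j0|j0] := eqVneq (val j) 0%N.
  by exists (Ordinal k2); apply/eqP => /(congr1 val)/=; rewrite j0.
by exists (Ordinal (ltnW k2)); apply/eqP => /(congr1 val)/= h; case/eqP: j0; exact: esym h.
Qed.

Let rest_lt j x : (forall l, l != j -> `|crd l x| < `|crd j x|) -> rst j x < `|crd j x|.
Proof.
move=> h; apply/bigmax_ltP; split => //.
by have [l lj] := neighbor j; exact: le_lt_trans (normr_ge0 _) (h l lj).
Qed.

Let dominates_ties j x : dominates kn j x -> ~ ties j x ->
  forall l, l != j -> `|crd l x| < `|crd j x|.
Proof.
move=> d nt l lj; rewrite lt_neqAle; apply/andP; split.
  by apply/eqP => e; apply: nt; exists l.
by apply: le_trans d; exact: rest_ge.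
Qed.

Lemma sub_cell j x : @sphere R n x -> (forall l, l != j -> `|crd l x| < `|crd j x|) ->
  cell kn (0 <= crd j x) j x.
Proof.
move=> xS h; split => //; split => // l.
  by have [->//|/h/ltW] := eqVneq l j.
by move=> lj; apply: h; apply: contraTneq lj => ->; rewrite ltnn.
Qed.

Lemma sigma_cell_open b j : sigma (cell kn b j) = sigma (open_cell kn b j).
Proof.
have [mt t0] := sigma_ties j; have mo : measurable (open_cell kn b j : set T) by exact: measurable_open_cell.
have mc : measurable (cell kn b j : set T) by exact: measurable_cell.
apply/eqP; rewrite eq_le; apply/andP; split.
  apply: (@le_trans _ _ (sigma (open_cell kn b j `|` ties j))).
    apply: le_measure; rewrite ?inE//; first exact: measurableU.
    move=> x [xS [sg hj _]]; have [tx|ntx] := pselect (ties j x); [by right|left].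
    have dx : dominates kn j x by apply/restP => // l _; exact: hj.
    have := rest_lt (dominates_ties dx ntx); rewrite /open_cell /=; congr (_ < _).
    rewrite -sg; case: ifPn => h; first by rewrite ger0_norm.
    by rewrite ltr0_norm// ltNge.
  by apply: (le_trans (sigmaU mo mt)); rewrite [X in (_ + X)%E]t0 adde0.
rewrite -(sigma_sphereI haar mo); apply: le_measure; rewrite ?inE//.
  by apply: measurableI => //; exact: measurable_sphere.
move=> x [ox xS].
have rx := rest_ge0 kn j x.
have [ax sg] : (if b then crd j x else - crd j x) = `|crd j x| /\ (0 <= crd j x) = b.
  move: ox; rewrite /open_cell /=; case: b {mo mc} => ox.
    have c0 : 0 < crd j x by exact: le_lt_trans ox.
    by rewrite gtr0_norm// ltW.
  have c0 : crd j x < 0 by rewrite -oppr_gt0; exact: le_lt_trans ox.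
  by rewrite ltr0_norm//; split => //; apply/negbTE; rewrite -ltNge.
rewrite -[X in cell _ X]sg; apply: sub_cell => // l lj.
by apply: (@le_lt_trans _ _ (rst j x)); [exact: rest_ge|move: ox; rewrite /open_cell /= ax].
Qed.

Let k_gt0 : (0 < k)%N. Proof. exact: ltnW. Qed.

Definition cells (i : 'I_(2 * k)) : set T := cell kn (i < k)%N (Ordinal (ltn_pmod i k_gt0)).

Lemma sphere_partition_cells : sphere_partition cells.
Proof.
split.
- by move=> i; exact: measurable_cell.
- move=> i i' _ _ [x [xi xi']]; apply/val_inj.
  have [bb /(congr1 val)/= ii] := cell_disjoint xi xi'.
  have iE (r : 'I_(2 * k)) : val r = ((~~ (r < k)) * k + r %% k)%N.
    have [rk|rk] := ltnP r k; first by rewrite mul0n modn_small.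
    rewrite mul1n -{1}(subnK rk) modnDr modn_small ?subnKC// ltn_subLR//.
    by rewrite addnn -mul2n.
  by rewrite (iE i) (iE i') bb ii.
- apply/seteqP; split => x; first by case=> i _ [].
  move=> /(cell_cover k2 kn) [b [j xc]].
  have ib : ((if b then val j else k + j) < 2 * k)%N.
    by rewrite mul2n -addnn; case: b {xc}; [exact: ltn_addl (ltn_ord j)|rewrite ltn_add2l].
  exists (Ordinal ib) => //; rewrite /cells /=.
  have -> : ((if b then val j else k + j) < k)%N = b.
    by case: b {xc ib}; [exact: ltn_ord j|rewrite ltnNge leq_addr].
  rewrite (_ : Ordinal _ = j)//; apply/val_inj => /=.
  by case: b {xc ib}; rewrite ?modnDl modn_small.
Qed.

(** Symmetry gives the cells one common mass, and 2 k of them make up a set of mass 1. *)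
Lemma equal_measure_cells : equal_measure sigma cells.
Proof.
have [mA tA uA] := sphere_partition_cells.
pose j0 := Ordinal k_gt0.
have e i : sigma (cells i) = sigma (open_cell kn true j0).
  by rewrite /cells sigma_cell_open; exact: sigma_open_cell.
have [r rE] : exists r, sigma (open_cell kn true j0) = r%:E.
  exists (fine (sigma (open_cell kn true j0))); rewrite fineK//.
  by apply: fin_num_measure; exact: measurable_open_cell.
have k20 : (2 * k)%:R != 0 :> R by rewrite pnatr_eq0 muln_eq0/= -lt0n.
have : sigma (\bigcup_i cells i) = ((2 * k)%:R * r)%:E.
  rewrite (measure_bigcup_ord sigma mA tA).
  rewrite (eq_bigr (fun=> r%:E)); last by move=> i _; exact: etrans (e i) rE.
  by rewrite sumEFin sumr_const card_ord -[in LHS]mulr_natl.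
rewrite uA haar.1 => -[h] i; apply: etrans (etrans (e i) rE) _; congr EFin.
by apply: (mulfI k20); rewrite -h divff.
Qed.

Lemma sigma_cell b j : sigma (cell kn b j) = ((2 * k)%:R^-1)%:E.
Proof.
have i0 : (0 < 2 * k)%N by rewrite muln_gt0.
rewrite sigma_cell_open (sigma_open_cell haar k2 kn b (Ordinal i0 < k)%N j
  (Ordinal (ltn_pmod (Ordinal i0) k_gt0))) -sigma_cell_open.
exact: (equal_measure_cells (Ordinal i0)).
Qed.

Lemma restZ (a : R) j x : 0 < a -> rst j (a *: (x : 'rV_n) : T) = a * rst j x.
Proof.
have cZ (c : R) l y : crd l (c *: (y : 'rV_n) : T) = c * crd l y by rewrite /coordk mxE.
have le (c : R) y : 0 < c -> rst j (c *: (y : 'rV_n) : T) <= c * rst j y.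
  move=> c0; apply/restP; first by rewrite mulr_ge0 ?rest_ge0// ltW.
  by move=> l lj; rewrite cZ normrM gtr0_norm// ler_pM2l//; exact: rest_ge.
move=> a0; apply/le_anti; rewrite le//=.
have := le a^-1 (a *: (x : 'rV_n) : T); rewrite invr_gt0 => /(_ a0).
by rewrite scalerA mulVf ?gt_eqF// scale1r mulrC ler_pdivlMr// mulrC.
Qed.

(** The set is a cone, so its Gaussian mass is its [sigma] mass; on the sphere and up to ties it
    consists of two cells of mass 1 / (2 k). *)
Lemma gauss_dominates j : (g (dominates kn j) <= (k%:R^-1)%:E)%E.
Proof.
have mD : measurable (dominates kn j : set T) by exact: measurable_dominates.
have [mt t0] := sigma_ties j.
have mi : measurable_fun setT (fun x : T => (\1_(dominates kn j) x : R)%:E).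
  by apply/measurable_EFinP; exact: measurable_indic.
have -> : g (dominates kn j) = sigma (dominates kn j).
  rewrite -[X in g X]setIT -[X in _ = sigma X]setIT -!integral_indic//.
  apply: etrans _ (integral_direction n2 haar mi _); last by move=> x; rewrite lee_fin.
  apply: eq_integral => x _; rewrite !indicE; congr (nat_of_bool _)%:R%:E.
  have [->|x0] := eqVneq (x : 'rV[R]_n) 0; first by rewrite /direction scaler0.
  have r0 : 0 < (euclid_norm (x : 'rV[R]_n))^-1 by rewrite invr_gt0 euclid_norm_gt0.
  have cE : crd j (direction x) = (euclid_norm (x : 'rV[R]_n))^-1 * crd j x.
    by rewrite /coordk /direction mxE.
  apply/idP/idP; rewrite !inE /dominates /= cE [rst j (direction x)]restZ//;
    by rewrite normrM (gtr0_norm r0) ler_pM2l.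
have mc b : measurable (cell kn b j : set T) by exact: measurable_cell.
rewrite -(sigma_sphereI haar mD).
apply: (@le_trans _ _ (sigma ((cell kn true j `|` cell kn false j) `|` ties j))).
  apply: le_measure; rewrite ?inE.
  - by apply: measurableI => //; exact: measurable_sphere.
  - by apply: measurableU => //; exact: measurableU.
  - move=> x [dx xS]; have [tx|ntx] := pselect (ties j x); [by right|left].
    have := sub_cell xS (dominates_ties dx ntx).
    by case: (0 <= _) => h; [left|right].
apply: (le_trans (sigmaU (measurableU _ _ (mc true) (mc false)) mt)).
rewrite [X in (_ + X)%E]t0 adde0; apply: (le_trans (sigmaU (mc true) (mc false))).
have h : ((2 * k)%:R^-1 + (2 * k)%:R^-1 = k%:R^-1 :> R).
  by rewrite natrM; field; rewrite pnatr_eq0 -lt0n.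
by rewrite -h EFinD; apply: leeD; rewrite [leLHS]sigma_cell.
Qed.
End EqualCells.

(** Markov's inequality for |x|^2, of mean at most 6 n, at the level 16 n. *)
Lemma gauss_ball (R : realType) (n : nat) : (0 < n)%N ->
  ((2^-1)%:E <= gauss R n [set x : borel_rV R n | (euclid_norm x <= 4 * Num.sqrt n%:R)%R])%E.
Proof.
move=> n0; have nR : 0 < n%:R :> R by rewrite ltr0n.
set B := mkset _.
have mB : measurable B by apply: measurable_le => //; exact: measurable_euclid_norm.
have mC : measurable (~` B) by exact: measurableC.
have d0 : 0 <= 16 * n%:R :> R by rewrite mulr_ge0// ltW.
have h : ((16 * n%:R)%:E * gauss R n (~` B) <= (6 * n%:R)%:E)%E.
  apply: (le_trans _ (gauss_dotprod_self R n)); rewrite -integralZ_indic//.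
  apply: le_integral_T.
  - by apply/measurable_EFinP; apply: measurable_funM => //; exact: measurable_indic.
  - by move=> x; rewrite lee_fin mulr_ge0// indicE.
  - by apply/measurable_EFinP; exact: measurable_dotprod_self.
  - move=> x; rewrite lee_fin indicE.
    have [|_] := boolP (x \in _); last by rewrite mulr0 dotprod_ge0.
    rewrite inE /B /= mulr1 => /negP; rewrite -ltNge => h.
    rewrite -euclid_norm_sqr; apply: (@le_trans _ _ ((4 * Num.sqrt n%:R) ^+ 2)).
      by rewrite exprMn sqr_sqrtr ?(ltW nR)// ler_pM2r// -natrX ler_nat.
    by rewrite lerXn2r ?nnegrE ?euclid_norm_ge0 ?mulr_ge0// ltW.
have fC : gauss R n (~` B) \is a fin_num by exact: fin_num_measure.
have fB : gauss R n B \is a fin_num by exact: fin_num_measure.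
have BC : (gauss R n (~` B) = 1 - gauss R n B)%E by exact: probability_setC.
move: h BC; rewrite -(fineK fC) -(fineK fB) -EFinM lee_fin -EFinB => h [BC].
rewrite lee_fin; move: h; rewrite BC; nra.
Qed.

(** * The boundary of the cells of dominating coordinates *)

Section UpperBound.
Context (R : realType) (m k : nat).
Notation n := m.+1.
Notation T := (borel_rV R n).
Notation g := (gauss R n).
Variable sigma : probability T R.
Hypotheses (n2 : (2 <= n)%N) (haar : is_sphere_haar sigma).
Hypotheses (k2 : (2 <= k)%N) (kn : (k <= n)%N).
Notation L := (Num.sqrt (ln k%:R) : R).
Notation crd := (coordk kn).
Notation rst := (rest kn).
Let S : R := Num.sqrt n%:R.
Let k_gt0 : (0 < k)%N. Proof. exact: ltnW. Qed.
Let kR : 0 < k%:R :> R. Proof. by rewrite ltr0n. Qed.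
Let S0 : 0 < S. Proof. by rewrite sqrtr_gt0. Qed.

(** Homogeneity: a gap d for the direction is a gap d |x| for x itself. *)
Let gap_set_scale (j : 'I_k) (d r : R) (x : T) : 0 <= d -> euclid_norm (x : 'rV[R]_n) <= r ->
  gap_set kn j d (direction x) -> gap_set kn j (d * r) x.
Proof.
move=> d0 xr; have [x0|x0] := eqVneq (x : 'rV[R]_n) 0.
  have r0 : 0 <= r := le_trans (euclid_norm_ge0 _) xr.
  rewrite [direction x](_ : _ = x); last by rewrite x0 /direction scaler0.
  move=> [h1 _]; split => //; rewrite x0 /coordk mxE normr0 addr_ge0 ?rest_ge0// mulr_ge0//.
have nx : 0 < euclid_norm (x : 'rV[R]_n) by rewrite euclid_norm_gt0.
have r0 : 0 < (euclid_norm (x : 'rV[R]_n))^-1 by rewrite invr_gt0.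
have cE : crd j (direction x) = (euclid_norm (x : 'rV[R]_n))^-1 * crd j x.
  by rewrite /coordk /direction mxE.
rewrite /gap_set /= cE [rst j (direction x)]restZ// normrM (gtr0_norm r0) ler_pM2l//.
move=> [h1 h2]; split => //.
have := ler_wpM2l (ltW nx) h2.
rewrite mulrDr !mulrA mulfV ?gt_eqF// !mul1r => /le_trans; apply.
by rewrite lerD2l mulrC ler_wpM2l.
Qed.

(** Norm and direction are independent and |x| <= 4 sqrt n has probability at least 1/2, so passing
    to the Gaussian costs a factor 2 and turns the gap d into 4 d sqrt n. There the hazard and
    moment bounds apply. *)
Lemma sigma_gap_set_le (j : 'I_k) (d : R) : 0 <= d ->
  (sigma (gap_set kn j d) <= (2 * (2 * (d * (4 * S)) * expR (3 / 2) * (13 * L / k%:R)))%:E)%E.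
Proof.
move=> d0; pose j0 := Ordinal k_gt0.
rewrite (sigma_gap_set haar kn j j0 d).
have mG : measurable (gap_set kn j0 d : set T) by exact: measurable_gap_set.
have mG' : measurable (gap_set kn j0 (d * (4 * S)) : set T) by exact: measurable_gap_set.
have mD : measurable (dominates kn j0 : set T) by exact: measurable_dominates.
have S40 : 0 <= d * (4 * S) by rewrite mulr_ge0// mulr_ge0// ltW.
pose I := [set r : measurableTypeR R | r <= 4 * S].
have mI : measurable I by apply: measurable_le.
have ball : ((2^-1)%:E <= g [set x : T | I (euclid_norm (x : 'rV_n))])%E by exact: gauss_ball.
have mx := gauss_norm_direction n2 haar mI mG.
have le : (g [set x : T | I (euclid_norm (x : 'rV_n)) /\ gap_set kn j0 d (direction x)] <=
    g (gap_set kn j0 (d * (4 * S))))%E.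
  apply: le_measure; rewrite ?inE//.
    apply: (measurableI [set x : T | I (euclid_norm (x : 'rV_n))]).
      exact: measurable_norm_preimage mI.
    by rewrite -[X in measurable X]setTI; exact: measurable_direction.
  by move=> x [Ix]; exact: gap_set_scale.
have K0 : 0 <= 2 * (d * (4 * S)) * expR (3 / 2) :> R by rewrite mulr_ge0 ?expR_ge0// mulr_ge0.
have gapb : (g (gap_set kn j0 (d * (4 * S))) <=
   (2 * (d * (4 * S)) * expR (3 / 2) * (13 * L / k%:R))%:E)%E.
  apply: (le_trans (@gauss_gap R m k kn j0 _ erefl S40)).
  rewrite [leRHS]EFinM lee_wpmul2l ?lee_fin//.
  by apply: (gauss_first_moment k2 mD); exact: (gauss_dominates n2 haar k2).
have fs : sigma (gap_set kn j0 d) \is a fin_num by exact: fin_num_measure.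
have half : ((2^-1)%:E * sigma (gap_set kn j0 d) <=
   (2 * (d * (4 * S)) * expR (3 / 2) * (13 * L / k%:R))%:E)%E.
  apply: le_trans gapb; apply: le_trans le; rewrite mx.
  by rewrite lee_wpmul2r.
move: half; rewrite -[sigma _](fineK fs) -EFinM !lee_fin; move: (_ * _ / _) => X.
by lra.
Qed.

Let cellA : ('I_(2 * k) -> set T) := cells k2 kn.

(** Within distance e every coordinate changes by at most e. If the largest absolute value exceeded
    the others by more than 2 e, it would itself exceed 2 e, and every point within e would have the
    same dominating coordinate with the same sign. *)
Lemma cell_boundary_gap b j (e : R) : 0 <= e -> e <= 1 ->
  (cell kn b j `&` sphere_nbhd (@sphere R n `\` cell kn b j) e) `<=` gap_set kn j (2 * e).
Proof.
move=> e0 e1 x [xc]; rewrite sphere_nbhdE; [|by move=> y []|by rewrite e0].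
move=> [xS [y [yS nyc] xy]]; have [_ [sg hj _]] := xc.
have close l : `|crd l y - crd l x| <= e.
  have -> : crd l y - crd l x = ((y : 'rV[R]_n) - (x : 'rV[R]_n)) 0 (widen_ord kn l).
    by rewrite !mxE.
  apply: le_trans (coord_le_norm _ _) _.
  rewrite -(@ler_pXn2r _ 2) ?nnegrE ?euclid_norm_ge0// euclid_norm_sqr.
  rewrite dist_sphere// dotprodC; have := cos_ge e0; move: xy => /=.
  by move: (e ^+ 2) (cos e) => E C; lra.
have dx : rst j x <= `|crd j x| by apply/restP => // l _; exact: hj.
split => //; rewrite leNgt; apply/negP => big; apply: nyc.
have r0 := rest_ge0 kn j x.
have cj := close j; have : 2 * e < `|crd j x| by lra.
move=> c2e.
have sgy : (0 <= crd j y) = b /\ rst j x + e < `|crd j y|.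
  rewrite -sg; move: big c2e cj; rewrite ler_norml => + + /andP[].
  have [x0|x0] := leP 0 (crd j x).
    rewrite ger0_norm// => h1 h2 h3 h4; have y0 : 0 <= crd j y by lra.
    by rewrite y0 ger0_norm//; split => //; lra.
  rewrite ltr0_norm// => h1 h2 h3 h4; have y0 : crd j y < 0 by lra.
  by rewrite leNgt y0/= ltr0_norm//; split => //; lra.
have [sy hy] := sgy; rewrite -[X in cell _ X]sy.
apply: sub_cell => // l lj; apply: le_lt_trans hy.
have := close l; have := rest_ge kn x lj.
have := ler_normD (crd l y - crd l x) (crd l x); rewrite subrK; lra.
Qed.

(** The factor 1 / k in the gap bound is cancelled by the sum over 2 k cells, up to a factor 2. *)
Lemma sigma_eps_boundary_cells (e : R) : 0 <= e -> e <= 1 ->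
  (sigma (eps_boundary cellA e) <= (2 * (2 * (2 * (2 * e * (4 * S)) * expR (3 / 2) * (13 * L))))%:E)%E.
Proof.
move=> e0 e1; have e01 : 0 <= e <= 1 by rewrite e0.
have pA := sphere_partition_cells R k2 kn.
rewrite (sigma_eps_boundary sigma pA e01).
set X := 2 * (2 * (2 * e * (4 * S)) * expR (3 / 2) * (13 * L)).
have le i : (sigma (cellA i `&` sphere_nbhd (@sphere R n `\` cellA i) e) <= (X / k%:R)%:E)%E.
  have [j cE] : exists j, cellA i = cell kn (i < k)%N j by eexists.
  have := sigma_gap_set_le j (_ : 0 <= 2 * e).
  rewrite mulr_ge0// => /(_ isT).
  have -> : 2 * (2 * (2 * e * (4 * S)) * expR (3 / 2) * (13 * L / k%:R)) = X / k%:R.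
    by rewrite /X; field; rewrite gt_eqF.
  apply: le_trans; apply: le_measure; rewrite ?inE.
  - exact: measurable_cell_boundary.
  - exact: measurable_gap_set.
  - by rewrite cE; exact: cell_boundary_gap.
apply: (le_trans (lee_sum _ (fun i _ => le i))).
rewrite sumEFin sumr_const card_ord lee_fin -[leLHS]mulr_natl natrM.
by rewrite le_eqVlt; apply/orP; left; apply/eqP; field; rewrite gt_eqF.
Qed.

Lemma limf_einf_right_le (h : R -> \bar R) (l : \bar R) (e0 : R) : 0 < e0 ->
  (forall e, 0 < e -> e < e0 -> (h e <= l)%E) -> (limf_einf h 0^'+ <= l)%E.
Proof.
move=> e00 hl; rewrite /limf_einf leeNl; apply: le_ereal_inf_tmp => _ [V V0 <-].
have [e [Ve [ep ee0]]] : exists e, V e /\ (0 < e /\ e < e0).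
  have : \forall e \near 0^'+, V e /\ (0 < e /\ e < e0).
    near=> e; split; first by near: e.
    by split; near: e; [exact: nbhs_right_gt|exact: nbhs_right_lt].
  by case/(@filter_ex _ _ (at_right_proper_filter _)) => e; exists e.
apply: (@le_trans _ _ (- h e)%E); first by rewrite leeN2; exact: hl.
by apply: ereal_sup_ubound; exists e.
Unshelve. all: by end_near.
Qed.

(** From pi <= 4 follows sqrt n <= 2 sqrt (2 n / pi), whence the factor 2 next to 4 in the
    constant. *)
Lemma boundary_upper_bound :
  (boundary_measure sigma cellA <= (2 * (2 * (2 * (2 * (4 * 2)) * expR (3 / 2) * 13)) * L)%:E)%E.
Proof.
have p0 : 0 < pi :> R by exact: pi_gt0.
have D2 : S <= 2 * Num.sqrt (2 * n%:R / pi).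
  rewrite [X in _ <= X * _](_ : 2 = Num.sqrt (2 ^+ 2)); last by rewrite sqrtr_sqr ger0_norm.
  rewrite -sqrtrM ?sqr_ge0// ler_sqrt ?mulr_ge0 ?sqr_ge0 ?divr_ge0 ?mulr_ge0 ?invr_ge0 ?(ltW p0)//.
  have : pi <= 4 :> R by have /andP[_] := pihalf_02 R; lra.
  move=> pi4; rewrite mulrA ler_pdivlMr// mulrC.
  apply: (le_trans (ler_wpM2r (ler0n _ _) pi4)).
  by have := ler0n R n; move: (n%:R : R) => N; rewrite expr2; lra.
have D0 : 0 < Num.sqrt (2 * n%:R / pi) :> R by rewrite sqrtr_gt0 divr_gt0// mulr_gt0.
apply: (limf_einf_right_le ltr01) => e e0 e1.
have h := sigma_eps_boundary_cells (ltW e0) (ltW e1).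
have De0 : 0 < Num.sqrt (2 * n%:R / pi) * e by rewrite mulr_gt0.
apply: (le_trans (lee_wpmul2r _ h)); first by rewrite lee_fin invr_ge0 ltW.
rewrite -EFinM lee_fin ler_pdivrMr//.
set D := Num.sqrt (2 * n%:R / pi) in D2 D0 De0 *.
have E0 : 0 <= expR (3 / 2) :> R by exact: expR_ge0.
have L0 : 0 <= L by exact: sqrtr_ge0.
have -> : 2 * (2 * (2 * (2 * e * (4 * S)) * expR (3 / 2) * (13 * L))) =
  2 * (2 * (2 * (2 * 4) * expR (3 / 2) * 13)) * L * e * S by ring.
have -> : 2 * (2 * (2 * (2 * (4 * 2)) * expR (3 / 2) * 13)) * L * (D * e) =
  2 * (2 * (2 * (2 * 4) * expR (3 / 2) * 13)) * L * e * (2 * D) by ring.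
apply: ler_wpM2l => //; apply: mulr_ge0; last exact: ltW.
by apply: mulr_ge0 => //; rewrite mulr_ge0// mulr_ge0// mulr_ge0// mulr_ge0.
Qed.
End UpperBound.

Theorem corollary2 (R : realType) :
  exists c C : R, [/\ 0 < c, c < C &
    forall k n : nat, (2 <= k)%N -> (2 <= n)%N ->
    forall sigma : probability (borel_rV R n) R, is_sphere_haar sigma ->
      (forall A : 'I_k -> set (borel_rV R n),
          sphere_partition A -> equal_measure sigma A ->
          ((c * Num.sqrt (ln k%:R))%:E <= boundary_measure sigma A)%E)
      /\
      ((k <= n)%N ->
        exists A : 'I_(2 * k) -> set (borel_rV R n),
          [/\ sphere_partition A, equal_measure sigma A &
              (boundary_measure sigma A <= (C * Num.sqrt (ln k%:R))%:E)%E])].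
Proof.
have C0 : 0 < C_inv R by rewrite ltr_pwDl// mulr_ge0// expR_ge0.
pose c := (5 * (2 + 128 * 4) * C_inv R)^-1.
pose C : R := 2 * (2 * (2 * (2 * (4 * 2)) * expR (3 / 2) * 13)).
have c0 : 0 < c by rewrite invr_gt0 mulr_gt0// mulr_gt0// addr_gt0// mulr_gt0.
have C1 : 0 < C.
  by rewrite mulr_gt0// mulr_gt0// mulr_gt0// mulr_gt0 ?expR_gt0// mulr_gt0// mulr_gt0// mulr_gt0.
(* The upper constant is c + C, which makes c < C immediate. Since n >= 2, the dimension is a
   successor, the form in which the bounds are stated. *)
exists c, (c + C); split; rewrite ?ltrDl// => k [//|m] k2 n2 sigma haar; split.
  by move=> A pA eA; exact: boundary_lower_bound.
move=> kn; exists (cells k2 kn); split.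
- exact: sphere_partition_cells.
- exact: equal_measure_cells.
- apply: le_trans (boundary_upper_bound n2 haar k2 kn) _.
  by rewrite lee_fin ler_wpM2r ?sqrtr_ge0// lerDr ltW.
Qed.
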